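(* Suppose Assumption PLM (stated in the context) holds, and let $K=K_n$ be a sequence with $K^{2(\alpha_g+\alpha_h)}/n\to\infty$ as $n\to\infty$, where $\alpha_g,\alpha_h>0$ are the exponents in part (e) of Assumption PLM. If $\mathbb{E}[\varepsilon_i^2|x_i,z_i]=\sigma_\varepsilon^2$ (a constant), then $$s^2\rightarrow_p\sigma_\varepsilon^2\qquad\text{and}\qquad \hat\Sigma_n^{\mathrm{HOM}}-\Sigma_n\rightarrow_p0,\qquad\text{where }\hat\Sigma_n^{\mathrm{HOM}}=s^2\hat\Gamma_n.$$
   Context: Model. For $i=1,\ldots,n$, $(y_i,x_i',z_i')'$ satisfies the partially linear model $y_i=x_i'\beta_0+g(z_i)+\varepsilon_i$ with $\mathbb{E}[\varepsilon_i|x_i,z_i]=0$, where $y_i$ is scalar, $x_i\in\mathbb{R}^d$, $z_i\in\mathbb{R}^{d_z}$, $\beta_0\in\mathbb{R}^d$, $g(\cdot)$ is an unknown function, and $\mathbb{E}[\mathbb{V}[x_i|z_i]]$ has full rank. Write $g_i=g(z_i)$, $h_i=h(z_i)=\mathbb{E}[x_i|z_i]$, $v_i=x_i-h_i$, and $Z=[z_1,\ldots,z_n]'$. Series estimator. Let $p^1(z),p^2(z),\ldots$ be real-valued approximating functions, $p_K(z)=(p^1(z),\ldots,p^K(z))'$, $P_K=[p_K(z_1),\ldots,p_K(z_n)]'$ (an $n\times K$ matrix), and $M=I_n-P_K(P_K'P_K)^{-1}P_K'$ with $(i,j)$-th element $M_{ij}$. The number of terms $K=K_n$ may depend on $n$.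 The estimator is $$\hat\beta=\Big(\sum_{1\le i,j\le n}M_{ij}x_ix_j'\Big)^{-1}\Big(\sum_{1\le i,j\le n}M_{ij}x_iy_j\Big)$$ (defined on the event that the inverse exists). Also $$\hat\Gamma_n=\frac1n\sum_{1\le i,j\le n}M_{ij}x_ix_j',\qquad s^2=\frac{1}{n-d-K}\sum_{1\le i\le n}\hat\varepsilon_i^2,\qquad \hat\varepsilon_i=\sum_{1\le j\le n}M_{ij}(y_j-\hat\beta'x_j).$$ Assumption PLM. (a) $(y_i,x_i',z_i')'$, $i=1,\ldots,n$, is a random sample (i.i.d.). (b) There is a $C<\infty$ such that $\mathbb{E}[\varepsilon_i^4|x_i,z_i]\le C$ and $\mathbb{E}[\|v_i\|^4|z_i]\le C$. (c) There is a $C>0$ such that $\mathbb{E}[\varepsilon_i^2|x_i,z_i]\ge C$ and $\lambda_{\min}(\mathbb{E}[v_iv_i'|z_i])\ge C$. (d) $\operatorname{rank}(P_K)=K$ (a.s.) and there is a $C>0$ such that $M_{ii}\ge C$. (e) For some $\alpha_g,\alpha_h>0$, there is a $C<\infty$ such that $$\min_{\eta_g\in\mathbb{R}^K}\mathbb{E}[|g(z_i)-\eta_g'p_K(z_i)|^2]\le CK^{-2\alpha_g},\qquad \min_{\eta_h\in\mathbb{R}^{K\times d}}\mathbb{E}[\|h(z_i)-\eta_h'p_K(z_i)\|^2]\le CK^{-2\alpha_h}.$$ Here $\|\cdot\|$ is the Euclidean norm and $\lambda_{\min}$ the smallest eigenvalue; the constants $C$ do not depend on $i$, $n$, or $K$,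 and statements involving conditional expectations hold almost surely. Variance quantity. $$\Sigma_n=\frac1n\mathbb{V}\Big[\sum_{1\le i,j\le n}M_{ij}v_i\varepsilon_j\Big|Z\Big]=\frac1n\sum_{1\le i\le n}M_{ii}^2\mathbb{E}[v_iv_i'\varepsilon_i^2|z_i]+\frac1n\sum_{1\le i,j\le n,\,j\ne i}M_{ij}^2\mathbb{E}[v_iv_i'\varepsilon_j^2|z_i,z_j].$$ All limits are as $n\to\infty$. It is not assumed that $K/n\to0$. *)

(* Defs.v *)
(* MathComp / MathComp-Analysis *)
From HB Require Import structures.
From mathcomp Require Import all_boot all_order all_algebra.
From mathcomp Require Import all_classical all_reals all_analysis.

Set Implicit Arguments.
Unset Strict Implicit.
Unset Printing Implicit Defensive.

Import Order.TTheory GRing.Theory Num.Theory.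
Import numFieldNormedType.Exports.

Local Open Scope classical_set_scope.
Local Open Scope ring_scope.

Section Probability.
Context {dO : measure_display} {Omega : measurableType dO} {R : realType}.
Variable P : probability Omega R.

(* Y is a version of z |-> E[X | W = z]: Y \o W is a version of E[X | W].     *)
Definition is_cond_expectation {dS} {S : measurableType dS}
    (W : Omega -> S) (X : Omega -> R) (Y : S -> R) : Prop :=
  [/\ measurable_fun setT W,
      P.-integrable setT (EFin \o X),
      measurable_fun setT Y,
      P.-integrable setT (EFin \o (Y \o W)) &
      forall B, measurable B ->
        (\int[P]_(w in W @^-1` B) (X w)%:E =
         \int[P]_(w in W @^-1` B) (Y (W w))%:E)%E].

Definition is_cond_expectation_mx {dS} {S : measurableType dS} {m n : nat}
    (W : Omega -> S) (X : Omega -> 'M[R]_(m, n)) (Y : S -> 'M[R]_(m, n)) : Prop :=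
  forall a b, is_cond_expectation W (fun w => X w a b) (fun s => Y s a b).

(* V is a version of the conditional variance matrix of X given W.            *)
Definition is_cond_variance {dS} {S : measurableType dS} {m : nat}
    (W : Omega -> S) (X : Omega -> 'cV[R]_m) (V : S -> 'M[R]_m) : Prop :=
  exists mu : S -> 'cV[R]_m,
    is_cond_expectation_mx W X mu /\
    is_cond_expectation_mx W
      (fun w => (X w - mu (W w)) *m (X w - mu (W w))^T) V.

Definition iid {dS} {S : measurableType dS} (X : nat -> Omega -> S) : Prop :=
  [/\ forall i, measurable_fun setT (X i),
      forall i A, measurable A -> P (X i @^-1` A) = P (X 0%N @^-1` A) &
      forall (I : seq nat) (A : nat -> set S), uniq I ->
        (forall i, measurable (A i)) ->
        (P (\bigcap_(i in [set` I]) (X i @^-1` A i)) =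
         \prod_(i <- I) P (X i @^-1` A i))%E].

(* Convergence in probability to l of a sequence whose n-th term is defined   *)
(* only on the event D n: outside D n the term counts as far from l.          *)
Definition cvg_in_prob {V : normedZmodType R} (D : nat -> set Omega)
    (X : nat -> Omega -> V) (l : V) : Prop :=
  forall e : R, 0 < e ->
    (fun n => P (~` (D n `&` [set w | `|X n w - l| <= e]))) @ \oo --> 0%E.

End Probability.

Section LinearAlgebra.
Context {R : realType}.

Definition enorm {m : nat} (u : 'cV[R]_m) : R :=
  Num.sqrt (\sum_a (u a ord0) ^+ 2).

Definition dotv {m : nat} (u v : 'cV[R]_m) : R := (u^T *m v) ord0 ord0.

(* Meant for symmetric A, whose eigenvalues form a finite set of reals, so    *)
(* that the infimum is the smallest of them.                                  *)
Definition lambda_min {m : nat} (A : 'M[R]_m) : R :=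
  inf [set a | eigenvalue A a].

Definition col_of_tuple {m : nat} (t : m.-tuple R) : 'cV[R]_m :=
  \col_a tnth t a.

End LinearAlgebra.

(* f attains its minimum, and this minimum is at most c.                      *)
Definition min_le {R : realType} {T : Type} (f : T -> \bar R) (c : \bar R) :=
  exists2 t, (forall t', (f t <= f t')%E) & (f t <= c)%E.

Section Estimator.
Context {R : realType} {n d : nat}.

Definition annihilator {k : nat} (B : 'M[R]_(n, k)) : 'M[R]_n :=
  1%:M - B *m invmx (B^T *m B) *m B^T.

Variables (M : 'M[R]_n) (x : 'I_n -> 'cV[R]_d) (y : 'I_n -> R).

Definition gram : 'M[R]_d := \sum_i \sum_j M i j *: (x i *m (x j)^T).

(* Only meaningful when gram \in unitmx.                                      *)
Definition beta_hat : 'cV[R]_d :=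
  invmx gram *m (\sum_i \sum_j (M i j * y j) *: x i).

Definition Gamma_hat : 'M[R]_d := n%:R^-1 *: gram.

Definition residual (i : 'I_n) : R :=
  \sum_j M i j * (y j - dotv beta_hat (x j)).

Definition s2 (k : nat) : R :=
  (n%:R - d%:R - k%:R)^-1 * \sum_i (residual i) ^+ 2.

Definition Sigma_HOM (k : nat) : 'M[R]_d := s2 k *: Gamma_hat.

End Estimator.

Section PartiallyLinearModel.
Context {dO : measure_display} {Omega : measurableType dO} {R : realType}.
Variables (P : probability Omega R) (d dz : nat).
(* Observations are indexed from 0; p k is the (k+1)-st approximating         *)
(* function.                                                                  *)
Variables (y : nat -> {RV P >-> R}) (x : nat -> {RV P >-> d.-tuple R})
  (z : nat -> {RV P >-> dz.-tuple R}).
Variables (beta0 : 'cV[R]_d) (g : {mfun (dz.-tuple R) >-> R})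
  (h : dz.-tuple R -> 'cV[R]_d) (p : nat -> {mfun (dz.-tuple R) >-> R}).

Definition xc (i : nat) (w : Omega) : 'cV[R]_d := col_of_tuple (x i w).

(* The equation y_i = x_i' beta0 + g(z_i) + eps_i is the definition of eps_i. *)
Definition eps (i : nat) (w : Omega) : R :=
  y i w - dotv (xc i w) beta0 - g (z i w).

Definition v (i : nat) (w : Omega) : 'cV[R]_d := xc i w - h (z i w).

Definition xz (i : nat) (w : Omega) : (d.-tuple R * dz.-tuple R)%type :=
  (x i w, z i w).

Definition obs (i : nat) (w : Omega)
  : (R * (d.-tuple R * dz.-tuple R))%type := (y i w, xz i w).

Definition Z (n : nat) (w : Omega) : n.-tuple (dz.-tuple R) :=
  [tuple z i w | i < n].

Record model : Prop := {
  model_eps : forall i, is_cond_expectation P (xz i) (eps i) (cst 0);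
  model_h : forall i, is_cond_expectation_mx P (z i) (xc i) h;
  model_rank : forall i, exists2 V : dz.-tuple R -> 'M[R]_d,
    is_cond_variance P (z i) (xc i) V &
    \rank (\matrix_(a, b) fine ('E_P[fun w => V (z i w) a b])%E) = d
}.

Definition pvec (k : nat) (t : dz.-tuple R) : 'cV[R]_k := \col_j p j t.

Definition Pmx (n k : nat) (w : Omega) : 'M[R]_(n, k) :=
  \matrix_(i, j) p j (z i w).

Definition Mmx (n k : nat) (w : Omega) : 'M[R]_n := annihilator (Pmx n k w).

(* The conditions involving both n and K n are required for all large n:     *)
(* rank K n is impossible when n < K n, and M_ii >= C > 0 when n = K n > 0.   *)
(* The bound M_ii >= C is required with probability tending to 1. It cannot   *)
(* hold almost surely for some n with K n >= 2 under random sampling and      *)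
(* almost sure rank K n: pick non-parallel points a, b in the support of      *)
(* p_K(z_i). With positive probability p_K(z_1) is as near b and the other    *)
(* p_K(z_j) as near a as desired, and then M_11 is as near 0 as desired. The  *)
(* almost sure bound would imply the one below.                               *)
Record assumption_PLM (K : nat -> nat) (alpha_g alpha_h : R) : Prop := {
  PLM_a : iid P obs;
  PLM_b : exists C : R, forall i,
    (exists2 m4 : d.-tuple R * dz.-tuple R -> R,
       is_cond_expectation P (xz i) (fun w => eps i w ^+ 4) m4 &
       {ae P, forall w, m4 (xz i w) <= C}) /\
    (exists2 m4 : dz.-tuple R -> R,
       is_cond_expectation P (z i) (fun w => enorm (v i w) ^+ 4) m4 &
       {ae P, forall w, m4 (z i w) <= C});
  PLM_c : exists2 C : R, 0 < C & forall i,
    (exists2 m2 : d.-tuple R * dz.-tuple R -> R,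
       is_cond_expectation P (xz i) (fun w => eps i w ^+ 2) m2 &
       {ae P, forall w, C <= m2 (xz i w)}) /\
    (exists2 V : dz.-tuple R -> 'M[R]_d,
       is_cond_expectation_mx P (z i) (fun w => v i w *m (v i w)^T) V &
       {ae P, forall w, C <= lambda_min (V (z i w))});
  PLM_d :
    (\forall n \near \oo, {ae P, forall w, \rank (Pmx n (K n) w) = K n}) /\
    exists2 C : R, 0 < C &
      (fun n => P [set w | forall i : 'I_n, C <= Mmx n (K n) w i i]) @ \oo
        --> 1%E;
  PLM_e : 0 < alpha_g /\ 0 < alpha_h /\
    exists C : R, \forall n \near \oo, forall i,
      min_le (fun eta : 'cV[R]_(K n) =>
          ('E_P[fun w => (`|g (z i w) - dotv eta (pvec (K n) (z i w))| ^+ 2)%R])%E)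
        (C * (K n)%:R `^ (- 2 * alpha_g))%:E /\
      min_le (fun eta : 'M[R]_(K n, d) =>
          ('E_P[fun w =>
             (enorm (h (z i w) - eta^T *m pvec (K n) (z i w)) ^+ 2)%R])%E)
        (C * (K n)%:R `^ (- 2 * alpha_h))%:E
}.

Definition score (n k : nat) (w : Omega) : 'cV[R]_d :=
  \sum_(i < n) \sum_(j < n) (Mmx n k w i j * eps j w) *: v i w.

(* The event on which the estimator is defined.                               *)
Definition defined (n k : nat) : set Omega :=
  [set w | gram (Mmx n k w) (fun i : 'I_n => xc i w) \in unitmx].

Definition s2_plm (n k : nat) (w : Omega) : R :=
  s2 (Mmx n k w) (fun i : 'I_n => xc i w) (fun i : 'I_n => y i w) k.

Definition Sigma_HOM_plm (n k : nat) (w : Omega) : 'M[R]_d :=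
  Sigma_HOM (Mmx n k w) (fun i : 'I_n => xc i w) (fun i : 'I_n => y i w) k.

End PartiallyLinearModel.

(* Main.v *)
Require Import Defs.
From HB Require Import structures.
From mathcomp Require Import all_boot all_order all_algebra.
From mathcomp Require Import all_classical all_reals all_analysis.
From mathcomp Require Import measurable_realfun.
From mathcomp Require Import ring lra.

Set Implicit Arguments.
Unset Strict Implicit.
Unset Printing Implicit Defensive.

Import Order.TTheory GRing.Theory Num.Theory.
Import numFieldNormedType.Exports.

Local Open Scope classical_set_scope.
Local Open Scope ring_scope.

(** Write M for the annihilator matrix of the approximating functions, v_i for
    the part of x_i left after conditioning on z_i, and eps_i for the error.
    Every random quantity in the theorem is built from quadratic forms
    n^-1 * u' M w, where u and w stack errors, coordinates of the v_i, values of
    g, or coordinates of h at the sample points, and the theorem follows from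
    the limits of these forms.

    The matrix M depends only on z_1, ..., z_n, is symmetric and idempotent, and
    hence has entries in [-1, 1] and rows whose squares sum to the diagonal
    entry.  If u_i and w_i are centred given z_i and independent across i,
    then u' M w minus sum_i M_ii E[u_i w_i | z_i] has second moment O(n)
    ([quadratic_form_sqr]): off the diagonal the form splits into two
    strictly triangular ones, each a sum of orthogonal terms, because the term
    of the largest index is a centred variable times a factor known without it
    ([orthogonality], [triangular_form_sqr]).

    If u stacks values of g or h, then M annihilates the best approximation
    of u, so that n^-1 * u' M u is at most the mean squared approximation error.
    The growth condition forces K to infinity, and this bias vanishes
    ([sieve_bias_cvg0]).  Mixed forms are handled by Cauchy-Schwarz
    ([form_cross_cvg0]).  Therefore
      - n^-1 * x' M x is asymptotic to n^-1 * sum_i M_ii E[v_i v_i' | z_i], which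
        is bounded and bounded below as a quadratic form ([Gamma_cvg],
        [gram_pos_def]);
      - n^-1 * x' M (g + eps) tends to 0 ([cross_cvg]);
      - n^-1 * (g + eps)' M (g + eps) is asymptotic to sigma^2 * (n - K) / n
        ([disturbance_cvg]).
    By least squares algebra the residual sum of squares differs from
    (g + eps)' M (g + eps) by at most a multiple of n times the squared norm of
    the second form ([residual_sum_sqr_bounds]), which gives s^2 -> sigma^2.

    Finally, under homoskedasticity sum_j M_ij^2 = M_ii turns the conditional
    variance of the score into sigma^2 * sum_i M_ii E[v_i v_i' | z_i]
    ([score_variance]), so Sigma_n is almost surely sigma^2 times the limit of
    Gamma-hat found above.

    Convergence in probability is expressed as convergence along a filter on
    pairs (sample size, outcome) ([inprob]), so the usual calculus of limits
    applies to random sequences. *)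

(** * Integrable functions and pulling out measurable factors *)

Section Integrability.
Context {d : measure_display} {T : measurableType d} {R : realType}.
Variable P : probability T R.
Local Notation L1 f := (P.-integrable setT (EFin \o f)).

Lemma L1_measurable (f : T -> R) : L1 f -> measurable_fun setT f.
Proof. by move=> if1; apply/measurable_EFinP; exact: measurable_int if1. Qed.

Lemma L1D (f g : T -> R) : L1 f -> L1 g -> L1 (fun w => f w + g w).
Proof. exact: integrableD. Qed.

Lemma L1B (f g : T -> R) : L1 f -> L1 g -> L1 (fun w => f w - g w).
Proof. exact: integrableB. Qed.

Lemma L1Z (c : R) (f : T -> R) : L1 f -> L1 (fun w => c * f w).
Proof. exact: integrableZl. Qed.

Lemma L1_cst (c : R) : L1 (fun=> c).
Proof. exact: finite_measure_integrable_cst. Qed.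

Lemma L1_sum I (s : seq I) (f : I -> T -> R) :
  (forall i, L1 (f i)) -> L1 (fun w => \sum_(i <- s) f i w).
Proof.
move=> Lf; elim: s => [|i s IH].
  by under eq_fun do rewrite big_nil; exact: L1_cst.
by under eq_fun do rewrite big_cons; exact: L1D.
Qed.

Lemma le_L1 (f g : T -> R) : measurable_fun setT f -> L1 g ->
  (forall w, `|f w| <= g w) -> L1 f.
Proof.
move=> mf Lg fg; apply: (le_integrable measurableT _ _ Lg).
  exact/measurable_EFinP.
by move=> w _ /=; rewrite lee_fin (le_trans (fg w))// ler_norm.
Qed.

Lemma Rintegral_sum I (s : seq I) (f : I -> T -> R) :
  (forall i, L1 (f i)) ->
  \int[P]_w (\sum_(i <- s) f i w) = \sum_(i <- s) \int[P]_w f i w.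
Proof.
move=> Lf; elim: s => [|i s IH].
  rewrite big_nil -[RHS](mul0r (fine (P setT))) -Rintegral_cst//.
  by apply: eq_Rintegral => w _; rewrite big_nil.
rewrite big_cons -IH -RintegralD//; last exact: L1_sum.
by apply: eq_Rintegral => w _; rewrite big_cons.
Qed.

Lemma L1_bounded_mul (f U : T -> R) (c : R) : L1 f -> measurable_fun setT U ->
  (forall w, `|U w| <= c) -> L1 (fun w => U w * f w).
Proof.
move=> if1 mU bU.
have mf := L1_measurable if1.
apply: (@le_L1 _ (fun w => c * `|f w|)) => //.
- exact: measurable_funM.
- apply: L1Z; exact: integrable_norm.
- by move=> w; rewrite normrM ler_wpM2r.
Qed.

Lemma L1_indic_mul (f : T -> R) A : L1 f -> measurable A -> L1 (fun w => \1_A w * f w).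
Proof.
move=> if1 mA; apply: (@L1_bounded_mul _ _ 1) => //.
by move=> w; rewrite indicE; case: (_ \in _); rewrite ?normr1 ?normr0.
Qed.

Lemma Rintegral_indic_mul (f : T -> R) A :
  \int[P]_w (\1_A w * f w) = \int[P]_(w in A) f w.
Proof.
rewrite [RHS]Rintegral_mkcond; apply: eq_Rintegral => w _; rewrite patchE indicE.
by case: ifP => wA; rewrite ?mul1r ?mul0r.
Qed.

Section Pullout.
Variables (G : set (set T)).
Hypotheses (mG : G `<=` measurable) (GI : setI_closed G).
Variable D : T -> R.
Hypothesis L1D' : L1 D.
Hypothesis D0 : \int[P]_w D w = 0.
Hypothesis DG : forall A, G A -> \int[P]_w (\1_A w * D w) = 0.

Lemma sigma_measurable A : <<s G >> A -> measurable A.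
Proof. by move: A; apply: smallest_sub => //; exact: sigma_algebra_measurable. Qed.

(** Dynkin's argument: the sets over which [D] integrates to 0 are stable under
    complements and disjoint countable unions. *)
Lemma integral0_sigma A : <<s G >> A -> \int[P]_w (\1_A w * D w) = 0.
Proof.
move: A; apply: (@dynkin_induction _ (g_sigma_algebraType G) G) => //.
- by rewrite -[RHS]D0; apply: eq_Rintegral => w _; rewrite indicT mul1r.
- move=> S /sigma_measurable mS S0.
  have : \int[P]_w (\1_S w * D w + \1_(~` S) w * D w) = 0.
    rewrite -[RHS]D0; apply: eq_Rintegral => w _; rewrite -mulrDl.
    by rewrite !indicE in_setC; case: (w \in S); rewrite /= ?addr0 ?add0r mul1r.
  rewrite RintegralD//; last 2 first.
    exact: L1_indic_mul.
    by apply: L1_indic_mul => //; exact: measurableC.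
  by rewrite S0 add0r.
- move=> F mF tF F0; rewrite Rintegral_indic_mul /Rintegral.
  have mF' n : d.-measurable (F n : set T) by apply: sigma_measurable; exact: mF.
  rewrite integral_bigcup//; last first.
    by apply: (integrableS measurableT) => //; exact: bigcupT_measurable.
  rewrite eseries0//= => n _ _; have := F0 n; rewrite Rintegral_indic_mul /Rintegral.
  move=> h; rewrite -[LHS]fineK ?h//; apply: integrable_fin_num => //.
  exact: integrableS L1D'.
Qed.

Import HBNNSimple.

(** [U] is an increasing limit of simple functions that are measurable for the
    generated sigma-algebra, and dominated convergence applies because these
    stay below [U]. *)
Let pullout_ge0 (U : T -> R) :
  @measurable_fun _ _ (g_sigma_algebraType G) R setT U -> (forall w, 0 <= U w) ->
  L1 (fun w => U w * D w) -> \int[P]_w (U w * D w) = 0.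
Proof.
move=> mU U0 LUD.
have mEU : measurable_fun setT (EFin \o U : g_sigma_algebraType G -> _).
  exact/measurable_EFinP.
pose f n := nnsfun_approx measurableT mEU n.
have fle n w : f n w <= U w.
  rewrite -lee_fin /f nnsfun_approxE; apply: le_approx => // x _.
  by rewrite lee_fin.
have mfib n r : d.-measurable (f n @^-1` [set r] : set T).
  by apply: sigma_measurable; rewrite -[f n @^-1` _]setTI; exact: (measurable_funP (f n)).
have mfn n : measurable_fun setT (f n : T -> R).
  move=> _ Y mY; rewrite setTI; apply: sigma_measurable.
  by have := measurable_funP (f n) measurableT Y mY; rewrite setTI.
have f0 n : (\int[P]_w ((f n w * D w)%:E))%E = 0%E.
  have ifib r : L1 (fun w => \1_(f n @^-1` [set r]) w * D w).
    exact: L1_indic_mul.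
  rewrite (@eq_integral _ T _ _ _
      (fun w : T => \sum_(r <- finmap.enum_fset (fset_set (range (f n))))
      (r%:E * (\1_(f n @^-1` [set r]) w * D w)%:E)))%E; last first.
    move=> w _; under [RHS]eq_bigr do rewrite -EFinM; rewrite sumEFin; congr EFin.
    rewrite (fimfunE (f n)) fsbig_finite//= mulr_suml.
    by apply: eq_bigr => r _; rewrite mulrA.
  rewrite integral_sum//; last first.
    by move=> r; apply: integrableZl => //; exact: ifib.
  rewrite big1// => r _; rewrite integralZl//; last exact: ifib.
  rewrite -[X in (_ * X)%E]fineK; last by apply: integrable_fin_num => //; exact: ifib.
  have := @integral0_sigma (f n @^-1` [set r]); rewrite /Rintegral => ->; first by rewrite mule0.
  by rewrite -[f n @^-1` _]setTI; exact: (measurable_funP (f n)).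
have mD : measurable_fun setT D by exact: L1_measurable L1D'.
have [] := @dominated_convergence _ _ _ P setT measurableT
   (fun n w => (f n w * D w)%:E) (fun w => (U w * D w)%:E) (fun w => `|U w * D w|%:E).
- by move=> n; apply/measurable_EFinP; exact: measurable_funM.
- exact: measurable_int LUD.
- apply: aeW => w _; apply: cvg_EFin; first exact: nearW.
  apply: cvgM; last exact: cvg_cst.
  have h : (fun n => (f n w)%:E) @ \oo --> (U w)%:E.
    by apply: (@cvg_nnsfun_approx _ _ _ _ measurableT _ mEU) => // x _; rewrite lee_fin.
  exact: fine_cvg h.
- exact: integrable_abse LUD.
- apply: aeW => w n _ /=; rewrite lee_fin !normrM ler_wpM2r//.
  by rewrite !ger0_norm.
move=> _ _; rewrite (_ : [sequence _]_n = cst 0%E); last first.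
  by apply/funext => n; rewrite /= f0.
by move=> /cvg_lim => /(_ (@ereal_hausdorff R)); rewrite lim_cst// /Rintegral => <-.
Qed.

(** This is the rule E[U D] = E[U E[D | G]] in the case E[D | G] = 0, under the
    sole integrability of [U D]: [U] may be unbounded, which products of errors
    and regressors require. *)
Lemma integral0_pullout (U : T -> R) :
  @measurable_fun _ _ (g_sigma_algebraType G) R setT U ->
  L1 (fun w => U w * D w) -> \int[P]_w (U w * D w) = 0.
Proof.
move=> mU LUD.
have mU' : measurable_fun setT U.
  move=> _ Y mY; rewrite setTI; apply: sigma_measurable.
  by have := mU measurableT Y mY; rewrite setTI.
have mD : measurable_fun setT D by exact: L1_measurable L1D'.
have mp : measurable_fun setT (U^\+) by exact: measurable_funrpos.
have mn : measurable_fun setT (U^\-) by exact: measurable_funrneg.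
have ip : L1 (fun w => U^\+ w * D w).
  apply: (@le_integrable _ _ _ _ _ measurableT _ (EFin \o (fun w => U w * D w))) => //.
    by apply/measurable_EFinP; exact: measurable_funM.
  move=> w _; rewrite lee_fin !normrM ler_wpM2r//.
  by rewrite /funrpos; case: (leP (U w) 0) => h; rewrite ?normr0.
have im : L1 (fun w => U^\- w * D w).
  apply: (@le_integrable _ _ _ _ _ measurableT _ (EFin \o (fun w => U w * D w))) => //.
    by apply/measurable_EFinP; exact: measurable_funM.
  move=> w _; rewrite lee_fin !normrM ler_wpM2r//.
  by rewrite /funrneg; case: (leP (- U w) 0) => h; rewrite ?normr0 ?normrN.
rewrite (@eq_Rintegral _ _ _ _ _ (fun w => U^\+ w * D w - U^\- w * D w)); last first.
  by move=> w _; rewrite -mulrBl -{1}(funrposBneg U).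
rewrite RintegralB// !pullout_ge0 ?subr0//.
exact: measurable_funrneg.
exact: measurable_funrpos.
Qed.
End Pullout.
End Integrability.

(** * Independent samples and leave-one-out orthogonality *)

Section IndependentSample.
Context {d : measure_display} {T : measurableType d} {R : realType}.
Variable P : probability T R.
Local Notation L1 f := (P.-integrable setT (EFin \o f)).
Context {dS : measure_display} {S : measurableType dS}.
Variable X : nat -> T -> S.
Hypothesis mX : forall i, measurable_fun setT (X i).
Hypothesis indX : forall (I : seq nat) (A : nat -> set S), uniq I ->
  (forall i, measurable (A i)) ->
  (P (\bigcap_(i in [set` I]) (X i @^-1` A i)) =
   \prod_(i <- I) P (X i @^-1` A i))%E.

Lemma Rintegral_indic (A : set T) : measurable A ->
  \int[P]_w (\1_A w : R) = fine (P A).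
Proof. by move=> mA; rewrite /Rintegral integral_indic// setIT. Qed.

Lemma Rintegral_cstT (c : R) : \int[P]_w c = c.
Proof. by rewrite /Rintegral integral_cst//= probability_setT mule1. Qed.

Lemma measurable_preimage {dU} {U : measurableType dU} (f : T -> U) (A : set U) :
  measurable_fun setT f -> measurable A -> measurable (f @^-1` A).
Proof. by move=> mf mA; rewrite -[_ @^-1` _]setTI; exact: mf. Qed.

Definition rect (I : seq nat) (A : nat -> set S) : set T :=
  \bigcap_(i in [set` I]) (X i @^-1` A i).

Lemma measurable_rect I A : (forall i, measurable (A i)) -> measurable (rect I A).
Proof.
move=> mA; rewrite /rect bigcap_mkcond.
apply: bigcapT_measurable => i; case: ifPn => // _.
exact: measurable_preimage.
Qed.

(** Independence says that the indicator of the rectangle minus its probability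
    integrates to 0 over all events of [X j]; pulling out [phi (X j)] turns this
    statement about events into one about functions. *)
Lemma integral_rect (j : nat) (I : seq nat) (A : nat -> set S) (phi : S -> R) :
  uniq (j :: I) -> (forall i, measurable (A i)) -> measurable_fun setT phi ->
  L1 (phi \o X j) ->
  \int[P]_w (\1_(rect I A) w * phi (X j w)) =
  fine (P (rect I A)) * \int[P]_w phi (X j w).
Proof.
move=> uI mA mphi Lphi.
have mI := measurable_rect I mA; set C := rect I A in mI *.
set c := fine (P C).
have fC : (P C = c%:E) by rewrite fineK// fin_num_measure.
pose G : set (set T) := [set B | exists2 A, measurable A & B = X j @^-1` A].
have mG : G `<=` measurable by move=> _ [B mB ->]; exact: measurable_preimage.
have LC : L1 (\1_C : T -> R) by exact: integrable_indic.
have Lc : L1 (cst c) by exact: finite_measure_integrable_cst.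
have LD : L1 (fun w => \1_C w - c) by apply: L1B => //; exact: L1_cst.
have D0 : \int[P]_w (\1_C w - c) = 0.
  by rewrite RintegralB// Rintegral_indic// Rintegral_cstT subrr.
have LUC := L1_indic_mul Lphi mI.
have LUc : L1 (fun w => c * phi (X j w)) by exact: L1Z.
have : \int[P]_w (phi (X j w) * (\1_C w - c)) = 0.
  apply: (@integral0_pullout _ _ _ P G) => //.
  - move=> _ _ [B1 m1 ->] [B2 m2 ->]; exists (B1 `&` B2) => //; exact: measurableI.
  - move=> _ [B mB ->].
    have mXB := measurable_preimage (mX j) mB.
    rewrite (@eq_Rintegral _ _ _ _ _ (fun w => \1_(X j @^-1` B `&` C) w -
        c * \1_(X j @^-1` B) w)); last first.
      by move=> w _; rewrite indicI/= mulrBr [in RHS](mulrC c).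
    rewrite RintegralB//; last 2 first.
    + by apply: integrable_indic => //; exact: measurableI.
    + by apply: L1Z; exact: integrable_indic.
    rewrite RintegralZl//; last exact: integrable_indic.
    rewrite !Rintegral_indic//; last exact: measurableI.
    pose A' i := if i == j then B else A i.
    have mA' i : measurable (A' i) by rewrite /A'; case: ifP.
    have A'j : A' j = B by rewrite /A' eqxx.
    have CA' : C = rect I A'.
      apply: eq_bigcapr => i /= iI; rewrite /A'; case: eqP => // ij.
      by move: uI; rewrite /= -ij iI.
    have -> : X j @^-1` B `&` C = rect (j :: I) A'.
      by rewrite CA' /rect [RHS]bigcap_seq big_cons -bigcap_seq A'j.
    rewrite /rect indX// big_cons -(indX (I := I))//; last by case/andP: uI.
    rewrite -/(rect I A') -CA' fC A'j fineM//; last exact: fin_num_measure.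
    by rewrite mulrC subrr.
  - move=> _ Y mY; rewrite setTI; apply: sub_sigma_algebra.
    exists (phi @^-1` Y) => //; by rewrite -[_ @^-1` _]setTI; exact: mphi.
  - rewrite (_ : (fun w => _) = (fun w => \1_C w * phi (X j w) - c * phi (X j w))).
      exact: L1B.
    by apply/funext => w /=; rewrite mulrBr mulrC (mulrC c).
rewrite (@eq_Rintegral _ _ _ _ _ (fun w => \1_C w * phi (X j w) - c * phi (X j w))); last first.
  by move=> w _; rewrite mulrBr mulrC (mulrC c).
by rewrite RintegralB// RintegralZl// => /eqP; rewrite subr_eq0 => /eqP.
Qed.

Context {dW : measure_display} {SW : measurableType dW}.
Variables (W : S -> SW) (n j : nat).
Hypothesis mW : measurable_fun setT W.

Definition others := [seq k <- iota 0 n | k != j].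

Lemma uniq_others : uniq (j :: others).
Proof. by rewrite /= filter_uniq ?iota_uniq// mem_filter eqxx. Qed.

(** A pi-system generating the information carried by the observations of index
    below [n] other than [j], together with the statistic [W] of observation [j]. *)
Definition leave_one_out_rect : set (set T) :=
  [set C | exists B A, [/\ measurable B, forall k, measurable (A k) &
     C = (W \o X j) @^-1` B `&` rect others A]].

Definition leave_one_out := g_sigma_algebraType leave_one_out_rect.

Lemma leave_one_out_stat : measurable_fun setT (W \o X j : leave_one_out -> SW).
Proof.
move=> _ B mB; rewrite setTI; apply: sub_sigma_algebra.
exists B, (fun=> setT); split => //.
by rewrite /rect (_ : \bigcap_(i in _) _ = setT) ?setIT//; apply/seteqP; split.
Qed.

Lemma leave_one_out_obs k : (k < n)%N -> k != j -> measurable_fun setT (X k : leave_one_out -> S).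
Proof.
move=> kn kj _ B mB; rewrite setTI; apply: sub_sigma_algebra.
exists setT, (fun i => if i == k then B else setT); split => //.
  by move=> i; case: ifP.
rewrite preimage_setT setTI; apply/seteqP; split => w /=.
  by move=> BX i /= _; case: ifPn => // /eqP ->.
move=> /(_ k); rewrite /= eqxx; apply.
by rewrite mem_filter kj mem_iota.
Qed.

Lemma leave_one_out_measurable {dU} {U : measurableType dU} (f : T -> U) :
  measurable_fun setT (f : leave_one_out -> U) -> measurable_fun setT f.
Proof.
move=> mf _ B mB; rewrite setTI.
have := mf measurableT B mB; rewrite setTI; apply: sigma_measurable.
move=> _ [B' [A [mB' mA ->]]]; apply: measurableI; last exact: measurable_rect.
by apply: measurable_preimage => //; exact: measurableT_comp.
Qed.

(** A function of observation [j] that is centred given [W (X j)] stays centred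
    when all other observations are added to the information.  On the
    generating rectangles this is independence, and [integral0_pullout] extends
    it to every factor known without the rest of observation [j]. *)
Theorem orthogonality (phi : S -> R) (U : T -> R) :
  measurable_fun setT phi -> L1 (phi \o X j) ->
  (forall B, measurable B -> \int[P]_w (\1_B (W (X j w)) * phi (X j w)) = 0) ->
  measurable_fun setT (U : leave_one_out -> R) -> L1 (fun w => U w * phi (X j w)) ->
  \int[P]_w (U w * phi (X j w)) = 0.
Proof.
move=> mphi Lphi h mU LU.
apply: (@integral0_pullout _ _ _ P leave_one_out_rect) => //.
- move=> _ [B [A [mB mA ->]]]; apply: measurableI; last exact: measurable_rect.
  by apply: measurable_preimage => //; exact: measurableT_comp.
- move=> _ _ [B [A [mB mA ->]]] [B' [A' [mB' mA' ->]]].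
  exists (B `&` B'), (fun k => A k `&` A' k); split.
  + exact: measurableI.
  + by move=> k; exact: measurableI.
  + by rewrite setIACA -preimage_setI /rect -bigcapI.
- rewrite -[RHS](h setT)//; apply: eq_Rintegral => w _.
  by rewrite indicT mul1r.
- move=> _ [B [A [mB mA ->]]].
  have mphi' : measurable_fun setT (fun s => \1_B (W s) * phi s).
    have mI : measurable_fun setT (\1_B : SW -> R) by exact: measurable_indic.
    by apply: measurable_funM => //; exact: measurableT_comp mI mW.
  transitivity (\int[P]_w (\1_(rect others A) w * (\1_B (W (X j w)) * phi (X j w)))).
    by apply: eq_Rintegral => w _; rewrite indicI/= [in LHS](mulrC (\1_ _ w)) -mulrA.
  have mWB : measurable ((W \o X j) @^-1` B).
    by apply: measurable_preimage => //; exact: measurableT_comp.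
  rewrite (@integral_rect j others A (fun s => \1_B (W s) * phi s)) ?uniq_others//.
    by rewrite h// mulr0.
  exact: L1_indic_mul Lphi mWB.
Qed.

End IndependentSample.

(** * Functions with integrable powers *)

Section PowerIntegrable.
Context {d : measure_display} {T : measurableType d} {R : realType}.
Variable P : probability T R.
Local Notation L1 f := (P.-integrable setT (EFin \o f)).

(** Used for even [k] only, where it is membership in L^k without an absolute
    value. *)
Definition pow_integrable (k : nat) (f : T -> R) :=
  measurable_fun setT f /\ L1 (fun w => f w ^+ k).
Local Notation L2 := (pow_integrable 2).
Local Notation L4 := (pow_integrable 4).

Lemma L2_L1 f : L2 f -> L1 f.
Proof.
move=> [mf f2]; apply: (@le_L1 _ _ _ _ _ (fun w => 1 + f w ^+ 2)) => //.
  by apply: L1D => //; exact: L1_cst.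
move=> w; rewrite ler_norml; have := sqr_ge0 (f w - 1); have := sqr_ge0 (f w + 1).
by move=> h1 h2; apply/andP; split; nra.
Qed.

Lemma L4_L2 f : L4 f -> L2 f.
Proof.
move=> [mf f4]; split=> //.
apply: (@le_L1 _ _ _ _ _ (fun w => 1 + f w ^+ 4)).
- exact: measurable_funX.
- by apply: L1D => //; exact: L1_cst.
- move=> w; rewrite ger0_norm ?sqr_ge0//.
  have := sqr_ge0 (f w ^+ 2 - 1); have := sqr_ge0 (f w); nra.
Qed.

Lemma L2M f g : L2 f -> L2 g -> L1 (fun w => f w * g w).
Proof.
move=> [mf f2] [mg g2]; apply: (@le_L1 _ _ _ _ _ (fun w => f w ^+ 2 + g w ^+ 2)).
- exact: measurable_funM.
- exact: L1D.
- move=> w; rewrite ler_norml.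
  have := sqr_ge0 (f w - g w); have := sqr_ge0 (f w + g w).
  by move=> h1 h2; apply/andP; split; nra.
Qed.

Lemma L4M f g : L4 f -> L4 g -> L2 (fun w => f w * g w).
Proof.
move=> [mf f4] [mg g4]; split; first exact: measurable_funM.
apply: (@le_L1 _ _ _ _ _ (fun w => f w ^+ 4 + g w ^+ 4)).
- by apply: measurable_funX; exact: measurable_funM.
- exact: L1D.
- move=> w; rewrite ger0_norm ?sqr_ge0//.
  have := sqr_ge0 (f w ^+ 2 - g w ^+ 2); have := sqr_ge0 (f w ^+ 2 + g w ^+ 2); nra.
Qed.

Lemma L2D f g : L2 f -> L2 g -> L2 (fun w => f w + g w).
Proof.
move=> [mf f2] [mg g2]; split; first exact: measurable_funD.
apply: (@le_L1 _ _ _ _ _ (fun w => 2 * f w ^+ 2 + 2 * g w ^+ 2)).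
- by apply: measurable_funX; exact: measurable_funD.
- by apply: L1D; exact: L1Z.
- by move=> w; rewrite ger0_norm ?sqr_ge0//; have := sqr_ge0 (f w - g w); nra.
Qed.

Lemma L4D f g : L4 f -> L4 g -> L4 (fun w => f w + g w).
Proof.
move=> [mf f4] [mg g4]; split; first exact: measurable_funD.
apply: (@le_L1 _ _ _ _ _ (fun w => 8 * f w ^+ 4 + 8 * g w ^+ 4)).
- by apply: measurable_funX; exact: measurable_funD.
- by apply: L1D; exact: L1Z.
- move=> w; set x := f w; set y := g w.
  have xy2 : (x + y) ^+ 2 <= 2 * (x ^+ 2 + y ^+ 2) by have := sqr_ge0 (x - y); nra.
  have : ((x + y) ^+ 2) ^+ 2 <= (2 * (x ^+ 2 + y ^+ 2)) ^+ 2.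
    by rewrite ler_sqr// nnegrE ?sqr_ge0// mulr_ge0// addr_ge0 ?sqr_ge0.
  have : (x ^+ 2 + y ^+ 2) ^+ 2 <= 2 * (x ^+ 4 + y ^+ 4).
    have := sqr_ge0 (x ^+ 2 - y ^+ 2); nra.
  rewrite ger0_norm; last by rewrite -[4%N]/(2 * 2)%N exprM sqr_ge0.
  by rewrite -[in (x + y) ^+ 4](_ : 2 * 2 = 4)%N// exprM; nra.
Qed.

Lemma L4_cst c : L4 (fun=> c).
Proof. by split; [exact: measurable_cst|exact: L1_cst]. Qed.

Lemma L2_cst c : L2 (fun=> c).
Proof. by split; [exact: measurable_cst|exact: L1_cst]. Qed.

Lemma L2_sum I (s : seq I) (f : I -> T -> R) :
  (forall i, L2 (f i)) -> L2 (fun w => \sum_(i <- s) f i w).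
Proof.
move=> Lf; elim: s => [|i s IH].
  by under eq_fun do rewrite big_nil; exact: L2_cst.
by under eq_fun do rewrite big_cons; exact: L2D.
Qed.

Lemma L4_sum I (s : seq I) (f : I -> T -> R) :
  (forall i, L4 (f i)) -> L4 (fun w => \sum_(i <- s) f i w).
Proof.
move=> Lf; elim: s => [|i s IH].
  by under eq_fun do rewrite big_nil; exact: L4_cst.
by under eq_fun do rewrite big_cons; exact: L4D.
Qed.

Lemma pow_integrable_bounded_mul k (U f : T -> R) (c : R) : pow_integrable k f ->
  measurable_fun setT U -> (forall w, `|U w| <= c) ->
  pow_integrable k (fun w => U w * f w).
Proof.
move=> [mf fk] mU Uc; split; first exact: measurable_funM.
under eq_fun do rewrite exprMn.
apply: (@L1_bounded_mul _ _ _ _ _ _ (c ^+ k)) => //.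
  exact: measurable_funX.
by move=> w; rewrite normrX lerXn2r// nnegrE (le_trans _ (Uc w)).
Qed.

Lemma L4_bounded (U : T -> R) (c : R) :
  measurable_fun setT U -> (forall w, `|U w| <= c) -> L4 U.
Proof.
move=> mU Uc; rewrite (_ : U = fun w => U w * 1); last first.
  by apply/funext => w; rewrite mulr1.
exact: (pow_integrable_bounded_mul (L4_cst 1) mU Uc).
Qed.

Lemma orthogonal_sum_sqr n (Y : 'I_n -> T -> R) : (forall i, L2 (Y i)) ->
  (forall i j : 'I_n, (j < i)%N -> \int[P]_w (Y i w * Y j w) = 0) ->
  \int[P]_w ((\sum_i Y i w) ^+ 2) = \sum_i \int[P]_w (Y i w ^+ 2).
Proof.
move=> LY Y0.
transitivity (\int[P]_w (\sum_i \sum_j Y i w * Y j w)).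
  by apply: eq_Rintegral => w _; rewrite expr2 big_distrlr.
have LYY i j : L1 (fun w => Y i w * Y j w) by exact: L2M.
rewrite Rintegral_sum; last by move=> i; exact: L1_sum.
apply: eq_bigr => i _; rewrite Rintegral_sum// (bigD1 i)//= [X in _ + X]big1 ?addr0//.
move=> j ji; have [ij|] := ltnP j i; first exact: Y0.
rewrite leq_eqVlt => /predU1P[/val_inj ij|ij]; first by rewrite ij eqxx in ji.
rewrite -[RHS](Y0 j i ij); apply: eq_Rintegral => w _; exact: mulrC.
Qed.

End PowerIntegrable.

(** * Versions of conditional expectations *)

Section ConditionalExpectation.
Context {d : measure_display} {T : measurableType d} {R : realType}.
Variable P : probability T R.
Local Notation L1 f := (P.-integrable setT (EFin \o f)).
Context {dS : measure_display} {S : measurableType dS}.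
Variable W : T -> S.

Lemma cond_expectation_orth (X : T -> R) (Y : S -> R) (B : set S) :
  is_cond_expectation P W X Y -> measurable B ->
  \int[P]_w (\1_B (W w) * (X w - Y (W w))) = 0.
Proof.
move=> [mW LX mY LY XY] mB.
have mWB := measurable_preimage mW mB.
transitivity (\int[P]_w (\1_(W @^-1` B) w * X w - \1_(W @^-1` B) w * Y (W w))).
  by apply: eq_Rintegral => w _; rewrite -mulrBr.
rewrite RintegralB//; [|exact: L1_indic_mul..].
by rewrite !Rintegral_indic_mul /Rintegral XY// subrr.
Qed.

Lemma cond_expectation_of_orth (X : T -> R) (Y : S -> R) :
  measurable_fun setT W -> L1 X -> measurable_fun setT Y -> L1 (Y \o W) ->
  (forall B, measurable B -> \int[P]_w (\1_B (W w) * (X w - Y (W w))) = 0) ->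
  is_cond_expectation P W X Y.
Proof.
move=> mW LX mY LY XY; split => // B mB.
have mWB := measurable_preimage mW mB.
have LWB f : L1 f -> P.-integrable (W @^-1` B) (EFin \o f) by exact: integrableS.
rewrite -[LHS]fineK; last by apply: integrable_fin_num => //; exact: (LWB X).
rewrite -[RHS]fineK; last by apply: integrable_fin_num => //; exact: (LWB _ LY).
congr EFin; apply/eqP; rewrite -subr_eq0 -(XY B mB).
rewrite (@eq_Rintegral _ _ _ _ _ (fun w => \1_(W @^-1` B) w * X w -
    \1_(W @^-1` B) w * Y (W w))); last first.
  by move=> w _; rewrite -mulrBr.
rewrite RintegralB//; [|exact: L1_indic_mul..].
by rewrite !Rintegral_indic_mul.
Qed.

Lemma is_cond_expectation_cst c : measurable_fun setT W ->
  is_cond_expectation P W (cst c) (cst c).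
Proof.
by move=> mW; split => //; exact: L1_cst.
Qed.

Lemma is_cond_expectationD (f g : T -> R) (f' g' : S -> R) :
  is_cond_expectation P W f f' -> is_cond_expectation P W g g' ->
  is_cond_expectation P W (fun w => f w + g w) (fun s => f' s + g' s).
Proof.
move=> [mW Lf mf' Lf' hf] [_ Lg mg' Lg' hg]; split => //.
- exact: L1D.
- exact: measurable_funD.
- exact: L1D.
- move=> B mB; have mWB := measurable_preimage mW mB.
  have LL h : L1 h -> P.-integrable (W @^-1` B) (EFin \o h) by exact: integrableS.
  by rewrite !integralD_EFin//; [|exact: LL..]; rewrite hf// hg.
Qed.

Lemma is_cond_expectationZ (k : R) (f : T -> R) (f' : S -> R) :
  is_cond_expectation P W f f' ->
  is_cond_expectation P W (fun w => k * f w) (fun s => k * f' s).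
Proof.
move=> [mW Lf mf' Lf' hf]; split => //.
- exact: L1Z.
- exact: measurable_funM.
- exact: L1Z.
- move=> B mB; have mWB := measurable_preimage mW mB.
  have LL h : L1 h -> P.-integrable (W @^-1` B) (EFin \o h) by exact: integrableS.
  have ZE h : L1 h ->
      (\int[P]_(w in W @^-1` B) (k * h w)%:E = k%:E * \int[P]_(w in W @^-1` B) (h w)%:E)%E.
    by move=> Lh; rewrite -integralZl//; exact: LL.
  by rewrite (ZE f)// (ZE (f' \o W))// hf.
Qed.

Lemma is_cond_expectationB (f g : T -> R) (f' g' : S -> R) :
  is_cond_expectation P W f f' -> is_cond_expectation P W g g' ->
  is_cond_expectation P W (fun w => f w - g w) (fun s => f' s - g' s).
Proof.
move=> hf /(is_cond_expectationZ (-1)) hg.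
under eq_fun do rewrite -mulN1r; under [X in is_cond_expectation _ _ _ X]eq_fun do rewrite -mulN1r.
exact: is_cond_expectationD.
Qed.

Lemma ae_eq_L1 (f g : T -> R) : measurable_fun setT g ->
  {ae P, forall w, f w = g w} -> L1 f -> L1 g.
Proof.
move=> mg fg Lf; have mf := L1_measurable Lf.
move: (Lf) => /integrableP[_ Lf']; apply/integrableP; split.
  exact/measurable_EFinP.
apply: le_lt_trans Lf'; rewrite le_eqVlt; apply/orP; left; apply/eqP.
apply: ae_eq_integral => //=.
- by apply/measurable_EFinP; exact: measurableT_comp.
- by apply/measurable_EFinP; exact: measurableT_comp.
- by apply: filterS fg => w -> _.
Qed.

Lemma ae_is_cond_expectation (X X' : T -> R) (Y Y' : S -> R) :
  measurable_fun setT X' -> measurable_fun setT Y' ->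
  {ae P, forall w, X w = X' w} -> {ae P, forall w, Y (W w) = Y' (W w)} ->
  is_cond_expectation P W X Y -> is_cond_expectation P W X' Y'.
Proof.
move=> mX' mY' XX' YY' [mW LX mY LY XY].
have mYW' : measurable_fun setT (Y' \o W) by exact: measurableT_comp.
have mYW : measurable_fun setT (Y \o W) by exact: measurableT_comp.
have mX := L1_measurable LX.
split => //.
- exact: ae_eq_L1 LX.
- exact: (@ae_eq_L1 (Y \o W)).
- move=> B mB; have mWB := measurable_preimage mW mB.
  transitivity (\int[P]_(w in W @^-1` B) (X w)%:E)%E.
    apply: ae_eq_integral => //.
    + by apply/measurable_EFinP; exact: measurable_funTS.
    + by apply/measurable_EFinP; exact: measurable_funTS.
    + by apply: filterS XX' => w -> _.
  rewrite XY//; apply: ae_eq_integral => //.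
  + by apply/measurable_EFinP; exact: measurable_funTS.
  + by apply/measurable_EFinP; exact: measurable_funTS.
  + by apply: filterS YY' => w -> _.
Qed.

Lemma Rintegral_eq0_ae (f : T -> R) : L1 f -> (forall w, 0 <= f w) ->
  \int[P]_w f w <= 0 -> {ae P, forall w, f w = 0}.
Proof.
move=> Lf f0 If; have mf := L1_measurable Lf.
have : ae_eq P setT (EFin \o f) (cst 0%E).
  apply/ae_eq_integral_abs => //; first exact/measurable_EFinP.
  have I0 : \int[P]_w f w = 0 by apply/eqP; rewrite eq_le If Rintegral_ge0.
  under eq_integral do rewrite /= ger0_norm//.
  rewrite -[LHS]fineK; last exact: integrable_fin_num.
  by rewrite -/(Rintegral P setT f) I0.
by apply: filterS => w /(_ I) [].
Qed.

(** On the event that the versions are in the wrong order their difference is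
    nonnegative, and its integral equals that of [X1 - X2], which is at most 0. *)
Lemma cond_expectation_mono (X1 X2 : T -> R) (Y1 Y2 : S -> R) :
  is_cond_expectation P W X1 Y1 -> is_cond_expectation P W X2 Y2 ->
  {ae P, forall w, X1 w <= X2 w} -> {ae P, forall w, Y1 (W w) <= Y2 (W w)}.
Proof.
move=> h1 h2 X12; have h := is_cond_expectationB h1 h2.
pose B : set S := [set s | Y2 s < Y1 s].
have [mW LX mY LY _] := h.
have mB : measurable B.
  have [_ _ m1 _ _] := h1; have [_ _ m2 _ _] := h2.
  rewrite -[B]setTI (_ : B = (fun s => Y2 s < Y1 s) @^-1` [set true]).
    exact: measurable_fun_ltr.
  by apply/seteqP; split => s /=.
have mWB := measurable_preimage mW mB.
pose f w := \1_B (W w) * (Y1 (W w) - Y2 (W w)).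
have Lf : L1 f by exact: L1_indic_mul LY mWB.
have LX' : L1 (fun w => \1_B (W w) * (X1 w - X2 w)) by exact: L1_indic_mul LX mWB.
have : {ae P, forall w, f w = 0}.
  apply: Rintegral_eq0_ae => //.
    move=> w; rewrite /f indicE; case: (boolP (_ \in _)) => [|_]; last by rewrite mul0r.
    by rewrite inE /B/= mul1r subr_ge0 => /ltW.
  have := cond_expectation_orth h mB.
  rewrite (@eq_Rintegral _ _ _ _ _ (fun w => \1_B (W w) * (X1 w - X2 w) - f w)); last first.
    by move=> w _; rewrite mulrBr.
  rewrite RintegralB// => /eqP; rewrite subr_eq0 => /eqP <-.
  pose g w := \1_B (W w) * (X2 w - X1 w).
  have Lg : L1 g.
    rewrite (_ : g = fun w => -1 * (\1_B (W w) * (X1 w - X2 w))); first exact: L1Z.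
    by apply/funext => w; rewrite /g; ring.
  rewrite (@eq_Rintegral _ _ _ _ _ (fun w => -1 * g w)); last first.
    by move=> w _; rewrite /g; ring.
  rewrite RintegralZl// mulN1r oppr_le0 /Rintegral.
  have -> : (\int[P]_w (g w)%:E = \int[P]_w `|g w|%:E)%E.
    apply: ae_eq_integral => //.
    - exact: measurable_int Lg.
    - by apply/measurable_EFinP; apply: measurableT_comp => //; exact: L1_measurable Lg.
    - apply: filterS X12 => w X12 _; congr EFin; rewrite ger0_norm//.
      by rewrite /g mulr_ge0// subr_ge0.
  by rewrite fine_ge0// integral_ge0// => w _; rewrite lee_fin.
apply: filterS => w; rewrite /f indicE; case: (boolP (_ \in _)) => [_|].
  by rewrite mul1r => /eqP; rewrite subr_eq0 => /eqP ->.
by move=> WB _; rewrite leNgt; apply/negP => h'; move: WB; rewrite notin_setE; apply.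
Qed.

Lemma cond_expectation_unique (X : T -> R) (Y1 Y2 : S -> R) :
  is_cond_expectation P W X Y1 -> is_cond_expectation P W X Y2 ->
  {ae P, forall w, Y1 (W w) = Y2 (W w)}.
Proof.
move=> h1 h2.
have le12 := cond_expectation_mono h1 h2 (aeW P (fun w => lexx (X w))).
have le21 := cond_expectation_mono h2 h1 (aeW P (fun w => lexx (X w))).
by apply: filterS2 le12 le21 => w h12 h21; apply/eqP; rewrite eq_le h12.
Qed.

(** The preimages under [W] form a pi-system, so [integral0_pullout] applies. *)
Lemma cond_expectation_pullout0 (X u : T -> R) (v : S -> R) :
  is_cond_expectation P W X (cst 0) -> measurable_fun setT v ->
  (forall w, u w = v (W w)) -> L1 (fun w => u w * X w) ->
  \int[P]_w (u w * X w) = 0.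
Proof.
move=> h mv uv Lu; have [mW LX _ _ _] := h.
pose G : set (set T) := [set A | exists2 B, measurable B & A = W @^-1` B].
have X0 B : measurable B -> \int[P]_w (\1_B (W w) * X w) = 0.
  move=> mB; rewrite -[RHS](cond_expectation_orth h mB).
  by apply: eq_Rintegral => w _; rewrite subr0.
apply: (@integral0_pullout _ _ _ P G) => //.
- by move=> _ [B mB ->]; exact: measurable_preimage.
- by move=> _ _ [B1 m1 ->] [B2 m2 ->]; exists (B1 `&` B2) => //; exact: measurableI.
- rewrite -[RHS](X0 setT)//; apply: eq_Rintegral => w _.
  by rewrite indicT mul1r.
- by move=> _ [B mB ->]; exact: X0.
- move=> _ Y mY; rewrite setTI; apply: sub_sigma_algebra.
  exists (v @^-1` Y); first exact: measurable_preimage.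
  by rewrite (_ : u = v \o W)//; exact/funext.
Qed.

End ConditionalExpectation.

(** Constants are measurable for every statistic, so the tower property needs no
    new version here. *)
Lemma coarser_cond_expectation {d : measure_display} {T : measurableType d}
    {R : realType} (P : probability T R)
    {dS dS' : measure_display} {S : measurableType dS} {S' : measurableType dS'}
    (W : T -> S) (f : S -> S') (X : T -> R) (c : R) :
  measurable_fun setT f ->
  is_cond_expectation P W X (cst c) -> is_cond_expectation P (f \o W) X (cst c).
Proof.
move=> mf [mW LX mY LY XY]; split => //; first exact: measurableT_comp.
by move=> B mB; exact: (XY (f @^-1` B) (measurable_preimage mf mB)).
Qed.

(** * Quadratic forms in conditionally centred noise *)

Section QuadraticForm.
Context {d : measure_display} {T : measurableType d} {R : realType}.
Variable P : probability T R.
Local Notation L1 f := (P.-integrable setT (EFin \o f)).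
Local Notation L2 := (pow_integrable P 2).
Local Notation L4 := (pow_integrable P 4).

Context {dS : measure_display} {S : measurableType dS}.
Variable X : nat -> T -> S.
Hypothesis mX : forall i, measurable_fun setT (X i).
Hypothesis indX : forall (I : seq nat) (A : nat -> set S), uniq I ->
  (forall i, measurable (A i)) ->
  (P (\bigcap_(i in [set` I]) (X i @^-1` A i)) =
   \prod_(i <- I) P (X i @^-1` A i))%E.
Context {dW : measure_display} {SW : measurableType dW}.
Variable zeta : S -> SW.
Hypothesis mzeta : measurable_fun setT zeta.

(** The variables to which the weights of a quadratic form are applied: centred
    given [zeta], with a bounded conditional variance.  The version [m2] of the
    conditional second moment is bounded everywhere and not just almost surely,
    so that products with it are integrable. *)
Record noise (kappa : R) (a : nat -> S -> R) : Prop := {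
  noise_measurable : forall i, measurable_fun setT (a i);
  noise_L4 : forall i, L4 (a i \o X i);
  noise_le : forall i, \int[P]_w (a i (X i w) ^+ 4) <= kappa;
  noise_mean0 : forall i, is_cond_expectation P (zeta \o X i) (a i \o X i) (cst 0);
  noise_var : forall i, exists2 m2 : SW -> R,
    is_cond_expectation P (zeta \o X i) (fun w => a i (X i w) ^+ 2) m2 &
    forall t, `|m2 t| <= kappa }.

Variable n : nat.
Local Notation known j f := (measurable_fun setT (f : leave_one_out X zeta n j -> R)).

Lemma known_noise kappa a i j : noise kappa a -> (i < n)%N -> i != j ->
  known j (fun w => a i (X i w)).
Proof.
move=> na iltn ij; apply: (@measurableT_comp _ _ _ _ _ _ (a i)).
  exact: noise_measurable na i.
exact: leave_one_out_obs.
Qed.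

Lemma known_stat j (f : SW -> R) i : measurable_fun setT f -> (i < n)%N ->
  known j (fun w => f (zeta (X i w))).
Proof.
move=> mf iltn; apply: (@measurableT_comp _ _ _ _ _ _ f) => //.
have [->|ij] := eqVneq i j; first exact: leave_one_out_stat.
apply: (@measurableT_comp _ _ _ _ _ _ zeta) => //; exact: leave_one_out_obs.
Qed.

Lemma noise_orth kappa a j (U : T -> R) : noise kappa a -> known j U -> L2 U ->
  \int[P]_w (U w * a j (X j w)) = 0.
Proof.
move=> na mU LU; have La := L4_L2 (noise_L4 na j).
apply: (@orthogonality _ _ _ P _ _ X mX indX _ _ zeta n j mzeta) => //.
- exact: noise_measurable na j.
- exact: L2_L1.
- move=> B mB; rewrite -[RHS](cond_expectation_orth (noise_mean0 na j) mB).
  by apply: eq_Rintegral => w _; rewrite subr0.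
- exact: L2M.
Qed.

(** [a j ^+ 2] minus its conditional second moment is centred given [zeta], hence
    orthogonal to the known factor [U ^+ 2]. *)
Lemma noise_second_moment kappa a j (U : T -> R) : noise kappa a -> known j U ->
  L4 U ->
  \int[P]_w ((U w * a j (X j w)) ^+ 2) <= kappa * \int[P]_w (U w ^+ 2).
Proof.
move=> na mU LU; have LU2 := L4_L2 LU.
have [m2 h2 b2] := noise_var na j; have [_ _ mm2 Lm2 _] := h2.
have LUa := L4M LU (noise_L4 na j).
have mzX : measurable_fun setT (zeta \o X j) by exact: measurableT_comp.
have LUm : L1 (fun w => U w ^+ 2 * m2 (zeta (X j w))).
  rewrite (_ : (fun _ => _) = (fun w => m2 (zeta (X j w)) * U w ^+ 2)); last first.
    by apply/funext => w; rewrite mulrC.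
  apply: (@L1_bounded_mul _ _ _ _ _ _ kappa) => //; first exact: (proj2 LU2).
  exact: measurableT_comp mm2 mzX.
have : \int[P]_w (U w ^+ 2 * (a j (X j w) ^+ 2 - m2 (zeta (X j w)))) = 0.
  apply: (@orthogonality _ _ _ P _ _ X mX indX _ _ zeta n j mzeta
    (fun s => a j s ^+ 2 - m2 (zeta s)) (fun w => U w ^+ 2)) => //.
  - apply: measurable_funB; last exact: measurableT_comp.
    by apply: measurable_funX; exact: noise_measurable na j.
  - by apply: L1B => //; exact: (proj2 (L4_L2 (noise_L4 na j))).
  - by move=> B mB; exact: cond_expectation_orth h2 mB.
  - exact: measurable_funX.
  - rewrite (_ : (fun _ => _) = (fun w => (U w * a j (X j w)) ^+ 2 - U w ^+ 2 * m2 (zeta (X j w)))).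
      by apply: L1B => //; exact: (proj2 LUa).
    by apply/funext => w; rewrite mulrBr exprMn.
rewrite (@eq_Rintegral _ _ _ _ _ (fun w => (U w * a j (X j w)) ^+ 2 -
    U w ^+ 2 * m2 (zeta (X j w)))); last first.
  by move=> w _; rewrite mulrBr exprMn.
rewrite RintegralB//; last exact: (proj2 LUa).
move/eqP; rewrite subr_eq0 => /eqP ->.
rewrite -RintegralZl//; last exact: (proj2 LU2).
apply: le_Rintegral => //; first by apply: L1Z; exact: (proj2 LU2).
move=> w _; rewrite mulrC ler_wpM2r ?sqr_ge0//.
exact: le_trans (ler_norm _) (b2 _).
Qed.

(** Strictly triangular weights make the quadratic form a martingale in its second
    index.  Only the squares of its increments contribute to the second moment,
    and conditional variances bound these. *)
Section Triangular.
Variable N : 'I_n -> 'I_n -> T -> R.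
Hypothesis N0 : forall (i j : 'I_n) w, (j <= i)%N -> N i j w = 0.
Hypothesis mN : forall i j k : 'I_n, known k (N i j).
Hypothesis N1 : forall i j w, `|N i j w| <= 1.
Hypothesis NN : forall j w, \sum_i N i j w ^+ 2 <= 1.

Let mN' i j : measurable_fun setT (N i j).
Proof. exact: (leave_one_out_measurable mX mzeta (@mN i j j)). Qed.

Let LN i j : L4 (N i j).
Proof. exact: L4_bounded (mN' i j) (N1 i j). Qed.

Let A (a : nat -> S -> R) (j : 'I_n) w := \sum_i N i j w * a i (X i w).

Let LA kappa a j : noise kappa a -> L4 (A a j).
Proof.
move=> na; apply: L4_sum => i.
by apply: pow_integrable_bounded_mul (N1 i j) => //; exact: noise_L4 na i.
Qed.

Let known_A kappa a (j l : 'I_n) : noise kappa a -> (l <= j)%N -> known j (A a l).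
Proof.
move=> na lj; apply: (@measurable_sum _ (leave_one_out X zeta n j)) => i.
have [/N0 Nil|il] := leqP l i.
  rewrite (_ : (fun _ => _) = cst 0); first exact: measurable_cst.
  by apply/funext => w; rewrite Nil mul0r.
apply: measurable_funM; first exact: mN.
apply: (known_noise na) => //; by rewrite neq_ltn (leq_trans il lj).
Qed.

Let A_sqr kappa a j : noise kappa a ->
  \int[P]_w (A a j w ^+ 2) <= kappa * \int[P]_w (\sum_i N i j w ^+ 2).
Proof.
move=> na.
have LNa i : L4 (fun w => N i j w * a i (X i w)).
  by apply: pow_integrable_bounded_mul (N1 i j) => //; exact: noise_L4 na i.
rewrite orthogonal_sum_sqr; last 2 first.
- by move=> i; exact: L4_L2.
- move=> i k ki.
  rewrite (@eq_Rintegral _ _ _ _ _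
      (fun w => (N i j w * (N k j w * a k (X k w))) * a i (X i w))); last first.
    by move=> w _; rewrite mulrAC.
  apply: (noise_orth na).
    apply: measurable_funM; first exact: mN.
    apply: measurable_funM; first exact: mN.
    by apply: (known_noise na) => //; rewrite neq_ltn ki.
  exact: L4M.
rewrite Rintegral_sum; last by move=> i; exact: (proj2 (L4_L2 (LN i j))).
rewrite mulr_sumr; apply: ler_sum => i _.
exact: (noise_second_moment na).
Qed.

(** The term of index [j] is [b j] times a sum over smaller indices.  Against a
    term of smaller index, [b j] is the only factor that involves the unknown
    part of observation [j], so the product integrates to 0.  The same argument
    inside the inner sum leaves [kappa] times the squared column norm of [N]. *)
Lemma triangular_form_sqr kappa a b : noise kappa a -> noise kappa b ->
  L2 (fun w => \sum_j (\sum_i N i j w * a i (X i w)) * b j (X j w)) /\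
  \int[P]_w ((\sum_j (\sum_i N i j w * a i (X i w)) * b j (X j w)) ^+ 2)
    <= kappa ^+ 2 * n%:R.
Proof.
move=> na nb.
have k0 : 0 <= kappa.
  apply: le_trans (noise_le na 0); apply: Rintegral_ge0 => w _.
  by rewrite -[4%N]/(2 * 2)%N exprM sqr_ge0.
have LAb (j : 'I_n) : L2 (fun w => A a j w * b j (X j w)).
  apply: L4M; [exact: LA na|exact: noise_L4 nb j].
split; first exact: L2_sum.
rewrite orthogonal_sum_sqr//; last first.
  move=> j l lj.
  rewrite (@eq_Rintegral _ _ _ _ _
      (fun w => (A a j w * (A a l w * b l (X l w))) * b j (X j w))); last first.
    by move=> w _; rewrite mulrAC.
  apply: (@orthogonality _ _ _ P _ _ X mX indX _ _ zeta n j mzeta (b j)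
      (fun w => A a j w * (A a l w * b l (X l w)))) => //.
  - exact: noise_measurable nb j.
  - by apply/L2_L1/L4_L2; exact: noise_L4 nb j.
  - move=> B mB; rewrite -[RHS](cond_expectation_orth (noise_mean0 nb j) mB).
    by apply: eq_Rintegral => w _; rewrite subr0.
  - apply: measurable_funM; first exact: (known_A na).
    apply: measurable_funM; first by apply: (known_A na); exact: ltnW.
    by apply: (known_noise nb) => //; rewrite neq_ltn lj.
  - rewrite (_ : (fun _ => _) = (fun w => (A a j w * b j (X j w)) * (A a l w * b l (X l w)))).
      exact: L2M.
    by apply/funext => w; rewrite mulrAC.
apply: (@le_trans _ _ (\sum_(j < n) kappa * kappa)); last first.
  by rewrite sumr_const card_ord -expr2 mulr_natr.
apply: ler_sum => j _.
apply: (le_trans (noise_second_moment nb (known_A na (leqnn _)) (LA j na))).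
apply: ler_wpM2l => //; apply: (le_trans (A_sqr j na)).
rewrite -[leRHS]mulr1; apply: ler_wpM2l => //.
rewrite -[leRHS](Rintegral_cstT P 1); apply: le_Rintegral => //.
- by apply: L1_sum => i; exact: (proj2 (L4_L2 (LN i j))).
- exact: L1_cst.
Qed.
End Triangular.

(** Symmetric idempotent weights: the squares in a row sum to the diagonal entry,
    so all entries lie in [-1, 1] and the columns of the triangular parts have
    norm at most 1. *)
Section Projection.
Variable M : T -> 'M[R]_n.
Hypothesis mM : forall i j k : 'I_n, known k (fun w => M w i j).
Hypothesis M_sym : forall w i j, M w i j = M w j i.
Hypothesis M_idem : forall w i j, \sum_k M w i k * M w k j = M w i j.

Lemma projection_row_sqr w i : \sum_k M w i k ^+ 2 = M w i i.
Proof. by rewrite -[RHS]M_idem; apply: eq_bigr => k _;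
    rewrite expr2 [in LHS](M_sym w i k) M_sym. Qed.

Lemma projection_sqr_le_diag w i j : M w i j ^+ 2 <= M w i i.
Proof.
rewrite -projection_row_sqr (bigD1 j)//= lerDl.
by apply: sumr_ge0 => k _; exact: sqr_ge0.
Qed.

Lemma projection_diag_ge0 w i : 0 <= M w i i.
Proof. exact: le_trans (sqr_ge0 _) (projection_sqr_le_diag w i i). Qed.

Lemma projection_diag_le1 w i : M w i i <= 1.
Proof.
have := projection_sqr_le_diag w i i; have := projection_diag_ge0 w i => h0 h1.
by case: (leP (M w i i) 1) => // h; nra.
Qed.

Lemma projection_le1 w i j : `|M w i j| <= 1.
Proof.
rewrite -(@ler_pXn2r _ 2)// ?nnegrE// expr1n real_normK ?num_real//.
exact: le_trans (projection_sqr_le_diag w i j) (projection_diag_le1 w i).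
Qed.

Lemma projection_measurable i j : measurable_fun setT (fun w => M w i j).
Proof. exact: (leave_one_out_measurable mX mzeta (@mM i j j)). Qed.

Let N (i j : 'I_n) w : R := if (i < j)%N then M w i j else 0.

Let N0 (i j : 'I_n) w : (j <= i)%N -> N i j w = 0.
Proof. by rewrite /N ltnNge => ->. Qed.

Let mN (i j k : 'I_n) : known k (N i j).
Proof.
have [ij|ij] := ltnP i j.
  rewrite (_ : N i j = fun w => M w i j); first exact: (@mM i j k).
  by apply/funext => w; rewrite /N ij.
rewrite (_ : N i j = cst 0); first exact: measurable_cst.
by apply/funext => w; rewrite N0.
Qed.

Let N1 i j w : `|N i j w| <= 1.
Proof. by rewrite /N; case: ifP => _; rewrite ?normr0 ?projection_le1. Qed.

Let NN j w : \sum_i N i j w ^+ 2 <= 1.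
Proof.
apply: le_trans (projection_diag_le1 w j); rewrite -projection_row_sqr.
apply: ler_sum => i _; rewrite M_sym /N; case: ifP => // _.
by rewrite expr0n/= sqr_ge0.
Qed.

Lemma triangular_split (a b : 'I_n -> R) w :
  \sum_i \sum_j M w i j * (a i * b j) =
  \sum_i M w i i * (a i * b i) + \sum_j (\sum_i N i j w * a i) * b j
    + \sum_j (\sum_i N i j w * b i) * a j.
Proof.
have -> : \sum_j (\sum_i N i j w * a i) * b j = \sum_i \sum_j N i j w * (a i * b j).
  rewrite exchange_big/=; apply: eq_bigr => j _; rewrite mulr_suml.
  by apply: eq_bigr => i _; rewrite mulrA.
have -> : \sum_j (\sum_i N i j w * b i) * a j = \sum_i \sum_j N j i w * (a i * b j).
  apply: eq_bigr => i _; rewrite mulr_suml; apply: eq_bigr => j _.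
  by rewrite -mulrA (mulrC (b j)).
rewrite -!big_split/=; apply: eq_bigr => i _.
rewrite (bigD1 i)//= [in RHS](bigD1 i)//= [X in _ = _ + X](bigD1 i)//=.
rewrite !N0// !mul0r !add0r -addrA; congr (_ + _).
rewrite -big_split/=; apply: eq_bigr => j ji.
rewrite /N; case: (ltngtP i j) ji => [ij _|ij _|/val_inj ->]; last by rewrite eqxx.
  by rewrite mul0r addr0.
by rewrite mul0r add0r M_sym.
Qed.

(** The diagonal, centred by [c], and the two triangular halves each have second
    moment O(n).  The inequality (x + y + z)^2 <= 3 (x^2 + y^2 + z^2) combines
    them. *)
Theorem quadratic_form_sqr kappa a b (c : nat -> SW -> R) :
  noise kappa a -> noise kappa b ->
  (forall i, is_cond_expectation P (zeta \o X i) (fun w => a i (X i w) * b i (X i w)) (c i)) ->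
  (forall i t, `|c i t| <= kappa) ->
  let Q w := \sum_i \sum_j M w i j * (a i (X i w) * b j (X j w))
             - \sum_i M w i i * c i (zeta (X i w)) in
  L2 Q /\ \int[P]_w (Q w ^+ 2) <= (6 * kappa + 12 * kappa ^+ 2) * n%:R.
Proof.
move=> na nb hc bc Q.
pose D i w := M w i i * (a i (X i w) * b i (X i w) - c i (zeta (X i w))).
pose phi (i : 'I_n) w := a i (X i w) * b i (X i w) - c i (zeta (X i w)).
have mzX (i : nat) : measurable_fun setT (zeta \o X i) by exact: measurableT_comp.
have mc (i : nat) : measurable_fun setT (c i) by have [] := hc i.
have Lphi (i : 'I_n) : L2 (phi i).
  apply: L2D; first exact: L4M (noise_L4 na i) (noise_L4 nb i).
  apply/L4_L2/(@L4_bounded _ _ _ _ _ kappa).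
    by apply: measurable_funN; exact: measurableT_comp (mc i) (mzX i).
  by move=> w; rewrite normrN.
have LD (i : 'I_n) : L2 (D i).
  apply: (@pow_integrable_bounded_mul _ _ _ _ _ _ (phi i) 1) => //.
    exact: projection_measurable.
  by move=> w; exact: projection_le1.
have [LT bT] := triangular_form_sqr N0 mN N1 NN na nb.
have [LT' bT'] := triangular_form_sqr N0 mN N1 NN nb na.
set T1 := (fun w => \sum_j (\sum_i N i j w * a i (X i w)) * b j (X j w)) in LT bT.
set T2 := (fun w => \sum_j (\sum_i N i j w * b i (X i w)) * a j (X j w)) in LT' bT'.
have LDD : L2 (fun w => \sum_i D i w) by exact: L2_sum.
have QE w : Q w = \sum_i D i w + T1 w + T2 w.
  rewrite /Q triangular_split (_ : \sum_i D i w =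
      \sum_i M w i i * (a i (X i w) * b i (X i w)) - \sum_i M w i i * c i (zeta (X i w))).
    by rewrite /T1 /T2; ring.
  by rewrite -sumrB; apply: eq_bigr => i _; rewrite -mulrBr.
have LQ : L2 Q.
  rewrite (_ : Q = fun w => \sum_i D i w + T1 w + T2 w); last exact/funext.
  by apply: L2D => //; exact: L2D.
split=> //.
have k0 : 0 <= kappa by exact: le_trans (normr_ge0 _) (bc 0 point).
have phi_sqr (i : 'I_n) : \int[P]_w (phi i w ^+ 2) <= 2 * kappa + 2 * kappa ^+ 2.
  have [[_ La] [_ Lb]] := (noise_L4 na i, noise_L4 nb i).
  have : \int[P]_w (phi i w ^+ 2) <=
      \int[P]_w (a i (X i w) ^+ 4 + b i (X i w) ^+ 4 + 2 * kappa ^+ 2).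
    apply: le_Rintegral => //; first exact: (proj2 (Lphi i)).
      by apply: L1D; [exact: L1D|exact: L1_cst].
    move=> w _; rewrite /phi; have := bc i (zeta (X i w)).
    move: (a i (X i w)) (b i (X i w)) (c i _) => x y z zk.
    have zk2 : z ^+ 2 <= kappa ^+ 2.
      by rewrite -(@ler_pXn2r _ 2)// ?nnegrE// real_normK ?num_real// in zk.
    have := sqr_ge0 (x * y + z); have := sqr_ge0 (x ^+ 2 - y ^+ 2); nra.
  move/le_trans; apply; rewrite RintegralD//; [|exact: L1D|exact: L1_cst].
  rewrite RintegralD// Rintegral_cstT lerD2r mulr2n mulrDl mul1r.
  by apply: lerD; [exact: noise_le na i|exact: noise_le nb i].
have D_sqr : \int[P]_w ((\sum_i D i w) ^+ 2) <= (2 * kappa + 2 * kappa ^+ 2) * n%:R.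
  rewrite orthogonal_sum_sqr//; last first.
    move=> i j ji.
    rewrite (@eq_Rintegral _ _ _ _ _ (fun w => (M w i i * D j w) * phi i w)); last first.
      by move=> w _; rewrite /D -/(phi i w) mulrAC.
    apply: (@orthogonality _ _ _ P _ _ X mX indX _ _ zeta n i mzeta
      (fun s => a i s * b i s - c i (zeta s)) (fun w => M w i i * D j w)) => //.
    - apply: measurable_funB; last exact: measurableT_comp.
      by apply: measurable_funM; [exact: noise_measurable na i|exact: noise_measurable nb i].
    - exact: L2_L1 (Lphi i).
    - by move=> B mB; exact: cond_expectation_orth (hc i) mB.
    - apply: measurable_funM; first exact: mM.
      apply: measurable_funM; first exact: mM.
      apply: measurable_funB; last exact: known_stat.
      by apply: measurable_funM; [apply: (known_noise na)|apply: (known_noise nb)] => //;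
          rewrite neq_ltn ji.
    - rewrite (_ : (fun _ => _) = fun w => D i w * D j w).
        exact: L2M.
      by apply/funext => w; rewrite /D -/(phi i w) mulrAC.
  rewrite -[n in leRHS]card_ord mulr_natr -sumr_const; apply: ler_sum => i _.
  apply: le_trans (phi_sqr i); apply: le_Rintegral => //.
  - exact: (proj2 (LD i)).
  - exact: (proj2 (Lphi i)).
  - move=> w _; rewrite /D -/(phi i w) exprMn -[leRHS]mul1r ler_wpM2r ?sqr_ge0//.
    by rewrite expr_le1// ?projection_diag_ge0// projection_diag_le1.
apply: (@le_trans _ _ (\int[P]_w (3 * (\sum_i D i w) ^+ 2 + 3 * T1 w ^+ 2 + 3 * T2 w ^+ 2))).
  apply: le_Rintegral => //; first exact: (proj2 LQ).
    by do 2?apply: L1D; apply: L1Z; [exact: (proj2 LDD)|exact: (proj2 LT)|exact: (proj2 LT')].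
  move=> w _; rewrite QE; move: (\sum_i D i w) (T1 w) (T2 w) => x y z.
  have := sqr_ge0 (x - y); have := sqr_ge0 (x - z); have := sqr_ge0 (y - z); nra.
have [iD [iT iT']] := (proj2 LDD, (proj2 LT, proj2 LT')).
rewrite RintegralD//; [|by apply: L1D; exact: L1Z|exact: L1Z].
rewrite RintegralD//; [|exact: L1Z..].
rewrite !RintegralZl//.
have n0 : 0 <= n%:R :> R by [].
move: bT bT' D_sqr; rewrite -/T1 -/T2; lra.
Qed.
End Projection.
End QuadraticForm.

(** * Conditional moments of the score *)

Section Score.
Context {d : measure_display} {T : measurableType d} {R : realType}.
Variable P : probability T R.
Local Notation L1 f := (P.-integrable setT (EFin \o f)).
Local Notation L2 := (pow_integrable P 2).
Local Notation L4 := (pow_integrable P 4).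
Context {dS : measure_display} {S : measurableType dS}.
Variable X : nat -> T -> S.
Hypothesis mX : forall i, measurable_fun setT (X i).
Hypothesis indX : forall (I : seq nat) (A : nat -> set S), uniq I ->
  (forall i, measurable (A i)) ->
  (P (\bigcap_(i in [set` I]) (X i @^-1` A i)) =
   \prod_(i <- I) P (X i @^-1` A i))%E.
Context {dW : measure_display} {SW : measurableType dW}.
Variable zeta : S -> SW.
Hypothesis mzeta : measurable_fun setT zeta.
Context {dV : measure_display} {SV : measurableType dV}.
Variable xi : S -> SV.
Hypothesis mxi : measurable_fun setT xi.
Variable n : nat.

Variable e : nat -> S -> R.
Hypothesis me : forall i, measurable_fun setT (e i).
Hypothesis Le : forall i, L4 (e i \o X i).
Hypothesis e_mean0 : forall i, is_cond_expectation P (xi \o X i) (e i \o X i) (cst 0).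
Variable s2 : R.
Hypothesis e_var : forall i, is_cond_expectation P (xi \o X i)
  (fun w => e i (X i w) ^+ 2) (cst s2).

Variables (kappa : R) (a b : nat -> S -> R) (c : nat -> SW -> R).
Hypotheses (na : noise P X zeta kappa a) (nb : noise P X zeta kappa b).
Hypothesis ca : forall i, exists2 al, measurable_fun setT al & a i = al \o xi.
Hypothesis cb : forall i, exists2 al, measurable_fun setT al & b i = al \o xi.
Hypothesis hc : forall i, is_cond_expectation P (zeta \o X i)
  (fun w => a i (X i w) * b i (X i w)) (c i).
Hypothesis bc : forall i t, `|c i t| <= kappa.

Variable M : T -> 'M[R]_n.
Hypothesis mMz : forall i j k : 'I_n,
  measurable_fun setT ((fun w => M w i j) : leave_one_out X zeta n k -> R).
Hypothesis mMx : forall i j k : 'I_n,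
  measurable_fun setT ((fun w => M w i j) : leave_one_out X xi n k -> R).
Hypothesis M_sym : forall w i j, M w i j = M w j i.
Hypothesis M_idem : forall w i j, \sum_k M w i k * M w k j = M w i j.

Variable U : T -> R.
Hypothesis mUz : forall k : 'I_n, measurable_fun setT (U : leave_one_out X zeta n k -> R).
Hypothesis mUx : forall k : 'I_n, measurable_fun setT (U : leave_one_out X xi n k -> R).
Hypothesis U1 : forall w, `|U w| <= 1.
Hypothesis mU : measurable_fun setT U.

Let M1 w i j : `|M w i j| <= 1.
Proof. exact: projection_le1. Qed.

Let mM i j : measurable_fun setT (fun w => M w i j).
Proof. exact: (leave_one_out_measurable mX mzeta (@mMz i j j)). Qed.

Let q (f : nat -> S -> R) (j : 'I_n) w := \sum_i M w i j * f i (X i w).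

Let Lq f j : noise P X zeta kappa f -> L4 (q f j).
Proof.
move=> nf; apply: L4_sum => i.
apply: (pow_integrable_bounded_mul (noise_L4 nf i) (mM i j)) => w; exact: M1.
Qed.

Let known_q f (j k : 'I_n) :
  (forall i, exists2 al, measurable_fun setT al & f i = al \o xi) ->
  measurable_fun setT (q f j : leave_one_out X xi n k -> R).
Proof.
move=> cf; apply: (@measurable_sum _ (leave_one_out X xi n k)) => i.
apply: measurable_funM; first exact: mMx.
have [al mal ->] := cf i.
exact: (@known_stat _ _ _ _ _ X _ _ xi mxi n k al i).
Qed.

Let orth_xi (phi : S -> R) (j : 'I_n) (V : T -> R) : measurable_fun setT phi ->
  is_cond_expectation P (xi \o X j) (phi \o X j) (cst 0) ->
  measurable_fun setT (V : leave_one_out X xi n j -> R) ->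
  L1 (fun w => V w * phi (X j w)) ->
  \int[P]_w (V w * phi (X j w)) = 0.
Proof.
move=> mphi hphi mV LV.
apply: (@orthogonality _ _ _ P _ _ X mX indX _ _ xi n j mxi) => //.
- by have [_ + _ _ _] := hphi.
- move=> B mB; rewrite -[RHS](cond_expectation_orth hphi mB).
  by apply: eq_Rintegral => w _; rewrite subr0.
Qed.

(** [q a j] is a function of all the [xi (X i)], given which [e j] is centred. *)
Lemma score_mean0 :
  \int[P]_w (U w * (\sum_j q a j w * e j (X j w))) = 0.
Proof.
have LUq j : L4 (fun w => U w * q a j w).
  exact: (pow_integrable_bounded_mul (Lq j na) mU U1).
transitivity (\int[P]_w (\sum_(j < n) (U w * q a j w) * e j (X j w))).
  apply: eq_Rintegral => w _; rewrite mulr_sumr; apply: eq_bigr => j _.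
  by rewrite mulrA.
have L j : L1 (fun w => (U w * q a j w) * e j (X j w)).
  exact: L2M (L4_L2 (LUq j)) (L4_L2 (Le j)).
rewrite Rintegral_sum//; apply: big1 => j _.
apply: orth_xi => //; apply: measurable_funM; first exact: mUx.
exact: known_q.
Qed.

(** Conditioning on all the [xi (X i)] first leaves s2 * sum_j q_j(a) q_j(b), since the
    errors are orthogonal with variance [s2].  Idempotence of [M] turns this sum
    into the quadratic form s2 * a' M b, whose off-diagonal terms vanish given
    the [zeta (X i)]. *)
Lemma score_cond_moment :
  \int[P]_w (U w * ((\sum_j q a j w * e j (X j w)) * (\sum_j q b j w * e j (X j w)))) =
  \int[P]_w (U w * (s2 * \sum_i M w i i * c i (zeta (X i w)))).
Proof.
have LUq f j : noise P X zeta kappa f -> L4 (fun w => U w * q f j w).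
  by move=> nf; exact: (pow_integrable_bounded_mul (Lq j nf) mU U1).
have Lqe f j : noise P X zeta kappa f -> L2 (fun w => q f j w * e j (X j w)).
  by move=> nf; exact: L4M (Lq j nf) (Le j).
have LUqe f j : noise P X zeta kappa f -> L2 (fun w => U w * q f j w * e j (X j w)).
  by move=> nf; exact: L4M (LUq f j nf) (Le j).
have LUqq j : L1 (fun w => U w * q a j w * q b j w).
  exact: L2M (L4_L2 (LUq _ j na)) (L4_L2 (Lq j nb)).
transitivity (\int[P]_w (\sum_(j < n) \sum_(l < n)
    (U w * q a j w * e j (X j w)) * (q b l w * e l (X l w)))).
  apply: eq_Rintegral => w _; rewrite mulrA [X in X * _]mulr_sumr big_distrlr/=.
  by apply: eq_bigr => j _; apply: eq_bigr => l _; rewrite !mulrA.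
have L j l : L1 (fun w => (U w * q a j w * e j (X j w)) * (q b l w * e l (X l w))).
  exact: L2M (LUqe _ j na) (Lqe _ l nb).
rewrite Rintegral_sum; last by move=> j; exact: L1_sum.
(* Two distinct errors are orthogonal given all the [xi (X i)]. *)
transitivity (\sum_(j < n) s2 * \int[P]_w (U w * q a j w * q b j w)).
  apply: eq_bigr => j _; rewrite Rintegral_sum// (bigD1 j)//=.
  rewrite [X in _ + X]big1 ?addr0; last first.
    move=> l lj.
    rewrite (@eq_Rintegral _ _ _ _ _
        (fun w => (U w * q a j w * (q b l w * e l (X l w))) * e j (X j w))); last first.
      by move=> w _; rewrite mulrAC.
    apply: orth_xi => //.
      apply: measurable_funM.
        by apply: measurable_funM; [exact: mUx|exact: known_q].
      apply: measurable_funM; first exact: known_q.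
      apply: (@measurableT_comp _ _ _ _ _ _ (e l)) => //; exact: leave_one_out_obs.
    rewrite (_ : (fun _ => _) =
        (fun w => (U w * q a j w * e j (X j w)) * (q b l w * e l (X l w)))) //.
    by apply/funext => w; rewrite mulrAC.
  have Lee : L1 (fun w => U w * q a j w * q b j w * e j (X j w) ^+ 2).
    rewrite (_ : (fun _ => _) =
        (fun w => (U w * q a j w * e j (X j w)) * (q b j w * e j (X j w)))) //.
    by apply/funext => w; ring.
  have Lqs : L1 (fun w => s2 * (U w * q a j w * q b j w)) by exact: L1Z.
  have : \int[P]_w ((U w * q a j w * q b j w) * (e j (X j w) ^+ 2 - s2)) = 0.
    apply: (@orth_xi (fun s => e j s ^+ 2 - s2)).
    - by apply: measurable_funB => //; exact: measurable_funX.
    - have hs : is_cond_expectation P (xi \o X j) (cst s2) (cst s2).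
        have [mW _ _ Lc _] := e_var j; split => //.
      have := is_cond_expectationB (e_var j) hs.
      by rewrite (_ : (fun s : SV => cst s2 s - cst s2 s) = cst 0)//; apply/funext => s;
          rewrite /= subrr.
    - apply: measurable_funM; last exact: known_q.
      by apply: measurable_funM; [exact: mUx|exact: known_q].
    - rewrite (_ : (fun _ => _) = (fun w => U w * q a j w * q b j w * e j (X j w) ^+ 2 -
        s2 * (U w * q a j w * q b j w))).
        exact: L1B.
      by apply/funext => w; ring.
  rewrite (@eq_Rintegral _ _ _ _ _ (fun w => U w * q a j w * q b j w * e j (X j w) ^+ 2 -
      s2 * (U w * q a j w * q b j w))); last first.
    by move=> w _; ring.
  rewrite RintegralB// RintegralZl// => /eqP; rewrite subr_eq0 => /eqP <-.
  by apply: eq_Rintegral => w _; ring.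
rewrite -mulr_sumr -Rintegral_sum//.
have mc i : measurable_fun setT (c i) by have [] := hc i.
have LUM i k : L4 (fun w => U w * M w i k).
  apply: (@L4_bounded _ _ _ _ _ 1); first exact: measurable_funM.
  by move=> w; rewrite normrM -[leRHS]mulr1 ler_pM.
have LUMa i k : L1 (fun w => U w * M w i k * (a i (X i w) * b k (X k w))).
  exact: L2M (L4_L2 (LUM i k)) (L4M (noise_L4 na i) (noise_L4 nb k)).
have Lc (i : 'I_n) : L1 (fun w => U w * M w i i * c i (zeta (X i w))).
  apply: L2M (L4_L2 (LUM i i)) _; apply: L4_L2.
  apply: (@L4_bounded _ _ _ _ _ kappa) => //.
  by apply: measurableT_comp => //; exact: measurableT_comp.
(* Idempotence collapses the sum over j of M i j * M j k. *)
transitivity (s2 * \int[P]_w (\sum_i \sum_k U w * M w i k * (a i (X i w) * b k (X k w)))).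
  congr (_ * _); apply: eq_Rintegral => w _; rewrite /q.
  transitivity (U w * \sum_i \sum_k (\sum_j M w i j * M w j k) * (a i (X i w) * b k (X k w))).
    transitivity (\sum_j \sum_i \sum_k U w * (M w i j * M w j k * (a i (X i w) * b k (X k w)))).
      apply: eq_bigr => j _; rewrite -mulrA big_distrlr/= mulr_sumr.
      apply: eq_bigr => i _; rewrite mulr_sumr; apply: eq_bigr => k _.
      by rewrite (M_sym w j k); ring.
    rewrite exchange_big mulr_sumr/=; apply: eq_bigr => i _.
    rewrite exchange_big mulr_sumr/=; apply: eq_bigr => k _.
    by rewrite mulr_suml mulr_sumr.
  rewrite mulr_sumr; apply: eq_bigr => i _; rewrite mulr_sumr; apply: eq_bigr => k _.
  by rewrite M_idem mulrA.
transitivity (s2 * \int[P]_w (\sum_(i < n) U w * M w i i * c i (zeta (X i w)))); last first.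
  rewrite -RintegralZl//; last exact: L1_sum.
  apply: eq_Rintegral => w _; rewrite !mulr_sumr; apply: eq_bigr => i _; ring.
congr (_ * _).
rewrite Rintegral_sum; last by move=> i; exact: L1_sum.
rewrite [RHS]Rintegral_sum//; apply: eq_bigr => i _.
rewrite Rintegral_sum// (bigD1 i)//= [X in _ + X]big1 ?addr0; last first.
  move=> k ki.
  rewrite (@eq_Rintegral _ _ _ _ _ (fun w => (U w * M w i k * b k (X k w)) * a i (X i w)));
      last first.
    by move=> w _; ring.
  apply: (noise_orth mX indX mzeta na).
    apply: measurable_funM; first by apply: measurable_funM; [exact: mUz|exact: mMz].
    by apply: (known_noise nb).
  exact: L4M (LUM i k) (noise_L4 nb k).
have LM : L1 (fun w => U w * M w i i * (a i (X i w) * b i (X i w) - c i (zeta (X i w)))).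
  rewrite (_ : (fun _ => _) = (fun w => U w * M w i i * (a i (X i w) * b i (X i w)) -
      U w * M w i i * c i (zeta (X i w)))).
    exact: L1B.
  by apply/funext => w; rewrite mulrBr.
have : \int[P]_w (U w * M w i i * (a i (X i w) * b i (X i w) - c i (zeta (X i w)))) = 0.
  apply: (@orthogonality _ _ _ P _ _ X mX indX _ _ zeta n i mzeta
      (fun s => a i s * b i s - c i (zeta s)) (fun w => U w * M w i i)) => //.
  - apply: measurable_funB; last exact: measurableT_comp.
    by apply: measurable_funM; [exact: noise_measurable na i|exact: noise_measurable nb i].
  - have [_ L1ab _ L1c _] := hc i; exact: L1B.
  - by move=> B mB; exact: cond_expectation_orth (hc i) mB.
  - by apply: measurable_funM; [exact: mUz|exact: mMz].
rewrite (@eq_Rintegral _ _ _ _ _ (fun w => U w * M w i i * (a i (X i w) * b i (X i w)) -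
    U w * M w i i * c i (zeta (X i w)))); last first.
  by move=> w _; rewrite mulrBr.
by rewrite RintegralB// => /eqP; rewrite subr_eq0 => /eqP.
Qed.
End Score.

(** * Annihilator matrices and bilinear forms *)

Section AnnihilatorAlgebra.
Context {R : realType}.

Lemma sqr_sum_eq0 n (u : 'cV[R]_n) : u^T *m u = 0 -> u = 0.
Proof.
move=> u0; have : (u^T *m u) 0 0 = 0 by rewrite u0 mxE.
rewrite mxE => /eqP; rewrite psumr_eq0; last by move=> i _; rewrite mxE -expr2 sqr_ge0.
move=> /allP h; apply/matrixP => i j; rewrite ord1 !mxE.
by have /eqP := h i (mem_index_enum _); rewrite mxE => /eqP; rewrite mulf_eq0 orbb => /eqP.
Qed.

(** If u B' B = 0 then |B u'|^2 = u B' B u' = 0, so u B' = 0. *)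
Lemma gram_full_rank n k (B : 'M[R]_(n, k)) : \rank B = k -> B^T *m B \in unitmx.
Proof.
move=> rB; rewrite -row_free_unit -kermx_eq0; apply/eqP/row_matrixP => i.
rewrite row0; set u := row i _.
have uBB : u *m (B^T *m B) = 0.
  by apply: sub_kermxP; exact: row_sub.
have : (B *m u^T)^T *m (B *m u^T) = 0.
  by rewrite trmx_mul trmxK -mulmxA (mulmxA B^T) mulmxA uBB mul0mx.
move=> /sqr_sum_eq0 /(congr1 trmx); rewrite trmx_mul trmxK trmx0 => uB.
apply: (@row_free_inj _ _ _ _ B^T) ; last by rewrite mul0mx.
by rewrite /row_free mxrank_tr rB.
Qed.

(** The annihilator, replaced by 0 when the Gram matrix is singular, so that it is a
    symmetric idempotent matrix on the whole sample space.  It agrees with the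
    annihilator almost surely under the rank condition. *)
Definition annihilator0 n k (B : 'M[R]_(n, k)) : 'M[R]_n :=
  if B^T *m B \in unitmx then annihilator B else 0.

Section Annihilator.
Variables (n k : nat) (B : 'M[R]_(n, k)).
Let A := B^T *m B.
Let A_sym : A^T = A. Proof. by rewrite /A trmx_mul trmxK. Qed.

Lemma annihilator0_sym : (annihilator0 B)^T = annihilator0 B.
Proof.
rewrite /annihilator0 -/A; case: ifP => uA; last by rewrite trmx0.
rewrite /annihilator -/A linearB/= trmx1 !trmx_mul trmxK trmx_inv A_sym.
by rewrite mulmxA.
Qed.

Lemma annihilator0_mul : annihilator0 B *m B = 0.
Proof.
rewrite /annihilator0 -/A; case: ifP => uA; last by rewrite mul0mx.
by rewrite /annihilator -/A mulmxBl mul1mx -!mulmxA mulVmx// mulmx1 subrr.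
Qed.

Lemma annihilator0_idem : annihilator0 B *m annihilator0 B = annihilator0 B.
Proof.
rewrite {2}/annihilator0 -/A; case: ifP => uA; last first.
  by rewrite mulmx0 /annihilator0 -/A uA.
by rewrite /annihilator mulmxBr mulmx1 !mulmxA annihilator0_mul !mul0mx subr0.
Qed.

Lemma annihilator_trace : A \in unitmx -> \tr (annihilator B) = n%:R - k%:R.
Proof.
move=> uA; rewrite /annihilator -/A linearB/= mxtrace1 -mulmxA mxtrace_mulC -mulmxA.
by rewrite mulVmx// mxtrace1.
Qed.
End Annihilator.

Section Bilinear.
Variable n : nat.
Implicit Types (M : 'M[R]_n) (u v w : 'I_n -> R).

Definition bil M u w := \sum_i \sum_j M i j * (u i * w j).

Lemma bilDl M u v w : bil M (fun i => u i + v i) w = bil M u w + bil M v w.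
Proof.
rewrite /bil -big_split/=; apply: eq_bigr => i _; rewrite -big_split/=; apply: eq_bigr => j _.
ring.
Qed.

Lemma bilZl M c u w : bil M (fun i => c * u i) w = c * bil M u w.
Proof.
rewrite /bil mulr_sumr; apply: eq_bigr => i _; rewrite mulr_sumr; apply: eq_bigr => j _.
ring.
Qed.

Lemma bil_suml M m (u : 'I_m -> 'I_n -> R) w :
  bil M (fun i => \sum_a u a i) w = \sum_a bil M (u a) w.
Proof.
rewrite /bil [RHS]exchange_big/=; apply: eq_bigr => i _; rewrite [RHS]exchange_big/=.
by apply: eq_bigr => j _; rewrite mulr_suml mulr_sumr.
Qed.

Section Symmetric.
Variable M : 'M[R]_n.
Hypothesis M_sym : M^T = M.

Lemma bilC u w : bil M u w = bil M w u.
Proof.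
rewrite /bil exchange_big/=; apply: eq_bigr => i _; apply: eq_bigr => j _.
by rewrite -{1}M_sym mxE; congr (_ * _); exact: mulrC.
Qed.

Lemma bilDr u v w : bil M w (fun i => u i + v i) = bil M w u + bil M w v.
Proof. by rewrite bilC bilDl !(bilC w). Qed.

Lemma bilZr c u w : bil M w (fun i => c * u i) = c * bil M w u.
Proof. by rewrite bilC bilZl bilC. Qed.

(** The quadratic polynomial s |-> M(u + s w, u + s w) is nonnegative: its
    discriminant is at most 0.  The case M(w, w) = 0 is separate, where the
    polynomial is affine. *)
Lemma bil_CauchySchwarz : (forall u, 0 <= bil M u u) ->
  forall u w, bil M u w ^+ 2 <= bil M u u * bil M w w.
Proof.
move=> bil_ge0 u w.
have h s : 0 <= bil M u u + 2 * s * bil M u w + s ^+ 2 * bil M w w.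
  have := bil_ge0 (fun i => u i + s * w i).
  rewrite bilDl !bilDr !bilZl !bilZr (bilC w u); congr (0 <= _); ring.
have := bil_ge0 u; have := bil_ge0 w.
move: (bil M u u) (bil M u w) (bil M w w) h => A B C h C0 A0.
have [C00|Cn] := eqVneq C 0.
  have [->|Bn] := eqVneq B 0; first by rewrite expr0n/= mulr_ge0.
  have := h (- (A + 1) / (2 * B)); rewrite C00 mulr0 addr0.
  have -> : A + 2 * (- (A + 1) / (2 * B)) * B = -1 by field.
  by rewrite ler0N1.
have Cp : 0 < C by rewrite lt_def Cn.
have := h (- B / C).
have -> : A + 2 * (- B / C) * B + (- B / C) ^+ 2 * C = (A * C - B ^+ 2) / C by field.
by rewrite pmulr_lge0 ?invr_gt0// subr_ge0.
Qed.

Hypothesis M_idem : M *m M = M.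

Lemma bil_row_sqr u : bil M u u = \sum_i (\sum_j M i j * u j) ^+ 2.
Proof.
transitivity (\sum_i \sum_j \sum_k M k i * M k j * (u i * u j)).
  apply: eq_bigr => i _; apply: eq_bigr => j _; rewrite -[in LHS]M_idem mxE mulr_suml.
  by apply: eq_bigr => k _; rewrite -{1}M_sym mxE.
under eq_bigr do rewrite exchange_big/=.
rewrite exchange_big/=; apply: eq_bigr => k _; rewrite expr2 big_distrlr/=.
by apply: eq_bigr => i _; apply: eq_bigr => j _; ring.
Qed.

Lemma bil_ge0 u : 0 <= bil M u u.
Proof. by rewrite bil_row_sqr sumr_ge0// => i _; exact: sqr_ge0. Qed.

(** The difference is the squared norm of u - M u. *)
Lemma bil_le u : bil M u u <= \sum_i u i ^+ 2.
Proof.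
rewrite -subr_ge0.
have -> : \sum_i u i ^+ 2 - bil M u u = \sum_i (u i - \sum_j M i j * u j) ^+ 2.
  under [RHS]eq_bigr do rewrite sqrrB.
  rewrite big_split/= -bil_row_sqr sumrB sumrMnl.
  suff -> : \sum_i u i * (\sum_j M i j * u j) = bil M u u by rewrite mulr2n; ring.
  apply: eq_bigr => i _; rewrite mulr_sumr; apply: eq_bigr => j _; ring.
by apply: sumr_ge0 => i _; exact: sqr_ge0.
Qed.

Lemma bil_kernel u v : (forall i, \sum_j M i j * v j = 0) ->
  bil M (fun i => u i - v i) (fun i => u i - v i) = bil M u u.
Proof.
move=> Mv; rewrite !bil_row_sqr; apply: eq_bigr => i _; congr (_ ^+ 2).
by under eq_bigr do rewrite mulrBr; rewrite sumrB Mv subr0.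
Qed.
End Symmetric.
End Bilinear.
End AnnihilatorAlgebra.

(** * The smallest eigenvalue of a symmetric matrix *)

Section LambdaMin.
Context {R : realType}.

Lemma cvg_sum {T : Type} {F : set_system T} {FF : Filter F} I (s : seq I)
    (f : I -> T -> R) (l : I -> R) :
  (forall i, f i t @[t --> F] --> l i) ->
  \sum_(i <- s) f i t @[t --> F] --> \sum_(i <- s) l i.
Proof.
move=> fl; elim: s => [|i s IH].
  by rewrite big_nil; under eq_fun do rewrite big_nil; exact: cvg_cst.
by rewrite big_cons; under eq_fun do rewrite big_cons; exact: cvgD.
Qed.

Lemma continuous_sum {T : topologicalType} I (s : seq I) (F : I -> T -> R) :
  (forall i, continuous (F i)) -> continuous (fun t => \sum_(i <- s) F i t).
Proof. by move=> cF t; apply: cvg_sum => i; exact: cF. Qed.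

Lemma bil_sub_scalar n (A : 'M[R]_n) mu u w :
  bil (A - mu%:M) u w = bil A u w - mu * \sum_i u i * w i.
Proof.
rewrite /bil mulr_sumr -sumrB; apply: eq_bigr => i _.
rewrite (bigD1 i)//= [in RHS](bigD1 i)//= !mxE eqxx mulr1n.
rewrite (eq_bigr (fun j => A i j * (u i * w j))); first by ring.
by move=> j ji; rewrite !mxE eq_sym (negbTE ji) mulr0n subr0.
Qed.

(** The Rayleigh quotient attains its minimum [mu] on the compact unit sphere.  The
    form of A - mu is then positive semidefinite and vanishes at the minimiser,
    so by Cauchy-Schwarz the minimiser is in its kernel. *)
Lemma rayleigh_min n (A : 'M[R]_n.+1) : A^T = A ->
  exists2 mu, eigenvalue A mu & forall t, mu * \sum_i t i ^+ 2 <= bil A t t.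
Proof.
move=> A_sym.
pose f (u : 'rV[R]_n.+1) := bil A (u 0) (u 0).
pose s (u : 'rV[R]_n.+1) := \sum_i u 0 i ^+ 2.
have cc i : continuous (fun u : 'rV[R]_n.+1 => u 0 i) by exact: coord_continuous.
have cs : continuous s.
  apply: continuous_sum => i u; apply: (@continuous_comp _ _ _ _ (fun x : R => x ^+ 2));
      first exact: cc.
  exact: exprn_continuous.
have cf : continuous f.
  have cm i j : continuous (fun u : 'rV[R]_n.+1 => A i j * (u 0 i * u 0 j)).
    move=> u; apply: (@cvgMl_tmp _ _ (nbhs u)).
    exact: (@cvgM _ _ (nbhs u) _ _ _ _ _ (cc i u) (cc j u)).
  by do 2!apply: continuous_sum => ?; exact: cm.
pose K : set 'rV[R]_n.+1 := s @^-1` [set 1].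
have Kc : compact K.
  have Bc := @rV_compact R n.+1 (fun=> `[-1, 1]%classic) (fun=> @segment_compact R (-1) 1).
  apply: subclosed_compact Bc _.
  - by apply: preimage_closed; [move=> u _; exact: cs|exact: closed_eq].
  - move=> u /= su i; rewrite in_itv/= -ler_norml.
    rewrite -(@ler_pXn2r _ 2)// ?nnegrE// expr1n real_normK ?num_real//.
    rewrite -[leRHS]su /s (bigD1 i)//= lerDl.
    by apply: sumr_ge0 => j _; exact: sqr_ge0.
have K0 : K !=set0.
  exists (delta_mx 0 0); rewrite /K /s /= (bigD1 0)//= big1 ?mxE ?eqxx/= ?expr1n ?addr0//.
  by move=> j j0; rewrite mxE (negbTE j0) andbF expr0n.
have [c] := compact_EVT_min K0 Kc (continuous_subspaceT cf).
rewrite inE => Kc1 fmin.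
have hmin t : f c * \sum_i t i ^+ 2 <= bil A t t.
  set q := \sum_i _.
  have q0 : 0 <= q by apply: sumr_ge0 => i _; exact: sqr_ge0.
  have [q00|qn] := eqVneq q 0.
    have t0 i : t i = 0.
      move/eqP: q00; rewrite psumr_eq0 => [|j _]; last exact: sqr_ge0.
      by move=> /allP/(_ i (mem_index_enum _)); rewrite sqrf_eq0 => /eqP.
    rewrite q00 mulr0 /bil big1// => i _; rewrite big1// => j _.
    by rewrite t0 mul0r mulr0.
  have qp : 0 < q by rewrite lt_def qn.
  have rp : 0 < Num.sqrt q by rewrite sqrtr_gt0.
  pose u : 'rV[R]_n.+1 := \row_i ((Num.sqrt q)^-1 * t i).
  have uE : u 0 = (fun i => (Num.sqrt q)^-1 * t i) by apply/funext => i; rewrite mxE.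
  have Ku : u \in K.
    rewrite inE /K /s /= uE; under eq_bigr do rewrite exprMn.
    by rewrite -mulr_sumr -/q exprVn sqr_sqrtr// mulVf.
  have := fmin u Ku; rewrite {2}/f uE bilZl bilZr// mulrA -expr2 exprVn sqr_sqrtr//.
  by rewrite mulrC ler_pdivlMr.
exists (f c) => //.
pose B := A - (f c)%:M.
have B_sym : B^T = B by rewrite /B linearB/= A_sym tr_scalar_mx.
have B0 t : 0 <= bil B t t by rewrite bil_sub_scalar subr_ge0; exact: hmin.
have Bc : bil B (c 0) (c 0) = 0.
  rewrite bil_sub_scalar (_ : \sum_i _ = 1) ?mulr1 ?subrr//.
have Bcw w : bil B (c 0) w = 0.
  have := bil_CauchySchwarz B_sym B0 (c 0) w; rewrite Bc mul0r => h.
  by apply/eqP; rewrite -sqrf_eq0 eq_le h sqr_ge0.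
apply/eigenvalueP; exists c; last first.
  apply/eqP => c0; move: Kc1; rewrite /K /s /= c0 big1 => [/esym/eqP|i _].
    by rewrite oner_eq0.
  by rewrite mxE expr0n.
have : c *m B = 0.
  apply/rowP => j; rewrite mxE [RHS]mxE -[RHS](Bcw (fun k => (k == j)%:R)).
  rewrite /bil; apply: eq_bigr => i _; rewrite (bigD1 j)//= eqxx mulr1 big1 ?addr0 1?mulrC//.
  by move=> k kj; rewrite (negbTE kj) !mulr0.
by rewrite /B mulmxBr mul_mx_scalar => /eqP; rewrite subr_eq0 => /eqP.
Qed.

(** The infimum defining [lambda_min] is over a set that contains the minimum of the
    Rayleigh quotient and is bounded below by it. *)
Lemma lambda_min_le n (A : 'M[R]_n) C : A^T = A -> C <= lambda_min A ->
  forall t, C * \sum_i t i ^+ 2 <= bil A t t.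
Proof.
case: n A => [A _ _ t|n A A_sym CA t]; first by rewrite /bil !big_ord0 mulr0.
have [mu emu hmu] := rayleigh_min A_sym.
apply: le_trans (hmu t); apply: ler_wpM2r.
  by apply: sumr_ge0 => i _; exact: sqr_ge0.
apply: le_trans CA _; apply: ge_inf => //.
exists mu => a /= /eigenvalueP[u uA u0].
have bilu : bil A (u 0) (u 0) = a * \sum_i u 0 i ^+ 2.
  rewrite mulr_sumr /bil exchange_big/=; apply: eq_bigr => j _.
  transitivity ((u *m A) 0 j * u 0 j); last by rewrite uA mxE; ring.
  by rewrite mxE mulr_suml; apply: eq_bigr => i _; ring.
have := hmu (u 0); rewrite bilu ler_pM2r//.
rewrite lt_def sumr_ge0 ?andbT => [|i _]; last exact: sqr_ge0.
apply: contra_neq u0 => /eqP; rewrite psumr_eq0 => [|i _]; last exact: sqr_ge0.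
move=> /allP h; apply/rowP => i; rewrite mxE; apply/eqP.
by rewrite -sqrf_eq0; exact: h (mem_index_enum _).
Qed.
End LambdaMin.

(** * Residual sums of squares *)

Section Residuals.
Context {R : realType} (n d : nat).
Variables (M : 'M[R]_n) (x : 'I_n -> 'cV[R]_d).
Hypothesis M_sym : M^T = M.
Hypothesis M_idem : M *m M = M.

Local Notation xa a := (fun i => x i a 0).

Lemma gramE a b : gram M x a b = bil M (xa a) (xa b).
Proof.
rewrite /gram summxE; apply: eq_bigr => i _; rewrite summxE; apply: eq_bigr => j _.
by rewrite !mxE big_ord1 !mxE.
Qed.

Lemma dotvE (u w : 'cV[R]_d) : dotv u w = \sum_a u a 0 * w a 0.
Proof. by rewrite /dotv mxE; apply: eq_bigr => a _; rewrite mxE. Qed.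

Lemma pos_def_unit (A : 'M[R]_d) c : 0 < c ->
  (forall t, c * \sum_a t a ^+ 2 <= bil A t t) -> A \in unitmx.
Proof.
move=> c0 hA; rewrite -row_free_unit -kermx_eq0; apply/eqP/row_matrixP => i.
rewrite row0; set u := row i _.
have uA : u *m A = 0 by apply: sub_kermxP; exact: row_sub.
clearbody u.
have bilu : bil A (u 0) (u 0) = 0.
  rewrite /bil exchange_big/=; apply: big1 => j _.
  transitivity ((u *m A) 0 j * u 0 j); last by rewrite uA mxE mul0r.
  by rewrite mxE mulr_suml; apply: eq_bigr => k _; ring.
have := hA (u 0); rewrite bilu pmulr_rle0// => h.
have : \sum_a u 0 a ^+ 2 == 0 by rewrite eq_le h sumr_ge0// => a _; exact: sqr_ge0.
rewrite psumr_eq0 => [/allP hu|a _]; last exact: sqr_ge0.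
apply/rowP => a; rewrite [RHS]mxE; apply/eqP; rewrite -sqrf_eq0.
exact: hu (mem_index_enum _).
Qed.

Variables (y G : 'I_n -> R) (beta0 : 'cV[R]_d).
Hypothesis yE : forall i, y i = dotv (x i) beta0 + G i.

(** With [delta] the estimation error, the normal equations read
    gram delta = x' M G, and the residuals are those of G - x delta.
    Expanding the square gives the usual Pythagorean identity. *)
Lemma residual_sum_sqr : gram M x \in unitmx ->
  exists delta : 'I_d -> R,
    \sum_a delta a * bil M (xa a) G = bil (gram M x) delta delta /\
    \sum_i residual M x y i ^+ 2 = bil M G G - bil (gram M x) delta delta.
Proof.
move=> uG; pose r : 'cV[R]_d := \col_a bil M (xa a) G.
pose dl := beta_hat M x y - beta0.
have Mxy : \sum_i \sum_j (M i j * y j) *: x i = gram M x *m beta0 + r.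
  apply/colP => a; rewrite summxE !mxE.
  transitivity (bil M (xa a) y).
    apply: eq_bigr => i _; rewrite summxE; apply: eq_bigr => j _.
    by rewrite mxE; ring.
  rewrite (_ : y = fun i => \sum_b x i b 0 * beta0 b 0 + G i); last first.
    by apply/funext => i; rewrite yE dotvE.
  rewrite bilDr//; congr (_ + _); rewrite bilC// bil_suml; apply: eq_bigr => b _.
  rewrite bilC// (_ : (fun j => x j b 0 * beta0 b 0) = fun j => beta0 b 0 * x j b 0)//.
    by rewrite bilZr// gramE mulrC.
  by apply/funext => j; rewrite mulrC.
have gd : gram M x *m dl = r.
  rewrite /dl /beta_hat mulmxBr mulKVmx// Mxy addrAC subrr add0r //.
have gda a : bil M (xa a) G = \sum_b bil M (xa a) (xa b) * dl b 0.
  have := congr1 (fun v : 'cV_d => v a 0) gd; rewrite !mxE => <-.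
  by apply: eq_bigr => b _; rewrite gramE.
exists (fun a => dl a 0).
have dG : \sum_a dl a 0 * bil M (xa a) G = bil (gram M x) (dl^~ 0) (dl^~ 0).
  apply: eq_bigr => a _; rewrite gda mulr_sumr; apply: eq_bigr => b _.
  by rewrite gramE; ring.
split=> //.
pose e i := G i + -1 * \sum_a dl a 0 * x i a 0.
have -> : \sum_i residual M x y i ^+ 2 = bil M e e.
  rewrite bil_row_sqr//; apply: eq_bigr => i _; congr (_ ^+ 2).
  rewrite /residual; apply: eq_bigr => j _; congr (_ * _).
  rewrite yE !dotvE /e /dl.
  rewrite (_ : \sum_a (beta_hat M x y - beta0) a 0 * x j a 0 =
     \sum_a beta_hat M x y a 0 * x j a 0 - \sum_a x j a 0 * beta0 a 0); first by ring.
  by rewrite -sumrB; apply: eq_bigr => a _; rewrite !mxE; ring.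
rewrite bilDl !bilDr// !bilZl !bilZr// (bilC M_sym G) !bil_suml.
have -> : \sum_a bil M (fun i => dl a 0 * x i a 0) G = bil (gram M x) (dl^~ 0) (dl^~ 0).
  by rewrite -dG; apply: eq_bigr => a _; rewrite bilZl.
rewrite (_ : \sum_a bil M _ _ = bil (gram M x) (dl^~ 0) (dl^~ 0)); first by ring.
apply: eq_bigr => a _; rewrite bilC// bil_suml; apply: eq_bigr => b _.
by rewrite bilZl bilZr// gramE (bilC M_sym (xa a)); ring.
Qed.

(** The reduction delta' gram delta of the sum of squares equals r' gram^-1 r with r =
    x' M G, hence is
    between 0 and |r|^2 / c. *)
Lemma residual_sum_sqr_bounds c : 0 < c ->
  (forall t, c * \sum_a t a ^+ 2 <= bil (gram M x) t t) ->
  `|\sum_i residual M x y i ^+ 2 - bil M G G| <= c^-1 * \sum_a bil M (xa a) G ^+ 2.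
Proof.
move=> c0 hc; have uG := pos_def_unit c0 hc.
have [dl [dG ->]] := residual_sum_sqr uG.
rewrite addrC addKr normrN ger0_norm; last first.
  apply: le_trans (hc dl); apply: mulr_ge0; first exact: ltW.
  by apply: sumr_ge0 => a _; exact: sqr_ge0.
have cdl := hc dl; set D := bil (gram M x) dl dl in dG cdl *.
set S := \sum_a bil M _ _ ^+ 2.
set q := \sum_a dl a ^+ 2 in cdl.
have S0 : 0 <= S by apply: sumr_ge0 => a _; exact: sqr_ge0.
have q0 : 0 <= q by apply: sumr_ge0 => a _; exact: sqr_ge0.
(* Expanding this square avoids the inverse of the Gram matrix: with D for
   delta' gram delta and q = |delta|^2 it reads c^2 q - 2 c D + |r|^2 >= 0, and
   c q <= D. *)
have : 0 <= \sum_a (c * dl a - bil M (xa a) G) ^+ 2.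
  by apply: sumr_ge0 => a _; exact: sqr_ge0.
under eq_bigr do rewrite sqrrB.
rewrite big_split/= sumrB -/S sumrMnl.
under eq_bigr do rewrite exprMn.
rewrite -mulr_sumr -/q.
under eq_bigr do rewrite -mulrA.
rewrite -mulr_sumr dG => h.
rewrite ler_pdivlMl//; nra.
Qed.
End Residuals.

(** * Convergence in probability as convergence along a filter *)

Section InProbability.
Context {d : measure_display} {T : measurableType d} {R : realType}.
Variable P : probability T R.
Local Notation L1 f := (P.-integrable setT (EFin \o f)).
Local Notation L2 := (pow_integrable P 2).

(** The sets of pairs (n, w) that hold with probability tending to 1.  Failures need
    only be covered by a small measurable [A], so a property can be used without
    knowing that it is measurable. *)
Definition inprob : set_system (nat * T) := [set S | forall e : R, 0 < e ->
  \forall n \near \oo, exists A, [/\ measurable A, (P A <= e%:E)%E &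
    forall w, ~ A w -> S (n, w)]].

Global Instance inprob_filter : Filter inprob.
Proof.
split.
- move=> e e0; apply: nearW => n; exists set0; split => //.
  by rewrite measure0 lee_fin ltW.
- move=> S1 S2 F1 F2 e e0.
  have e2 : 0 < e / 2 by rewrite divr_gt0.
  apply: filterS2 (F1 _ e2) (F2 _ e2) => n [A1 [m1 P1 h1]] [A2 [m2 P2 h2]].
  exists (A1 `|` A2); split; first exact: measurableU.
    rewrite (splitr e) EFinD; apply: le_trans (measureU2 P m1 m2) _.
    exact: leeD.
  by move=> w /not_orP[/h1 ? /h2].
- move=> S1 S2 S12 F1 e e0; apply: filterS (F1 e e0) => n [A [mA PA hA]].
  by exists A; split => // w /hA; exact: S12.
Qed.

Lemma inprob_near (S : nat -> Prop) : (\forall n \near \oo, S n) ->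
  \forall t \near inprob, S t.1.
Proof.
move=> hS e e0; apply: filterS hS => n Sn; exists set0; split => //.
by rewrite measure0 lee_fin ltW.
Qed.

Lemma inprob_ae (S : nat -> T -> Prop) :
  (\forall n \near \oo, {ae P, forall w, S n w}) -> \forall t \near inprob, S t.1 t.2.
Proof.
move=> hS e e0; apply: filterS hS => n [A [mA PA hA]]; exists A; split => //.
  by rewrite PA lee_fin ltW.
by move=> w Aw; apply: contrapT => Sw; exact/Aw/hA.
Qed.

Lemma inprob_event (S : nat -> set T) : (forall n, measurable (S n)) ->
  (fun n => P (S n)) @ \oo --> 1%E -> \forall t \near inprob, S t.1 t.2.
Proof.
move=> mS /fine_cvgP[_ /cvgrPdist_le hS] e e0.
apply: filterS (hS e e0) => n hn; exists (~` S n); split.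
- exact: measurableC.
- rewrite probability_setC// -[P (S n)]fineK ?fin_num_measure// -EFinB lee_fin.
  exact: le_trans (ler_norm _) hn.
- by move=> w /contrapT.
Qed.

Lemma markov_L1 (f : T -> R) e : 0 < e -> L1 f -> (forall w, 0 <= f w) ->
  measurable [set w | e <= f w] /\
  (P [set w | (e <= f w)%R] <= (e^-1 * \int[P]_w f w)%:E)%E.
Proof.
move=> e0 Lf f0; have mf := L1_measurable Lf.
have mA : measurable [set w | e <= f w].
  rewrite -[[set _ | _]]setTI (_ : [set w | e <= f w] = (fun w => e <= f w) @^-1` [set true]).
    exact: measurable_fun_ler.
  by apply/seteqP; split.
split=> //; rewrite -[P _]fineK ?fin_num_measure// lee_fin -Rintegral_indic//.
rewrite -RintegralZl//; apply: le_Rintegral => //.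
- exact: integrable_indic.
- exact: L1Z.
- move=> w _; rewrite indicE; case: (boolP (_ \in _)) => [|_].
    by rewrite inE /= => ew; rewrite ler_pdivlMl// mulr1.
  by rewrite mulr_ge0// invr_ge0 ltW.
Qed.

Lemma cvg_inprob_L1 (X : nat -> T -> R) (r : nat -> R) :
  (\forall n \near \oo, [/\ L1 (X n), forall w, 0 <= X n w & \int[P]_w X n w <= r n]) ->
  r @ \oo --> 0 -> X t.1 t.2 @[t --> inprob] --> 0.
Proof.
move=> hX r0; apply/cvgrPdist_le => /= e e0 dl dl0.
have /cvgrPdist_le /(_ (e * dl)) := r0; rewrite mulr_gt0// => /(_ isT) hr.
apply: filterS2 hX hr => n [Lf f0 If] rn.
have [mA PA] := markov_L1 e0 Lf f0; exists [set w | e <= X n w]; split => //.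
  apply: le_trans PA _; rewrite lee_fin ler_pdivrMl//; apply: le_trans If _.
  by apply: le_trans rn; rewrite sub0r normrN ler_norm.
move=> w /= /negP; rewrite -ltNge => /ltW Xe.
by rewrite sub0r normrN ger0_norm.
Qed.

Lemma cvg_inprob_L2 (Q : nat -> T -> R) (C : R) :
  (forall n, L2 (Q n)) -> (forall n, \int[P]_w (Q n w ^+ 2) <= C * n%:R) ->
  t.1%:R^-1 * Q t.1 t.2 @[t --> inprob] --> 0.
Proof.
move=> LQ IQ.
have : (fun t => (t.1%:R^-1 * Q t.1 t.2) ^+ 2) t @[t --> inprob] --> 0.
  apply: (@cvg_inprob_L1 (fun n w => (n%:R^-1 * Q n w) ^+ 2) (fun n => C * n%:R^-1)).
    near=> n.
    have n0 : 0 < n%:R :> R by rewrite ltr0n; near: n; exact: (nbhs_infty_gt 0).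
    split.
    - by under eq_fun do rewrite exprMn; apply: L1Z; exact: (proj2 (LQ n)).
    - by move=> w; exact: sqr_ge0.
    - under eq_Rintegral do rewrite exprMn.
      rewrite RintegralZl//; last exact: (proj2 (LQ n)).
      apply: le_trans (ler_wpM2l _ (IQ n)) _; first exact: sqr_ge0.
      rewrite le_eqVlt; apply/orP; left; apply/eqP; field.
      by rewrite gt_eqF.
  rewrite -[0 in X in _ --> X](mulr0 C).
  apply: cvgMl_tmp.
  apply/gtr0_cvgV0; last exact: cvgr_idn.
  by near=> n; rewrite ltr0n; near: n; exact: (nbhs_infty_gt 0).
move=> /cvgrPdist_le h; apply/cvgrPdist_le => /= e e0.
apply: (@filterS _ inprob _ _ _ _ (h (e ^+ 2) (exprn_gt0 2 e0))) => t.
rewrite !sub0r !normrN normrX => ?; rewrite -(@ler_pXn2r _ 2)// nnegrE ltW//.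
Unshelve. all: by end_near. Qed.

(** Measurability enters here, where [P] is applied to the event itself. *)
Lemma cvg_in_prob_inprob {V : normedZmodType R} (D : nat -> set T)
    (X : nat -> T -> V) (l : V) :
  (forall e : R, 0 < e -> \forall n \near \oo,
     measurable (D n `&` [set w | `|X n w - l| <= e])) ->
  (forall e : R, 0 < e -> \forall t \near inprob,
     D t.1 t.2 /\ `|X t.1 t.2 - l| <= e) ->
  cvg_in_prob P D X l.
Proof.
move=> mX hX e e0; apply/fine_cvgP; split.
  apply: filterS (mX e e0) => n mn.
  by rewrite fin_num_measure//; exact: measurableC.
apply/cvgrPdist_le => /= dl dl0; apply: filterS2 (mX e e0) (hX e e0 dl dl0) => n mn [A [mA PA hA]].
have mC := measurableC mn.
rewrite sub0r normrN ger0_norm ?fine_ge0//.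
rewrite -lee_fin fineK ?fin_num_measure//; apply: le_trans PA.
apply: le_measure; rewrite ?inE// => w /= nD; apply: contrapT => /hA /=.
by move=> [] ? ?; exact: nD.
Qed.
End InProbability.

(** * Measurability of matrix operations *)

Section MatrixMeasurability.
Context {d : measure_display} {T : measurableType d} {R : realType}.

Definition mx_measurable m n (F : T -> 'M[R]_(m, n)) :=
  forall i j, measurable_fun setT (fun w => F w i j).

Lemma measurable_inv (f : T -> R) : measurable_fun setT f ->
  measurable_fun setT (fun w => (f w)^-1).
Proof.
(* x * (x^2)^-1 equals x^-1 for every real x, including x = 0, and real powers
   of nonnegative numbers are measurable. *)
move=> mf; rewrite (_ : (fun w => _) = fun w => f w * (f w ^+ 2) `^ (-1)).
  apply: measurable_funM => //.
  apply: (@measurableT_comp _ _ _ _ _ _ (fun x : R => x `^ (-1)) _ (fun w => f w ^+ 2)).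
    exact: measurable_powR.
  exact: measurable_funX.
apply/funext => w; rewrite powR_inv1 ?sqr_ge0//.
have [->|f0] := eqVneq (f w) 0; first by rewrite invr0 mul0r.
by field.
Qed.

Lemma mx_measurable_cst m n (A : 'M[R]_(m, n)) : mx_measurable (fun=> A).
Proof. by move=> i j; exact: measurable_cst. Qed.

Lemma mx_measurableB m n (F G : T -> 'M[R]_(m, n)) :
  mx_measurable F -> mx_measurable G -> mx_measurable (fun w => F w - G w).
Proof.
by move=> mF mG i j; under eq_fun do rewrite !mxE; exact: measurable_funB.
Qed.

Lemma mx_measurableM m n k (F : T -> 'M[R]_(m, n)) (G : T -> 'M[R]_(n, k)) :
  mx_measurable F -> mx_measurable G -> mx_measurable (fun w => F w *m G w).
Proof.
move=> mF mG i j; under eq_fun do rewrite mxE.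
by apply: measurable_sum => l; exact: measurable_funM.
Qed.

Lemma mx_measurable_tr m n (F : T -> 'M[R]_(m, n)) :
  mx_measurable F -> mx_measurable (fun w => (F w)^T).
Proof. by move=> mF i j; under eq_fun do rewrite mxE; exact: mF. Qed.

Lemma mx_measurableZ m n (f : T -> R) (F : T -> 'M[R]_(m, n)) :
  measurable_fun setT f -> mx_measurable F -> mx_measurable (fun w => f w *: F w).
Proof.
by move=> mf mF i j; under eq_fun do rewrite mxE; exact: measurable_funM.
Qed.

Lemma mx_measurable_if m n (b : T -> bool) (F G : T -> 'M[R]_(m, n)) :
  measurable_fun setT b -> mx_measurable F -> mx_measurable G ->
  mx_measurable (fun w => if b w then F w else G w).
Proof.
move=> mb mF mG i j.
rewrite (_ : (fun w => _) = fun w => if b w then F w i j else G w i j).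
  exact: measurable_fun_ifT.
by apply/funext => w; case: ifP.
Qed.

Lemma measurable_det n (F : T -> 'M[R]_n) : mx_measurable F ->
  measurable_fun setT (fun w => \det (F w)).
Proof.
move=> mF; apply: measurable_sum => s; apply: measurable_funM => //.
by apply: measurable_prod => i _; exact: mF.
Qed.

Lemma measurable_unitmx n (F : T -> 'M[R]_n) : mx_measurable F ->
  measurable_fun setT (fun w => F w \in unitmx).
Proof.
move=> mF; under eq_fun do rewrite unitmxE unitfE.
apply: measurable_neg; apply: measurable_fun_eqr => //; exact: measurable_det.
Qed.

Lemma mx_measurable_inv n (F : T -> 'M[R]_n) : mx_measurable F ->
  mx_measurable (fun w => invmx (F w)).
Proof.
move=> mF; apply: mx_measurable_if => //; first exact: measurable_unitmx.
apply: mx_measurableZ; first by apply: measurable_inv; exact: measurable_det.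
move=> i j; under eq_fun do rewrite mxE.
apply: measurable_funM => //; apply: measurable_det => k l.
by under eq_fun do rewrite !mxE; exact: mF.
Qed.

Lemma mx_measurable_annihilator n k (B : T -> 'M[R]_(n, k)) : mx_measurable B ->
  mx_measurable (fun w => annihilator (B w)).
Proof.
move=> mB; apply: mx_measurableB; first exact: mx_measurable_cst.
apply: mx_measurableM; last exact: mx_measurable_tr.
apply: mx_measurableM => //; apply: mx_measurable_inv.
by apply: mx_measurableM => //; exact: mx_measurable_tr.
Qed.

Lemma mx_measurable_annihilator0 n k (B : T -> 'M[R]_(n, k)) : mx_measurable B ->
  mx_measurable (fun w => annihilator0 (B w)).
Proof.
move=> mB; apply: mx_measurable_if.
- by apply: measurable_unitmx; apply: mx_measurableM => //; exact: mx_measurable_tr.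
- exact: mx_measurable_annihilator.
- exact: mx_measurable_cst.
Qed.

Lemma mx_measurable_gram n k (M : T -> 'M[R]_n) (x : T -> 'I_n -> 'cV[R]_k) :
  mx_measurable M -> (forall i, mx_measurable (x^~ i)) ->
  mx_measurable (fun w => gram (M w) (x w)).
Proof.
move=> mM mx a b; under eq_fun do rewrite gramE.
apply: measurable_sum => i; apply: measurable_sum => j.
by apply: measurable_funM => //; apply: measurable_funM; exact: mx.
Qed.

Lemma mx_measurable_beta_hat n k (M : T -> 'M[R]_n) (x : T -> 'I_n -> 'cV[R]_k)
    (y : T -> 'I_n -> R) :
  mx_measurable M -> (forall i, mx_measurable (x^~ i)) ->
  (forall i, measurable_fun setT (y^~ i)) ->
  mx_measurable (fun w => beta_hat (M w) (x w) (y w)).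
Proof.
move=> mM mx my; apply: mx_measurableM.
  by apply: mx_measurable_inv; exact: mx_measurable_gram.
move=> a b; under eq_fun do rewrite summxE.
apply: measurable_sum => i; under eq_fun do rewrite summxE.
apply: measurable_sum => j; under eq_fun do rewrite mxE.
by apply: measurable_funM; [exact: measurable_funM|exact: mx].
Qed.

Lemma measurable_s2 n k l (M : T -> 'M[R]_n) (x : T -> 'I_n -> 'cV[R]_k)
    (y : T -> 'I_n -> R) :
  mx_measurable M -> (forall i, mx_measurable (x^~ i)) ->
  (forall i, measurable_fun setT (y^~ i)) ->
  measurable_fun setT (fun w => s2 (M w) (x w) (y w) l).
Proof.
move=> mM mx my; apply: measurable_funM => //.
apply: measurable_sum => i; apply: measurable_funX.
apply: measurable_sum => j; apply: measurable_funM => //.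
apply: measurable_funB => //; under eq_fun do rewrite dotvE.
apply: measurable_sum => a; apply: measurable_funM; last exact: mx.
exact: mx_measurable_beta_hat.
Qed.

Lemma measurable_mx_norm_le m n (F : T -> 'M[R]_(m, n)) e : 0 <= e ->
  mx_measurable F -> measurable [set w | `|F w| <= e].
Proof.
move=> e0 mF.
rewrite (_ : [set w | _] = \bigcap_(ij in [set: 'I_m * 'I_n]) [set w | `|F w ij.1 ij.2| <= e]).
  apply: fin_bigcap_measurable => // -[i j] _ /=.
  rewrite -[[set _ | _]]setTI (_ : [set w | _] = (fun w => `|F w i j| <= e) @^-1` [set true]).
    by apply: measurable_fun_ler => //; exact: measurableT_comp.
  by apply/seteqP; split.
apply/seteqP; split => w /=.
  rewrite /Num.norm /= mx_normrE => /bigmax_leP[_ h] ij _.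
  exact: (h ij).
move=> h; rewrite /Num.norm /= mx_normrE; apply/bigmax_leP; split => // ij _; exact: (h ij).
Qed.

Lemma mx_norm_le m n (A : 'M[R]_(m, n)) e : 0 <= e ->
  (forall i j, `|A i j| <= e) -> `|A| <= e.
Proof.
move=> e0 h; rewrite /Num.norm /= mx_normrE; apply/bigmax_leP; split => // ij _; exact: h.
Qed.
End MatrixMeasurability.

(** * The bias of the sieve *)

Section Sieve.
Context {d : measure_display} {T : measurableType d} {R : realType}.
Variable P : probability T R.
Local Notation L1 f := (P.-integrable setT (EFin \o f)).

Lemma identical_integral {dS} {S : measurableType dS} (X Y : {RV P >-> S})
    (phi : S -> R) :
  (forall A, measurable A -> P (X @^-1` A) = P (Y @^-1` A)) ->
  measurable_fun setT phi -> (forall s, 0 <= phi s) ->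
  (\int[P]_w (phi (X w))%:E = \int[P]_w (phi (Y w))%:E)%E.
Proof.
move=> XY mphi phi0.
have mE : measurable_fun setT (EFin \o phi) by exact/measurable_EFinP.
have h (U : {RV P >-> S}) :
    (\int[P]_w (phi (U w))%:E = \int[distribution P U]_s (phi s)%:E)%E.
  by rewrite (ge0_integral_distribution U mE).
rewrite !h; apply: eq_measure_integral => A mA _; exact: XY.
Qed.

(** If K_n were below A for arbitrarily large n, then K_n^g / n would be below
    A^g / n, hence below 1. *)
Lemma sieve_dim_ge (K : nat -> nat) (g : R) : 0 < g ->
  (fun n => (K n)%:R `^ g / n%:R : R) @ \oo --> +oo ->
  forall A : R, \forall n \near \oo, A <= (K n)%:R.
Proof.
move=> g0 /cvgryPge hK A.
near=> n.
have n0 : 0 < n%:R :> R by rewrite ltr0n; near: n; exact: (nbhs_infty_gt 0).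
have Kn : n%:R <= (K n)%:R `^ g :> R.
  rewrite -[leLHS]mul1r -ler_pdivlMr//; near: n; exact: hK.
have nA : Num.max A 0 `^ g <= n%:R by near: n; exact: nbhs_infty_ger.
rewrite leNgt; apply/negP => KA.
have KA' : (K n)%:R < Num.max A 0 by rewrite lt_max KA.
have := gt0_ltr_powR g0 _ _ KA'; rewrite !nnegrE ler0n le_max lexx orbT => /(_ isT isT).
by rewrite ltNge (le_trans nA Kn).
Unshelve. all: by end_near. Qed.

Lemma sieve_rate_cvg0 (K : nat -> nat) (a C : R) : 0 < a ->
  (forall A : R, \forall n \near \oo, A <= (K n)%:R) ->
  (fun n => C * (K n)%:R `^ (- 2 * a)) @ \oo --> 0.
Proof.
move=> a0 hK; rewrite -[X in _ --> X](mulr0 C); apply: cvgMl_tmp.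
apply/cvgrPdist_le => /= e e0.
have ei0 : 0 < e^-1 by rewrite invr_gt0.
have a2 : 0 < 2 * a by rewrite mulr_gt0.
apply: filterS (hK (e^-1 `^ (2 * a)^-1)) => n hn.
rewrite sub0r normrN ger0_norm ?powR_ge0// mulNr powRN.
rewrite -[leRHS]invrK lef_pV2 ?posrE//; last first.
  by apply: powR_gt0; exact: lt_le_trans (powR_gt0 _ ei0) hn.
have := ge0_ler_powR (ltW a2) _ _ hn; rewrite !nnegrE powR_ge0 ler0n => /(_ isT isT).
by rewrite -powRrM mulVf ?gt_eqF// powRr1// ltW.
Qed.

Variables (dz : nat) (z : nat -> {RV P >-> dz.-tuple R}).
Variables (p : nat -> {mfun (dz.-tuple R) >-> R}) (K : nat -> nat).
Hypothesis z_id : forall i A, measurable A -> P (z i @^-1` A) = P (z 0%N @^-1` A).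

Definition ann n w := annihilator0 (Pmx z p n (K n) w).

Lemma measurable_ann n : mx_measurable (ann n).
Proof.
apply: mx_measurable_annihilator0 => i j; under eq_fun do rewrite mxE.
exact: measurableT_comp.
Qed.

(** The annihilator kills every linear combination of the approximating functions,
    so [f] may be replaced by its approximation error.  A projection does not
    increase norms, and the z_i are identically distributed, so a combination
    that is good for z_0 is good for all of them. *)
Lemma sieve_bias_cvg0 (f : dz.-tuple R -> R) (r : nat -> R) :
  measurable_fun setT f ->
  (\forall n \near \oo, exists eta : 'cV[R]_(K n),
    (\int[P]_w ((f (z 0%N w) - dotv eta (pvec p (K n) (z 0%N w))) ^+ 2)%:E <= (r n)%:E)%E) ->
  r @ \oo --> 0 ->
  t.1%:R^-1 * bil (ann t.1 t.2) (fun i => f (z i t.2)) (fun i => f (z i t.2))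
    @[t --> inprob P] --> 0.
Proof.
move=> mf hf r0.
apply: (@cvg_inprob_L1 _ _ _ P (fun n w => n%:R^-1 * bil (ann n w) (fun i => f (z i w))
    (fun i => f (z i w))) r) => //.
have := nbhs_infty_gt 0; apply: filterS2 hf => n [eta heta] n0.
pose phi t := (f t - dotv eta (pvec p (K n) t)) ^+ 2.
have mphi : measurable_fun setT phi.
  apply: measurable_funX; apply: measurable_funB => //.
  under eq_fun do rewrite dotvE; apply: measurable_sum => a.
  by under eq_fun do rewrite !mxE; exact: measurable_funM.
have phi0 t : 0 <= phi t by exact: sqr_ge0.
have Iphi i : (\int[P]_w (phi (z i w))%:E <= (r n)%:E)%E.
  by rewrite (@identical_integral _ _ (z i) (z 0%N))//; exact: z_id.
have mphiz i : measurable_fun setT (fun w => phi (z i w)) by exact: measurableT_comp.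
have Lphi i : L1 (fun w => phi (z i w)).
  apply/integrableP; split; first exact/measurable_EFinP.
  under eq_integral do rewrite /= ger0_norm//.
  exact: le_lt_trans (Iphi i) (ltry _).
have bil0 w : 0 <= n%:R^-1 * bil (ann n w) (fun i => f (z i w)) (fun i => f (z i w)).
  rewrite mulr_ge0// bil_ge0//; [exact: annihilator0_sym|exact: annihilator0_idem].
have bille w : n%:R^-1 * bil (ann n w) (fun i => f (z i w)) (fun i => f (z i w)) <=
    n%:R^-1 * \sum_(i < n) phi (z i w).
  rewrite ler_wpM2l//.
  rewrite -(@bil_kernel _ _ _ (annihilator0_sym _) (annihilator0_idem _) _
     (fun i : 'I_n => dotv eta (pvec p (K n) (z i w)))).
    exact: bil_le (annihilator0_sym _) (annihilator0_idem _) _.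
  move=> i; transitivity ((ann n w *m Pmx z p n (K n) w *m eta) i 0).
    rewrite -mulmxA mxE; apply: eq_bigr => j _; congr (_ * _).
    by rewrite dotvE mxE; apply: eq_bigr => a _; rewrite !mxE mulrC.
  by rewrite annihilator0_mul mul0mx mxE.
have Lsum : L1 (fun w => n%:R^-1 * \sum_(i < n) phi (z i w)).
  by apply: L1Z; exact: L1_sum.
have Lb : L1 (fun w => n%:R^-1 * bil (ann n w) (fun i => f (z i w)) (fun i => f (z i w))).
  apply: le_L1 Lsum _; last by move=> w; rewrite ger0_norm.
  apply: measurable_funM => //; apply: measurable_sum => i; apply: measurable_sum => j.
  apply: measurable_funM; first exact: measurable_ann.
  by apply: measurable_funM; exact: measurableT_comp.
split=> //.
apply: (@le_trans _ _ (\int[P]_w (n%:R^-1 * \sum_(i < n) phi (z i w)))).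
  exact: le_Rintegral.
rewrite RintegralZl//; last exact: L1_sum.
rewrite Rintegral_sum// ler_pdivrMl ?ltr0n//.
have -> : n%:R * r n = \sum_(i < n) r n by rewrite sumr_const card_ord mulr_natl.
apply: ler_sum => i _; rewrite -lee_fin /Rintegral fineK ?Iphi//.
exact: (integrable_fin_num measurableT (Lphi i)).
Qed.
End Sieve.

(** * Errors and regressors of the partially linear model *)

Lemma noise_weaken {d : measure_display} {T : measurableType d} {R : realType}
    (P : probability T R) {dS : measure_display} {S : measurableType dS}
    (X : nat -> T -> S) {dW : measure_display} {SW : measurableType dW}
    (zeta : S -> SW) (k k' : R) (a : nat -> S -> R) :
  k <= k' -> noise P X zeta k a -> noise P X zeta k' a.
Proof.
move=> kk' [ma La Ea a0 va]; split => //.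
  by move=> i; exact: le_trans (Ea i) kk'.
move=> i; have [m2 hm bm] := va i; exists m2 => // t; exact: le_trans (bm t) kk'.
Qed.

Section PLM.
Context {dO : measure_display} {Omega : measurableType dO} {R : realType}.
Variables (P : probability Omega R) (d dz : nat).
Variables (y : nat -> {RV P >-> R}) (x : nat -> {RV P >-> d.-tuple R})
  (z : nat -> {RV P >-> dz.-tuple R}).
Variables (beta0 : 'cV[R]_d) (g : {mfun (dz.-tuple R) >-> R})
  (h : dz.-tuple R -> 'cV[R]_d) (p : nat -> {mfun (dz.-tuple R) >-> R}).
Variables (K : nat -> nat) (alpha_g alpha_h sigma_eps : R).
Hypothesis hmodel : model y x z beta0 g h.
Hypothesis hPLM : assumption_PLM y x z beta0 g h p K alpha_g alpha_h.
Hypothesis hhom : forall i, is_cond_expectation P (xz x z i)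
  (fun w => eps y x z beta0 g i w ^+ 2) (cst (sigma_eps ^+ 2)).
Local Notation L1 f := (P.-integrable setT (EFin \o f)).
Local Notation OBS := (R * (d.-tuple R * dz.-tuple R))%type.
Local Notation X := (obs y x z).

Definition stat_z (s : OBS) := s.2.2.
Definition stat_xz (s : OBS) := s.2.
(** The error and the regressor deviation as functions of an observation, indexed
    in the way that [noise] expects. *)
Definition err (i : nat) (s : OBS) : R :=
  s.1 - dotv (col_of_tuple s.2.1) beta0 - g s.2.2.
Definition reg (a : 'I_d) (i : nat) (s : OBS) : R :=
  (col_of_tuple s.2.1 - h s.2.2) a 0.

Lemma measurable_obs i : measurable_fun setT (X i).
Proof. by have [] := PLM_a hPLM. Qed.

Lemma independent_obs (I : seq nat) (A : nat -> set OBS) : uniq I ->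
  (forall i, measurable (A i)) ->
  (P (\bigcap_(i in [set` I]) (X i @^-1` A i)) = \prod_(i <- I) P (X i @^-1` A i))%E.
Proof. by have [_ _] := PLM_a hPLM; apply. Qed.

Lemma measurable_stat_xz : measurable_fun setT stat_xz.
Proof. exact: measurable_snd. Qed.

Lemma measurable_stat_z : measurable_fun setT stat_z.
Proof. exact: (measurableT_comp measurable_snd measurable_snd). Qed.

Lemma measurable_h a : measurable_fun setT (fun t => h t a 0).
Proof. by have [] := model_h hmodel 0 a 0. Qed.

Lemma measurable_col_of_tuple a :
  measurable_fun setT (fun t : d.-tuple R => col_of_tuple t a 0).
Proof. by under eq_fun do rewrite mxE; exact: measurable_tnth. Qed.

Lemma measurable_err i : measurable_fun setT (err i).
Proof.
apply: measurable_funB; last exact: measurableT_comp measurable_stat_z.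
apply: measurable_funB => //; under eq_fun do rewrite dotvE.
apply: measurable_sum => a; apply: measurable_funM => //.
apply: (measurableT_comp (measurable_col_of_tuple a)).
exact: (measurableT_comp measurable_fst measurable_snd).
Qed.

Definition reg_xz a (s : d.-tuple R * dz.-tuple R) := (col_of_tuple s.1 - h s.2) a 0.

Lemma measurable_reg_xz a : measurable_fun setT (reg_xz a).
Proof.
rewrite (_ : reg_xz a = fun s => col_of_tuple s.1 a 0 - h s.2 a 0); last first.
  by apply/funext => s; rewrite /reg_xz !mxE.
apply: measurable_funB.
  exact: (measurableT_comp (measurable_col_of_tuple a) measurable_fst).
exact: (measurableT_comp (measurable_h a) measurable_snd).
Qed.

Lemma regE a i : reg a i = reg_xz a \o stat_xz.
Proof. by []. Qed.

Lemma measurable_reg a i : measurable_fun setT (reg a i).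
Proof.
rewrite regE; exact: (measurableT_comp (measurable_reg_xz a) measurable_stat_xz).
Qed.

Lemma pow4 (r : R) : r ^+ 4 = (r ^+ 2) ^+ 2.
Proof. by rewrite -exprM. Qed.

Lemma cond_expectation_integral {dS} {S : measurableType dS} (W : Omega -> S)
  (U : Omega -> R) (Y : S -> R) : is_cond_expectation P W U Y ->
  \int[P]_w U w = \int[P]_w Y (W w).
Proof.
by move=> [_ _ _ _ /(_ setT measurableT)]; rewrite preimage_setT /Rintegral => ->.
Qed.

Lemma integral_ae_le (U : Omega -> R) C : L1 U -> {ae P, forall w, U w <= C} ->
  \int[P]_w U w <= C.
Proof.
move=> LU UC.
have mU := L1_measurable LU.
rewrite (_ : \int[P]_w U w = \int[P]_w Num.min (U w) C).
  rewrite -[leRHS](Rintegral_cstT P C); apply: le_Rintegral => //.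
  - apply: ae_eq_L1 LU; first exact: measurable_minr.
    by apply: filterS UC => w UC; rewrite min_l.
  - exact: L1_cst.
  - by move=> w _; rewrite ge_min lexx orbT.
congr fine; apply: ae_eq_integral => //.
- exact/measurable_EFinP.
- by apply/measurable_EFinP; exact: measurable_minr.
- by apply: filterS UC => w UC _; rewrite min_l.
Qed.

Lemma err_L4 i : pow_integrable P 4 (err i \o X i).
Proof.
split; first exact: measurableT_comp (measurable_err i) (measurable_obs i).
have [C /(_ i)[[m4 [_ + _ _ _] _] _]] := PLM_b hPLM; exact.
Qed.

Lemma err_noise : exists k0, noise P X stat_z k0 err.
Proof.
have [C hC] := PLM_b hPLM; exists (Num.max C (sigma_eps ^+ 2)); split.
- exact: measurable_err.
- exact: err_L4.
- move=> i; have [[m4 hm4 bm4] _] := hC i; have [_ _ _ Lm4 _] := hm4.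
  rewrite le_max; apply/orP; left.
  rewrite (_ : \int[P]_w _ = \int[P]_w m4 (xz x z i w)); last first.
    exact: cond_expectation_integral hm4.
  exact: integral_ae_le.
- move=> i; exact: (coarser_cond_expectation measurable_snd (model_eps hmodel i)).
- move=> i; exists (cst (sigma_eps ^+ 2)).
    exact: (coarser_cond_expectation measurable_snd (hhom i)).
  by move=> t; rewrite /= ger0_norm ?sqr_ge0// le_max lexx orbT.
Qed.

Lemma reg_sqr_le_enorm a i w : reg a i (X i w) ^+ 2 <= enorm (v x z h i w) ^+ 2.
Proof.
rewrite /enorm sqr_sqrtr; last by apply: sumr_ge0 => b _; exact: sqr_ge0.
rewrite (bigD1 a)//= lerDl; apply: sumr_ge0 => b _; exact: sqr_ge0.
Qed.

Lemma reg_pow4_le_enorm a i w : reg a i (X i w) ^+ 4 <= enorm (v x z h i w) ^+ 4.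
Proof.
by rewrite !pow4 ler_sqr ?nnegrE ?sqr_ge0//; exact: reg_sqr_le_enorm.
Qed.

Lemma reg_L4 a i : pow_integrable P 4 (reg a i \o X i).
Proof.
have mr := measurableT_comp (measurable_reg a i) (measurable_obs i).
split=> //; have [C /(_ i)[_ [m4 [_ Lv _ _ _] _]]] := PLM_b hPLM.
apply: le_L1 Lv _; first exact: measurable_funX.
move=> w; rewrite ger0_norm ?reg_pow4_le_enorm// pow4; exact: sqr_ge0.
Qed.

Lemma reg_mean0 a i :
  is_cond_expectation P (stat_z \o X i) (reg a i \o X i) (cst 0).
Proof.
have hx := model_h hmodel i a 0; have [mz Lx mh Lh _] := hx.
have hh : is_cond_expectation P (z i) (fun w => h (z i w) a 0) (fun t => h t a 0) by split.
have := is_cond_expectationB hx hh.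
rewrite (_ : (fun w => _) = reg a i \o X i); last first.
  by apply/funext => w; rewrite /reg /= !mxE.
rewrite (_ : (fun s : dz.-tuple R => _) = cst 0)//.
by apply/funext => t; rewrite subrr.
Qed.

(** The versions supplied by the assumptions are symmetric, bounded and positive
    definite only almost surely.  Truncating their entries makes them bounded
    everywhere and changes them on a null set.  The bound on the entries comes
    from |v_a v_b| <= 1 + |v|^4. *)
Lemma cond_cov : exists2 c, 0 < c & exists k0 (Vz : nat -> dz.-tuple R -> 'M[R]_d),
  forall i, [/\
    forall a b, is_cond_expectation P (stat_z \o X i)
      (fun w => reg a i (X i w) * reg b i (X i w)) (fun t => Vz i t a b),
    forall t a b, `|Vz i t a b| <= k0 &
    {ae P, forall w, forall t, c * \sum_a t a ^+ 2 <= bil (Vz i (z i w)) t t}].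
Proof.
have [c c0 hc] := PLM_c hPLM; have [C hC] := PLM_b hPLM; exists c => //.
exists (1 + `|C|).
suff : forall i, exists Vi : dz.-tuple R -> 'M[R]_d, [/\
    forall a b, is_cond_expectation P (stat_z \o X i)
      (fun w => reg a i (X i w) * reg b i (X i w)) (fun t => Vi t a b),
    forall t a b, `|Vi t a b| <= 1 + `|C| &
    {ae P, forall w, forall t, c * \sum_a t a ^+ 2 <= bil (Vi (z i w)) t t}].
  by move=> /choice[Vz hVz]; exists Vz.
move=> i; have [_ [V hV lV]] := hc i; have [_ [m4 hm4 bm4]] := hC i.
have hVab a b : is_cond_expectation P (stat_z \o X i)
      (fun w => reg a i (X i w) * reg b i (X i w)) (fun t => V t a b).
  have e : (fun w => (v x z h i w *m (v x z h i w)^T) a b) =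
      (fun w => reg a i (X i w) * reg b i (X i w)).
    by apply/funext => w; rewrite mxE big_ord1 [X in _ * X]mxE.
  by have := hV a b; rewrite e.
have mz : measurable_fun setT (stat_z \o X i).
  exact: measurableT_comp measurable_stat_z (measurable_obs i).
have h1 : is_cond_expectation P (stat_z \o X i)
    (fun w => 1 + enorm (v x z h i w) ^+ 4) (fun t => 1 + m4 t).
  exact: (is_cond_expectationD (is_cond_expectation_cst P 1 mz) hm4).
have prod_le a b w : `|reg a i (X i w) * reg b i (X i w)| <= 1 + enorm (v x z h i w) ^+ 4.
  have := reg_sqr_le_enorm a i w; have := reg_sqr_le_enorm b i w.
  rewrite pow4; set q := enorm _ ^+ 2; rewrite ler_norml => ha hb.
  have := sqr_ge0 (reg a i (X i w) - reg b i (X i w)).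
  have := sqr_ge0 (reg a i (X i w) + reg b i (X i w)).
  by have := sqr_ge0 (q - 1) => *; apply/andP; split; nra.
have bV a b : {ae P, forall w, `|V (z i w) a b| <= 1 + `|C|}.
  have up := cond_expectation_mono (hVab a b) h1
    (aeW P (fun w => le_trans (ler_norm _) (prod_le a b w))).
  have lo : {ae P, forall w, (fun t => -1 * V t a b) (z i w) <= 1 + m4 (z i w)}.
    apply: (cond_expectation_mono (is_cond_expectationZ (-1) (hVab a b)) h1).
    apply: aeW => w; apply: le_trans (prod_le a b w).
    by rewrite mulN1r -normrN ler_norm.
  apply: filterS3 up lo bm4 => w u1 l1 b4.
  have Cn := ler_norm C; rewrite ler_norml; move: u1 l1; rewrite /stat_z /=.
  by move=> *; apply/andP; split; lra.
pose k := 1 + `|C|.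
have k0 : 0 <= k by rewrite addr_ge0.
pose Vi t : 'M[R]_d := \matrix_(a, b) (if `|V t a b| <= k then V t a b else 0).
have ViV : {ae P, forall w, forall a b, Vi (z i w) a b = V (z i w) a b}.
  suff : {ae P, forall w, forall ab : 'I_d * 'I_d, Vi (z i w) ab.1 ab.2 = V (z i w) ab.1 ab.2}.
    by apply: filterS => w hw a b; exact: (hw (a, b)).
  apply: filter_forall => ab; apply: filterS (bV ab.1 ab.2) => w bw.
  by rewrite mxE bw.
exists Vi; split.
- move=> a b; apply: ae_is_cond_expectation (hVab a b).
  + apply: measurable_funM; [exact: (measurableT_comp (measurable_reg a i) (measurable_obs
      i))|exact: (measurableT_comp (measurable_reg b i) (measurable_obs i))].
  + have [_ _ mV _ _] := hVab a b.
    under eq_fun do rewrite mxE; apply: measurable_fun_ifT => //.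
    by apply: measurable_fun_ler => //; exact: measurableT_comp.
  + exact: aeW.
  + by apply: filterS ViV => w ->.
- by move=> t a b; rewrite mxE; case: ifP; rewrite ?normr0.
- have symV : {ae P, forall w, forall a b, V (z i w) a b = V (z i w) b a}.
    suff : {ae P, forall w, forall ab : 'I_d * 'I_d, V (z i w) ab.1 ab.2 = V (z i w) ab.2 ab.1}.
      by apply: filterS => w hw a b; exact: (hw (a, b)).
    apply: filter_forall => ab; have hba := hVab ab.2 ab.1.
    rewrite (_ : (fun w => _) =
        (fun w => reg ab.1 i (X i w) * reg ab.2 i (X i w))) in hba; last first.
      by apply/funext => w; rewrite mulrC.
    exact: cond_expectation_unique (hVab ab.1 ab.2) hba.
  apply: filterS3 lV ViV symV => w lw vw sw t.
  have -> : Vi (z i w) = V (z i w) by apply/matrixP => a b; exact: vw.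
  by apply: lambda_min_le => //; apply/matrixP => a b; rewrite mxE sw.
Qed.

Lemma reg_noise : exists k0, forall a, noise P X stat_z k0 (reg a).
Proof.
have [c _ [k1 [Vz hVz]]] := cond_cov; have [C hC] := PLM_b hPLM.
exists (Num.max C k1) => a; split.
- exact: measurable_reg.
- exact: reg_L4.
- move=> i; have [_ [m4 hm4 bm4]] := hC i; have [_ Lv _ Lm4 _] := hm4.
  rewrite le_max; apply/orP; left.
  apply: (@le_trans _ _ (\int[P]_w (enorm (v x z h i w) ^+ 4))).
    apply: le_Rintegral => //; first exact: (proj2 (reg_L4 a i)).
    by move=> w _; exact: reg_pow4_le_enorm.
  rewrite (cond_expectation_integral hm4); exact: integral_ae_le.
- exact: reg_mean0.
- move=> i; have [hce hb _] := hVz i; exists (fun t => Vz i t a a).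
    exact: hce.
  by move=> t; rewrite le_max hb orbT.
Qed.

(** The error is centred given (x_i, z_i), of which the deviation is a function. *)
Lemma reg_err_orth a i : is_cond_expectation P (stat_z \o X i)
  (fun w => reg a i (X i w) * err i (X i w)) (cst 0).
Proof.
have Lre := L2M (L4_L2 (reg_L4 a i)) (L4_L2 (err_L4 i)).
apply: cond_expectation_of_orth.
- exact: (measurableT_comp measurable_stat_z (measurable_obs i)).
- exact: Lre.
- exact: measurable_cst.
- exact: L1_cst.
- move=> B mB.
  pose u (s : d.-tuple R * dz.-tuple R) := \1_B s.2 * reg_xz a s.
  have mI : measurable_fun setT (\1_B : dz.-tuple R -> R) by exact: measurable_indic.
  have mu : measurable_fun setT u.
    apply: measurable_funM; last exact: measurable_reg_xz.
    exact: (measurableT_comp mI measurable_snd).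
  have mzB : measurable ((stat_z \o X i) @^-1` B).
    exact: (measurable_preimage (measurableT_comp measurable_stat_z (measurable_obs i)) mB).
  have := @cond_expectation_pullout0 _ _ _ P _ _ _ _ (u \o xz x z i) u (model_eps hmodel i) mu
      (fun=> erefl).
  rewrite (@eq_Rintegral _ _ _ _ _
      (fun w => \1_B ((stat_z \o X i) w) * (reg a i (X i w) * err i (X i w)))); last first.
    by move=> w _; rewrite mulrA.
  move=> e0; rewrite -[RHS]e0.
    by apply: eq_Rintegral => w _; rewrite /= subr0.
  rewrite (_ : (fun w => _) =
      (fun w => \1_((stat_z \o X i) @^-1` B) w * (reg a i (X i w) * err i (X i w)))).
    exact: L1_indic_mul.
  by apply/funext => w; rewrite mulrA.
Qed.

(** * Limits of the scaled quadratic forms *)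

Local Notation F := (inprob P).
Local Notation Mn := (ann z p K).

Lemma ann_sym n w (i j : 'I_n) : Mn n w i j = Mn n w j i.
Proof. by rewrite /ann -[in LHS]annihilator0_sym mxE. Qed.

Lemma ann_idem n w (i j : 'I_n) : \sum_k Mn n w i k * Mn n w k j = Mn n w i j.
Proof. by rewrite /ann -[in RHS]annihilator0_idem mxE. Qed.

Lemma ann_known_z n (i j k : 'I_n) :
  measurable_fun setT ((fun w => Mn n w i j) : leave_one_out X stat_z n k -> R).
Proof.
apply: (@mx_measurable_annihilator0 _ (leave_one_out X stat_z n k)) => a b.
under eq_fun do rewrite mxE.
by apply: (known_stat measurable_stat_z).
Qed.

Lemma ann_known_xz n (i j k : 'I_n) :
  measurable_fun setT ((fun w => Mn n w i j) : leave_one_out X stat_xz n k -> R).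
Proof.
apply: (@mx_measurable_annihilator0 _ (leave_one_out X stat_xz n k)) => a b.
under eq_fun do rewrite mxE.
apply: (@known_stat _ _ _ _ _ X _ _ stat_xz measurable_stat_xz n k (fun s => p b s.2)) => //.
exact: (measurableT_comp _ measurable_snd).
Qed.

(** A function of the pair (n, w), so that its limit along [inprob] can be taken. *)
Definition form (u v : nat -> OBS -> R) (t : nat * Omega) : R :=
  t.1%:R^-1 * bil (Mn t.1 t.2) (fun i => u i (X i t.2)) (fun i => v i (X i t.2)).

Definition weighted_diag (c : nat -> dz.-tuple R -> R) (t : nat * Omega) : R :=
  t.1%:R^-1 * \sum_i Mn t.1 t.2 i i * c i (z i t.2).

(** A second moment of order n, scaled by n^-2, tends to 0. *)
Lemma form_noise_cvg kappa u v c : noise P X stat_z kappa u -> noise P X stat_z kappa v ->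
  (forall i, is_cond_expectation P (stat_z \o X i) (fun w => u i (X i w) * v i (X i w)) (c i)) ->
  (forall i t, `|c i t| <= kappa) ->
  form u v t - weighted_diag c t @[t --> F] --> 0.
Proof.
move=> nu nv hc bc.
have H n := @quadratic_form_sqr _ _ _ P _ _ X measurable_obs independent_obs _ _ stat_z
  measurable_stat_z n (Mn n) (@ann_known_z n) (@ann_sym n) (@ann_idem n) kappa u v c nu nv hc bc.
have := @cvg_inprob_L2 _ _ _ P _ _ (fun n => proj1 (H n)) (fun n => proj2 (H n)).
by under eq_fun do rewrite mulrBr.
Qed.

Lemma form_ge0 u t : 0 <= form u u t.
Proof.
rewrite /form mulr_ge0// bil_ge0//; [exact: annihilator0_sym|exact: annihilator0_idem].
Qed.

Lemma formC u v t : form u v t = form v u t.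
Proof. by rewrite /form bilC//; exact: annihilator0_sym. Qed.

Lemma form_CauchySchwarz u v t : form u v t ^+ 2 <= form u u t * form v v t.
Proof.
rewrite /form exprMn [leRHS]mulrACA -expr2; apply: ler_wpM2l; first exact: sqr_ge0.
apply: bil_CauchySchwarz; first exact: annihilator0_sym.
by move=> u'; apply: bil_ge0; [exact: annihilator0_sym|exact: annihilator0_idem].
Qed.

Definition add_effect (u v : nat -> OBS -> R) : nat -> OBS -> R := fun i s => u i s + v i s.

Lemma formDD u v u' v' t :
  form (add_effect u v) (add_effect u' v') t = form u u' t + form u v' t + form v u' t +
      form v v' t.
Proof.
have s := annihilator0_sym (Pmx z p t.1 (K t.1) t.2).
by rewrite /form bilDl !(bilDr s) /=; ring.
Qed.

Lemma form_cross_cvg0 u v C : form u u t @[t --> F] --> 0 ->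
  (\forall t \near F, form v v t <= C) -> form u v t @[t --> F] --> 0.
Proof.
move=> u0 vC; apply/cvgrPdist_le => /= e e0.
have C1 : 0 < `|C| + 1 by rewrite ltr_wpDl.
have q0 : 0 < e ^+ 2 / (`|C| + 1) by rewrite divr_gt0// exprn_gt0.
have /cvgrPdist_le/(_ _ q0) hu := u0.
near=> t.
rewrite sub0r normrN -(@ler_pXn2r _ 2)// ?nnegrE ?(ltW e0)// real_normK ?num_real//.
apply: le_trans (form_CauchySchwarz u v t) _.
have uq : form u u t <= e ^+ 2 / (`|C| + 1).
  have : `|0 - form u u t| <= e ^+ 2 / (`|C| + 1) by near: t.
  by rewrite sub0r normrN ger0_norm// form_ge0.
have vC' : form v v t <= `|C| + 1.
  have : form v v t <= C by near: t.
  move/le_trans; apply; rewrite ler_wpDr//; exact: ler_norm.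
rewrite ler_pdivlMr// in uq.
apply: le_trans uq; apply: ler_wpM2l => //; exact: form_ge0.
Unshelve. all: by end_near. Qed.

Lemma wdiag_le c C t : (forall i s, `|c i s| <= C) -> `|weighted_diag c t| <= C.
Proof.
move=> hc; have C0 : 0 <= C by exact: le_trans (normr_ge0 _) (hc 0 point).
rewrite /weighted_diag normrM ger0_norm ?invr_ge0//.
have [->|n0] := eqVneq t.1 0%N; first by rewrite invr0 mul0r.
have np : 0 < t.1%:R :> R by rewrite ltr0n lt0n.
rewrite ler_pdivrMl//; apply: le_trans (ler_norm_sum _ _ _) _.
have -> : t.1%:R * C = \sum_(i < t.1) C by rewrite sumr_const card_ord mulr_natl.
apply: ler_sum => i _; rewrite normrM -[leRHS]mul1r ler_pM//.
rewrite ger0_norm.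
  exact: (projection_diag_le1 (@ann_sym t.1) (@ann_idem t.1)).
exact: (projection_diag_ge0 (@ann_sym t.1) (@ann_idem t.1)).
Qed.

Lemma form_noise_bounded kappa u c : noise P X stat_z kappa u ->
  (forall i, is_cond_expectation P (stat_z \o X i) (fun w => u i (X i w) * u i (X i w)) (c i)) ->
  (forall i t, `|c i t| <= kappa) ->
  \forall t \near F, form u u t <= kappa + 1.
Proof.
move=> nu hc bc; have := form_noise_cvg nu nu hc bc => /cvgrPdist_le/(_ 1 ltr01).
apply: (@filterS _ F) => t; rewrite sub0r normrN => hb.
have := wdiag_le t bc; have := ler_norm (form u u t - weighted_diag c t).
have := ler_norm (weighted_diag c t); lra.
Qed.

Definition g_effect : nat -> OBS -> R := fun _ s => g s.2.2.
Definition h_effect (a : 'I_d) : nat -> OBS -> R := fun _ s => h s.2.2 a 0.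

Hypothesis hK : (fun n => (K n)%:R `^ (2 * (alpha_g + alpha_h)) / n%:R : R) @ \oo --> +oo.

Lemma sieve_dim_large (A : R) : \forall n \near \oo, A <= (K n)%:R.
Proof.
have [ag [ah _]] := PLM_e hPLM; apply: (sieve_dim_ge _ hK).
by rewrite mulr_gt0// addr_gt0.
Qed.

Lemma z_identical i (A : set (dz.-tuple R)) : measurable A ->
  P (z i @^-1` A) = P (z 0%N @^-1` A).
Proof.
move=> mA; have [_ idX _] := PLM_a hPLM.
exact: (idX i _ (measurable_preimage measurable_stat_z mA)).
Qed.

Lemma form_g_cvg0 : form g_effect g_effect t @[t --> F] --> 0.
Proof.
have [ag [ah [C hC]]] := PLM_e hPLM.
apply: (sieve_bias_cvg0 z_identical (f := g) (r := fun n => C * (K n)%:R `^ (- 2 * alpha_g))) => //.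
  apply: filterS hC => n /(_ 0%N)[[eta _ heta] _]; exists eta.
  apply: le_trans heta; rewrite unlock.
  rewrite le_eqVlt; apply/orP; left; apply/eqP; apply: eq_integral => w _.
  by congr EFin; rewrite real_normK ?num_real.
exact: sieve_rate_cvg0 ag sieve_dim_large.
Qed.

Lemma form_h_cvg0 a : form (h_effect a) (h_effect a) t @[t --> F] --> 0.
Proof.
have [ag [ah [C hC]]] := PLM_e hPLM.
apply: (sieve_bias_cvg0 z_identical (f := fun t => h t a 0) (r := fun n => C * (K n)%:R `^ (- 2
    * alpha_h))).
- exact: measurable_h.
- apply: filterS hC => n /(_ 0%N)[_ [eta _ heta]]; exists (col a eta).
  have mz : measurable_fun setT (z 0%N) by [].
  have me (b : 'I_d) : measurable_fun setT (fun t => (h t - eta^T *m pvec p (K n) t) b 0).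
    rewrite (_ : (fun t => _) = fun t => h t b 0 - \sum_j eta j b * p j t); last first.
      apply/funext => t; rewrite !mxE; congr (_ - _); apply: eq_bigr => j _.
      by rewrite !mxE.
    apply: measurable_funB; first exact: measurable_h.
    by apply: measurable_sum => j; exact: measurable_funM.
  have men : measurable_fun setT (fun t => enorm (h t - eta^T *m pvec p (K n) t) ^+ 2).
    rewrite (_ : (fun t => _) = fun t => \sum_b ((h t - eta^T *m pvec p (K n) t) b 0) ^+ 2).
      by apply: measurable_sum => b; exact: measurable_funX.
    apply/funext => t; rewrite /enorm sqr_sqrtr//; apply: sumr_ge0 => b _; exact: sqr_ge0.
  apply: le_trans heta; rewrite unlock; apply: ge0_le_integral => //.
  + by move=> w _; rewrite lee_fin sqr_ge0.
  + apply/measurable_EFinP; apply: measurable_funX; apply: measurable_funB.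
      exact: (measurableT_comp (measurable_h a) mz).
    under eq_fun do rewrite dotvE; apply: measurable_sum => j.
    by under eq_fun do rewrite !mxE; apply: measurable_funM => //; exact: measurableT_comp.
  + by apply/measurable_EFinP; exact: (measurableT_comp men mz).
  + move=> w _; rewrite lee_fin /enorm sqr_sqrtr; last first.
      by apply: sumr_ge0 => b _; exact: sqr_ge0.
    rewrite (bigD1 a)//=.
    rewrite (_ : (h (z 0%N w) - _) a 0 = h (z 0%N w) a 0 -
        dotv (col a eta) (pvec p (K n) (z 0%N w))).
      by rewrite lerDl; apply: sumr_ge0 => b _; exact: sqr_ge0.
    by rewrite dotvE !mxE; congr (_ - _); apply: eq_bigr => j _; rewrite !mxE.
exact: sieve_rate_cvg0 ah sieve_dim_large.
Qed.

(** * The conditional variance of the score *)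

Section ScoreVariance.
Variables (kappa : R) (Vz : nat -> dz.-tuple R -> 'M[R]_d).
Hypothesis nreg : forall a, noise P X stat_z kappa (reg a).
Hypothesis hVz : forall i a b, is_cond_expectation P (stat_z \o X i)
  (fun w => reg a i (X i w) * reg b i (X i w)) (fun t => Vz i t a b).
Hypothesis bVz : forall i t a b, `|Vz i t a b| <= kappa.
Variable n : nat.

(** A coordinate of the score, with the sums exchanged so that the errors come
    last. *)
Definition score_sum a w : R :=
  \sum_(j < n) (\sum_(i < n) Mn n w i j * reg a i (X i w)) * err j (X j w).

Lemma ann_le1 w i j : `|Mn n w i j| <= 1.
Proof. exact: (projection_le1 (@ann_sym n) (@ann_idem n)). Qed.

Lemma measurable_ann_entry i j : measurable_fun setT (fun w => Mn n w i j).
Proof. exact: measurable_ann. Qed.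

Lemma score_sum_L2 a : pow_integrable P 2 (score_sum a).
Proof.
apply: L2_sum => j; apply: L4M (err_L4 j); apply: L4_sum => i.
exact: (pow_integrable_bounded_mul (reg_L4 a i) (measurable_ann_entry i j)
    (fun w => ann_le1 w i j)).
Qed.

Lemma score_entry a w : Mmx z p n (K n) w = Mn n w ->
  score y x z beta0 g h p n (K n) w a 0 = score_sum a w.
Proof.
move=> MM; rewrite /score MM /score_sum summxE.
under eq_bigr do rewrite summxE.
rewrite exchange_big/=; apply: eq_bigr => j _; rewrite mulr_suml.
by apply: eq_bigr => i _; rewrite mxE mulrAC.
Qed.

(** The annihilator as a function of the tuple of the z_i, on which conditional
    expectations given Z are evaluated. *)
Definition ann_t (t : n.-tuple (dz.-tuple R)) : 'M[R]_n :=
  annihilator0 (\matrix_(i < n, j < K n) p j (tnth t i)).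

Lemma ann_tE w : ann_t (Z z n w) = Mn n w.
Proof.
rewrite /ann_t /ann; congr annihilator0; apply/matrixP => i j.
by rewrite !mxE tnth_mktuple.
Qed.

Lemma mx_measurable_ann_t : mx_measurable ann_t.
Proof.
apply: mx_measurable_annihilator0 => i j; under eq_fun do rewrite mxE.
by apply: measurableT_comp => //; exact: measurable_tnth.
Qed.

Definition score_var a b (t : n.-tuple (dz.-tuple R)) : R :=
  sigma_eps ^+ 2 * \sum_i ann_t t i i * Vz i (tnth t i) a b.

Lemma measurable_score_var a b : measurable_fun setT (score_var a b).
Proof.
apply: measurable_funM => //; apply: measurable_sum => i.
apply: measurable_funM; first exact: mx_measurable_ann_t.
have [_ _ mV _ _] := hVz i a b.
exact: (measurableT_comp mV (measurable_tnth i)).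
Qed.

Lemma measurable_Z : measurable_fun setT (Z z n).
Proof.
apply/measurable_fun_tnthP => i.
by rewrite (_ : _ \o _ = z i)//; apply/funext => w; rewrite /= tnth_mktuple.
Qed.

Lemma known_Z_z (k : 'I_n) : measurable_fun setT (Z z n : leave_one_out X stat_z n k -> _).
Proof.
apply/measurable_fun_tnthP => i.
rewrite (_ : _ \o _ = (fun w => id (stat_z (X i w)))); last first.
  by apply/funext => w; rewrite /= tnth_mktuple.
have [->|ik] := eqVneq i k; first exact: leave_one_out_stat.
apply: (@measurableT_comp _ _ _ _ _ _ stat_z); first exact: measurable_stat_z.
exact: leave_one_out_obs.
Qed.

Lemma known_Z_xz (k : 'I_n) : measurable_fun setT (Z z n : leave_one_out X stat_xz n k -> _).
Proof.
apply/measurable_fun_tnthP => i.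
rewrite (_ : _ \o _ = (fun w => snd (stat_xz (X i w)))); last first.
  by apply/funext => w; rewrite /= tnth_mktuple.
apply: (@measurableT_comp _ _ _ _ _ _ snd) => //.
have [->|ik] := eqVneq i k; first exact: leave_one_out_stat.
apply: (@measurableT_comp _ _ _ _ _ _ stat_xz); first exact: measurable_stat_xz.
exact: leave_one_out_obs.
Qed.

Lemma score_mean a : is_cond_expectation P (Z z n) (score_sum a) (cst 0).
Proof.
apply: cond_expectation_of_orth.
- exact: measurable_Z.
- exact: L2_L1 (score_sum_L2 a).
- exact: measurable_cst.
- exact: L1_cst.
move=> B mB.
have mI : measurable_fun setT (\1_B : n.-tuple (dz.-tuple R) -> R) by exact: measurable_indic.
have U1 w : `|\1_B (Z z n w) : R| <= 1.
  by rewrite indicE; case: (_ \in _); rewrite ?normr1 ?normr0.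
under eq_Rintegral do rewrite subr0.
exact: (@score_mean0 _ _ _ P _ _ X measurable_obs independent_obs _ _ stat_z measurable_stat_z
  _ _ stat_xz measurable_stat_xz n err measurable_err err_L4 (model_eps hmodel) kappa (reg a)
  (nreg a) (fun i => ex_intro2 _ _ (reg_xz a) (measurable_reg_xz a) (regE a i)) (Mn n)
  (@ann_known_z n) (@ann_known_xz n) (@ann_sym n) (@ann_idem n) (fun w => \1_B (Z z n w))
  (fun k => measurableT_comp mI (@known_Z_xz k)) U1 (measurableT_comp mI measurable_Z)).
Qed.

Lemma score_second_moment a b :
  is_cond_expectation P (Z z n) (fun w => score_sum a w * score_sum b w) (score_var a b).
Proof.
have LSS := L2M (score_sum_L2 a) (score_sum_L2 b).
have LV : L1 (score_var a b \o Z z n).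
  apply: L1Z; apply: L1_sum => i; apply/L2_L1/L4_L2.
  have [_ _ mV _ _] := hVz i a b.
  apply: (@L4_bounded _ _ _ _ _ kappa).
    apply: measurable_funM.
      exact: (measurableT_comp (mx_measurable_ann_t i i) measurable_Z).
    apply: (@measurableT_comp _ _ _ _ _ _ (fun t => Vz i (tnth t i) a b)); last exact: measurable_Z.
    exact: (measurableT_comp mV (measurable_tnth i)).
  move=> w; rewrite ann_tE normrM -[leRHS]mul1r ler_pM//; exact: ann_le1.
apply: cond_expectation_of_orth.
- exact: measurable_Z.
- exact: LSS.
- exact: measurable_score_var.
- exact: LV.
move=> B mB.
have mI : measurable_fun setT (\1_B : n.-tuple (dz.-tuple R) -> R) by exact: measurable_indic.
have U1 w : `|\1_B (Z z n w) : R| <= 1.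
  by rewrite indicE; case: (_ \in _); rewrite ?normr1 ?normr0.
have mZB := measurable_preimage measurable_Z mB.
have e := @score_cond_moment _ _ _ P _ _ X measurable_obs independent_obs _ _ stat_z
    measurable_stat_z
  _ _ stat_xz measurable_stat_xz n err measurable_err err_L4 (model_eps hmodel) (sigma_eps ^+ 2)
      hhom
  kappa (reg a) (reg b) (fun i t => Vz i t a b) (nreg a) (nreg b)
  (fun i => ex_intro2 _ _ (reg_xz a) (measurable_reg_xz a) (regE a i))
  (fun i => ex_intro2 _ _ (reg_xz b) (measurable_reg_xz b) (regE b i))
  (fun i => hVz i a b) (fun i t => bVz i t a b) (Mn n)
  (@ann_known_z n) (@ann_known_xz n) (@ann_sym n) (@ann_idem n) (fun w => \1_B (Z z n w))
  (fun k => measurableT_comp mI (@known_Z_z k))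
  (fun k => measurableT_comp mI (@known_Z_xz k)) U1 (measurableT_comp mI measurable_Z).
rewrite (@eq_Rintegral _ _ _ _ _ (fun w => \1_(Z z n @^-1` B) w * (score_sum a w * score_sum b w) -
   \1_(Z z n @^-1` B) w * (score_var a b (Z z n w)))); last first.
  by move=> w _; rewrite -mulrBr.
rewrite RintegralB//; [|exact: L1_indic_mul LSS mZB|exact: L1_indic_mul LV mZB].
apply/eqP; rewrite subr_eq0; apply/eqP; rewrite [LHS]e; apply: eq_Rintegral => w _.
congr (_ * (_ * _)); apply: eq_bigr => i _; rewrite ann_tE tnth_mktuple.
by [].
Qed.

(** The conditional mean of the score vanishes, so its conditional variance is the
    conditional second moment, and versions are almost surely unique. *)
Lemma score_variance (Vn : n.-tuple (dz.-tuple R) -> 'M[R]_d) :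
  {ae P, forall w, Mmx z p n (K n) w = Mn n w} ->
  is_cond_variance P (Z z n) (score y x z beta0 g h p n (K n)) Vn ->
  forall a b, {ae P, forall w, Vn (Z z n w) a b =
    sigma_eps ^+ 2 * \sum_i Mn n w i i * Vz i (z i w) a b}.
Proof.
move=> MM [mu [hmu hVn]] a b.
have mS c : measurable_fun setT (score_sum c) by exact: (proj1 (score_sum_L2 c)).
have mu0 c : {ae P, forall w, mu (Z z n w) c 0 = 0}.
  have hc := hmu c 0; have [_ _ mm _ _] := hc.
  apply: (@cond_expectation_unique _ _ _ P _ _ (Z z n) (score_sum c) (fun t => mu t c 0) (cst 0)).
    apply: ae_is_cond_expectation hc => //; last exact: aeW.
    by apply: filterS MM => w; exact: score_entry.
  exact: score_mean.
have hab := hVn a b; have [_ _ mV _ _] := hab.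
have hS : is_cond_expectation P (Z z n) (fun w => score_sum a w * score_sum b w)
    (fun t => Vn t a b).
  apply: ae_is_cond_expectation hab => //.
  - exact: measurable_funM.
  - apply: filterS3 MM (mu0 a) (mu0 b) => w MMw ma mb.
    rewrite mxE big_ord1 [X in _ * X]mxE.
    have sub0 c : mu (Z z n w) c 0 = 0 ->
        (score y x z beta0 g h p n (K n) w - mu (Z z n w)) c 0 = score_sum c w.
      move=> m0; rewrite mxE [X in _ + X]mxE m0 subr0; exact: score_entry.
    by rewrite !sub0.
  - exact: aeW.
apply: filterS (cond_expectation_unique hS (score_second_moment a b)) => w ->.
rewrite /score_var; congr (_ * _); apply: eq_bigr => i _; rewrite ann_tE tnth_mktuple.
by [].
Qed.
End ScoreVariance.

(** * Consistency of the variance estimators *)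

Section Limits.
Variables (kappa c : R) (Vz : nat -> dz.-tuple R -> 'M[R]_d).
Hypothesis nreg : forall a, noise P X stat_z kappa (reg a).
Hypothesis nerr : noise P X stat_z kappa err.
Hypothesis c_gt0 : 0 < c.
Hypothesis sigma_le : sigma_eps ^+ 2 <= kappa.
Hypothesis hVz : forall i a b, is_cond_expectation P (stat_z \o X i)
  (fun w => reg a i (X i w) * reg b i (X i w)) (fun t => Vz i t a b).
Hypothesis bVz : forall i t a b, `|Vz i t a b| <= kappa.
Hypothesis posVz : forall i, {ae P, forall w, forall t,
  c * \sum_a t a ^+ 2 <= bil (Vz i (z i w)) t t}.

Local Notation regressor a := (add_effect (reg a) (h_effect a)).
Local Notation disturbance := (add_effect err g_effect).
Local Notation Vab a b := (fun i t => Vz i t a b).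
Local Notation sigma2 := (sigma_eps ^+ 2).
Let csigma : nat -> dz.-tuple R -> R := fun _ _ => sigma2.

Let kappa_ge0 : 0 <= kappa.
Proof. exact: le_trans (sqr_ge0 _) sigma_le. Qed.

Let csigma_le i s : `|csigma i s| <= kappa.
Proof. by rewrite ger0_norm ?sqr_ge0. Qed.

Let err_sqr i : is_cond_expectation P (stat_z \o X i)
  (fun w => err i (X i w) * err i (X i w)) (csigma i).
Proof.
have := coarser_cond_expectation measurable_snd (hhom i).
by rewrite (_ : (fun w => _ ^+ 2) = (fun w => err i (X i w) * err i (X i w))).
Qed.

Let form_reg_bounded a : \forall t \near F, form (reg a) (reg a) t <= kappa + 1.
Proof. exact: form_noise_bounded (nreg a) (fun i => hVz i a a) (fun i t => bVz i t a a). Qed.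

Let form_err_bounded : \forall t \near F, form err err t <= kappa + 1.
Proof. exact: form_noise_bounded nerr err_sqr csigma_le. Qed.

(** x = v + h: the form in v is asymptotic to its conditional mean, and every form
    that involves h is negligible. *)
Lemma Gamma_cvg a b :
  form (regressor a) (regressor b) t - weighted_diag (Vab a b) t @[t --> F] --> 0.
Proof.
have l1 := form_noise_cvg (nreg a) (nreg b) (fun i => hVz i a b) (fun i t => bVz i t a b).
have l2 := form_cross_cvg0 (form_h_cvg0 b) (form_reg_bounded a).
have l3 := form_cross_cvg0 (form_h_cvg0 a) (form_reg_bounded b).
have b4 : \forall t \near F, form (h_effect b) (h_effect b) t <= 1.
  have /cvgrPdist_le/(_ _ ltr01) := form_h_cvg0 b; apply: (@filterS _ F) => t.
  by rewrite sub0r normrN; apply: le_trans; exact: ler_norm.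
have l4 := form_cross_cvg0 (form_h_cvg0 a) b4.
rewrite (_ : (fun t => _) = fun t => (form (reg a) (reg b) t - weighted_diag (Vab a b) t)
   + form (h_effect b) (reg a) t + form (h_effect a) (reg b) t +
       form (h_effect a) (h_effect b) t); last first.
  by apply/funext => t; rewrite formDD (formC (h_effect b)); ring.
rewrite -[X in _ --> X]addr0; apply: cvgD => //.
rewrite -[X in _ --> X]addr0; apply: cvgD => //.
by rewrite -[X in _ --> X]addr0; apply: cvgD.
Qed.

Lemma cross_cvg a : form (regressor a) disturbance t @[t --> F] --> 0.
Proof.
have b0 (i : nat) t : `|(cst 0 : dz.-tuple R -> R) t| <= kappa by rewrite normr0.
have l1 := form_noise_cvg (nreg a) nerr (reg_err_orth a) b0.
have l2 := form_cross_cvg0 form_g_cvg0 (form_reg_bounded a).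
have l3 := form_cross_cvg0 (form_h_cvg0 a) form_err_bounded.
have b4 : \forall t \near F, form g_effect g_effect t <= 1.
  have /cvgrPdist_le/(_ _ ltr01) := form_g_cvg0; apply: (@filterS _ F) => t.
  by rewrite sub0r normrN; apply: le_trans; exact: ler_norm.
have l4 := form_cross_cvg0 (form_h_cvg0 a) b4.
rewrite (_ : (fun t => _) = fun t => (form (reg a) err t - weighted_diag (fun=> cst 0) t)
   + form g_effect (reg a) t + form (h_effect a) err t + form (h_effect a) g_effect t); last first.
  apply/funext => t; rewrite formDD (formC g_effect) /weighted_diag.
  by rewrite [X in _ * X]big1 ?mulr0 ?subr0// => i _; rewrite mulr0.
rewrite -[X in _ --> X]addr0; apply: cvgD => //.
rewrite -[X in _ --> X]addr0; apply: cvgD => //.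
by rewrite -[X in _ --> X]addr0; apply: cvgD.
Qed.

Lemma disturbance_cvg : form disturbance disturbance t - weighted_diag csigma t @[t --> F] --> 0.
Proof.
have l1 := form_noise_cvg nerr nerr err_sqr csigma_le.
have l2 := form_cross_cvg0 form_g_cvg0 form_err_bounded.
have l3 := form_g_cvg0.
rewrite (_ : (fun t => _) = fun t => (form err err t - weighted_diag csigma t)
   + form g_effect err t + form g_effect err t + form g_effect g_effect t); last first.
  by apply/funext => t; rewrite formDD (formC err g_effect); ring.
rewrite -[X in _ --> X]addr0; apply: cvgD => //.
rewrite -[X in _ --> X]addr0; apply: cvgD => //.
by rewrite -[X in _ --> X]addr0; apply: cvgD.
Qed.

Lemma inprob_full_rank : \forall t \near F,
  Mmx z p t.1 (K t.1) t.2 = Mn t.1 t.2 /\ \tr (Mn t.1 t.2) = t.1%:R - (K t.1)%:R.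
Proof.
have [hr _] := PLM_d hPLM.
have := @inprob_ae _ _ _ P (fun n w => \rank (Pmx z p n (K n) w) = K n) hr.
apply: (@filterS _ F) => t /gram_full_rank u.
have e : Mmx z p t.1 (K t.1) t.2 = Mn t.1 t.2 by rewrite /ann /annihilator0 u.
by split => //; rewrite -e; exact: annihilator_trace.
Qed.

Lemma inprob_diag_lower : exists2 C : R, 0 < C & \forall t \near F,
  forall i, C <= Mmx z p t.1 (K t.1) t.2 i i.
Proof.
have [_ [C C0 hC]] := PLM_d hPLM; exists C => //.
apply: (@inprob_event _ _ _ P (fun n => [set w | forall i : 'I_n, C <= Mmx z p n (K n) w i i])) hC.
move=> n.
rewrite (_ : [set w | _] = \bigcap_(i in [set: 'I_n]) [set w | C <= Mmx z p n (K n) w i i]).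
  apply: fin_bigcap_measurable => // i _.
  rewrite -[[set _ | _]]setTI (_ : [set w | _] =
      (fun w => C <= Mmx z p n (K n) w i i) @^-1` [set true]).
    apply: measurable_fun_ler => //.
    apply: mx_measurable_annihilator => a b; under eq_fun do rewrite mxE.
    exact: measurableT_comp.
  by apply/seteqP; split.
by apply/seteqP; split => [w /= hw i _|w /= hw i]; [exact: hw|exact: (hw i I)].
Qed.

Lemma regressorE a i w : regressor a i (X i w) = xc x i w a 0.
Proof. by rewrite /add_effect /reg /h_effect !mxE subrK. Qed.

Lemma gram_form n w a b : (0 < n)%N ->
  gram (Mn n w) (fun i : 'I_n => xc x i w) a b =
  n%:R * form (regressor a) (regressor b) (n, w).
Proof.
move=> n0; rewrite gramE /form /= mulrA divff ?mul1r ?pnatr_eq0 -?lt0n//.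
apply: eq_bigr => i _; apply: eq_bigr => j _.
by rewrite -!regressorE.
Qed.

Lemma outcome_decomposition i w : y i w = dotv (xc x i w) beta0 + disturbance i (X i w).
Proof. by rewrite /add_effect /err /g_effect /= -/(xc x i w); ring. Qed.

(** With M_ii >= C and E[v_i v_i' | z_i] >= c the limit n^-1 * sum_i M_ii E[v_i v_i' | z_i] is
    at least C c as a quadratic form.  Half of it remains once all entries
    of the Gram matrix are close enough to the limit. *)
Lemma gram_pos_def : exists2 C : R, 0 < C & \forall t \near F,
  forall u, C * t.1%:R * \sum_a u a ^+ 2 <=
    bil (gram (Mn t.1 t.2) (fun i : 'I_t.1 => xc x i t.2)) u u.
Proof.
have [C C0 hC] := inprob_diag_lower.
exists (C * c / 2); first by rewrite divr_gt0// mulr_gt0.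
(* An entrywise error eta changes a quadratic form by at most eta * d * |u|^2;
   the extra 1 keeps eta finite when d = 0. *)
pose eta := C * c / (2 * (d%:R + 1)).
have d1 : 0 < d%:R + 1 :> R by rewrite ltr_wpDl.
have eta0 : 0 < eta by rewrite divr_gt0// mulr_gt0.
have hG : \forall t \near F, forall ab : 'I_d * 'I_d,
    `|form (regressor ab.1) (regressor ab.2) t - weighted_diag (Vab ab.1 ab.2) t| <= eta.
  apply: filter_forall => ab.
  have /cvgrPdist_le/(_ _ eta0) := Gamma_cvg ab.1 ab.2.
  by apply: (@filterS _ F) => t; rewrite sub0r normrN.
have hV : \forall t \near F, forall i, forall u,
    c * \sum_a u a ^+ 2 <= bil (Vz i (z i t.2)) u u.
  apply: (@inprob_ae _ _ _ P (fun _ w => forall i, forall u,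
    c * \sum_a u a ^+ 2 <= bil (Vz i (z i w)) u u)).
  by apply: nearW => _; exact: ae_foralln.
have hn : \forall t \near F, (0 < t.1)%N.
  by apply: (@inprob_near _ _ _ P (fun n => (0 < n)%N)); exact: (nbhs_infty_gt 0).
near=> t => u.
have n0 : (0 < t.1)%N by near: t.
have nR : 0 < t.1%:R :> R by rewrite ltr0n.
have MM : Mmx z p t.1 (K t.1) t.2 = Mn t.1 t.2.
  by have [] : Mmx z p t.1 (K t.1) t.2 = Mn t.1 t.2 /\
    \tr (Mn t.1 t.2) = t.1%:R - (K t.1)%:R by near: t; exact: inprob_full_rank.
have Mii i : C <= Mn t.1 t.2 i i by rewrite -MM; move: i; near: t.
have Gt (ab : 'I_d * 'I_d) : `|form (regressor ab.1) (regressor ab.2) t -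
    weighted_diag (Vab ab.1 ab.2) t| <= eta.
  by move: ab; near: t.
have Vt i v : c * \sum_a v a ^+ 2 <= bil (Vz i (z i t.2)) v v.
  by move: i v; near: t.
set q := \sum_a u a ^+ 2.
have q0 : 0 <= q by apply: sumr_ge0 => a _; exact: sqr_ge0.
have -> : bil (gram (Mn t.1 t.2) (fun i : 'I_t.1 => xc x i t.2)) u u =
    t.1%:R * \sum_a \sum_b form (regressor a) (regressor b) t * (u a * u b).
  rewrite mulr_sumr; apply: eq_bigr => a _; rewrite mulr_sumr; apply: eq_bigr => b _.
  by rewrite gram_form// -surjective_pairing -mulrA.
rewrite [leLHS](_ : _ = t.1%:R * (C * c / 2 * q)); last by ring.
rewrite ler_wpM2l//.
have main : C * c * q <= \sum_a \sum_b weighted_diag (Vab a b) t * (u a * u b).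
  have -> : \sum_a \sum_b weighted_diag (Vab a b) t * (u a * u b) =
      t.1%:R^-1 * \sum_i Mn t.1 t.2 i i * bil (Vz i (z i t.2)) u u.
    transitivity (\sum_a \sum_b \sum_i t.1%:R^-1 * (Mn t.1 t.2 i i * (Vz i (z i t.2) a b * (u a
        * u b)))).
      apply: eq_bigr => a _; apply: eq_bigr => b _.
      rewrite /weighted_diag mulr_sumr mulr_suml; apply: eq_bigr => i _; ring.
    under eq_bigr do rewrite exchange_big/=.
    rewrite exchange_big/= mulr_sumr; apply: eq_bigr => i _.
    rewrite !mulr_sumr; apply: eq_bigr => a _.
    by rewrite !mulr_sumr.
  rewrite ler_pdivlMl//.
  have -> : t.1%:R * (C * c * q) =
      \sum_(i < t.1) C * c * q by rewrite sumr_const card_ord mulr_natl.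
  apply: ler_sum => i _; rewrite -mulrA; apply: ler_pM; [exact: ltW| |exact: Mii|exact: Vt].
  by rewrite mulr_ge0// ltW.
have err_le : `|\sum_a \sum_b form (regressor a) (regressor b) t * (u a * u b) -
    \sum_a \sum_b weighted_diag (Vab a b) t * (u a * u b)| <= eta * (d%:R * q).
  rewrite -sumrB; apply: le_trans (ler_norm_sum _ _ _) _.
  apply: (@le_trans _ _ (\sum_(a < d) \sum_(b < d) eta * ((u a ^+ 2 + u b ^+ 2) / 2))).
    apply: ler_sum => a _; rewrite -sumrB; apply: le_trans (ler_norm_sum _ _ _) _.
    apply: ler_sum => b _; rewrite -mulrBl normrM; apply: ler_pM => //; first exact: (Gt (a, b)).
    rewrite ler_norml; have := sqr_ge0 (u a - u b); have := sqr_ge0 (u a + u b).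
    by move=> *; apply/andP; split; lra.
  rewrite le_eqVlt; apply/orP; left; apply/eqP.
  transitivity (\sum_(a < d) (eta / 2) * (u a ^+ 2 * d%:R + q)).
    apply: eq_bigr => a _.
    rewrite (_ : u a ^+ 2 * d%:R = \sum_(b < d) u a ^+ 2); last first.
      by rewrite sumr_const card_ord mulr_natr.
    rewrite /q -big_split/= mulr_sumr; apply: eq_bigr => b _; ring.
  rewrite -mulr_sumr big_split/= -mulr_suml -/q sumr_const card_ord -mulr_natl; by field.
have etad : eta * (d%:R * q) <= C * c / 2 * q.
  rewrite mulrA ler_wpM2r// /eta -[leRHS]mulr1 invfM.
  rewrite (_ : C * c * (2^-1 * (d%:R + 1)^-1) * d%:R = C * c / 2 * (d%:R / (d%:R + 1)));
      last by field; rewrite gt_eqF.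
  rewrite ler_wpM2l ?divr_ge0 ?mulr_ge0 ?(ltW C0) ?(ltW c_gt0)//.
  by rewrite ler_pdivrMr// mul1r lerDl.
move: err_le; rewrite ler_norml => /andP[lo _]; lra.
Unshelve. all: by end_near. Qed.

(** Bounds |RSS - sigma^2 (n - K)| / n when the Gram matrix is at least C n as a form. *)
Definition gap C t : R := `|form disturbance disturbance t - weighted_diag csigma t| +
  C^-1 * \sum_a form (regressor a) disturbance t ^+ 2.

(** With D = n - d - K, s^2 - sigma^2 is (RSS - D sigma^2) / D.  The numerator is at
    most n times the gap plus d sigma^2.  The trace of M gives n - K >= C1 n, so
    D >= C1 n / 2 for large n. *)
Lemma s2_error C C1 e n w : 0 < e -> 0 < C -> 0 < C1 ->
  Mmx z p n (K n) w = Mn n w -> \tr (Mn n w) = n%:R - (K n)%:R ->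
  1 <= n%:R :> R -> 2 * d%:R / C1 <= n%:R ->
  d%:R * sigma2 / (e * C1 / 4) <= n%:R ->
  (forall i, C1 <= Mn n w i i) -> gap C (n, w) <= e * C1 / 4 ->
  (forall u, C * n%:R * \sum_a u a ^+ 2 <=
    bil (gram (Mn n w) (fun i : 'I_n => xc x i w)) u u) ->
  defined x z p n (K n) w /\ `|s2_plm y x z p n (K n) w - sigma2| <= e.
Proof.
move=> e0 C0 C10 MM tr n1 n2 n3 Mii; set delta := e * C1 / 4 => Bt hP.
have delta0 : 0 < delta by rewrite divr_gt0// mulr_gt0.
have nR : 0 < n%:R :> R by exact: lt_le_trans ltr01 n1.
have Cn : 0 < C * n%:R by rewrite mulr_gt0.
split; first by rewrite /defined /= MM; exact: pos_def_unit Cn hP.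
rewrite /s2_plm /s2 MM.
have := @residual_sum_sqr_bounds _ _ _ (Mn n w) (fun i : 'I_n => xc x i w)
  (annihilator0_sym _) (annihilator0_idem _) (fun i : 'I_n => y i w)
  (fun i : 'I_n => disturbance i (X i w)) beta0 (fun i => outcome_decomposition i w) _ Cn hP.
set rss := \sum_i residual _ _ _ _ ^+ 2.
have bilE (u v : nat -> OBS -> R) :
    bil (Mn n w) (fun i : 'I_n => u i (X i w)) (fun i : 'I_n => v i (X i w)) =
    n%:R * form u v (n, w) by rewrite /form mulrA divff ?mul1r// gt_eqF.
have xE a : bil (Mn n w) (fun i : 'I_n => xc x i w a 0) (fun i : 'I_n => disturbance i (X i w)) =
    n%:R * form (regressor a) disturbance (n, w).
  by rewrite -bilE; apply: eq_bigr => i _; apply: eq_bigr => j _; rewrite -regressorE.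
rewrite (bilE disturbance disturbance).
rewrite (eq_bigr (fun a => n%:R ^+ 2 * form (regressor a) disturbance (n, w) ^+ 2)); last first.
  by move=> a _; rewrite xE exprMn.
rewrite -mulr_sumr; set Q := \sum_a _ => rss_le.
have nwd : n%:R * weighted_diag csigma (n, w) = (n%:R - (K n)%:R) * sigma2.
  by rewrite /weighted_diag mulrA divff ?gt_eqF// mul1r -tr /mxtrace mulr_suml.
have diag_ge : C1 * n%:R <= n%:R - (K n)%:R.
  rewrite -tr /mxtrace (_ : C1 * n%:R = \sum_(i < n) C1); last first.
    by rewrite sumr_const card_ord mulr_natr.
  exact: ler_sum.
have n2' : 2 * d%:R <= C1 * n%:R by rewrite [leRHS]mulrC -ler_pdivrMr.
have n3' : d%:R * sigma2 <= n%:R * delta by rewrite -ler_pdivrMr.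
set D := n%:R - d%:R - (K n)%:R.
have D_ge : C1 * n%:R / 2 <= D by rewrite /D; lra.
have D0 : 0 < D by apply: lt_le_trans D_ge; rewrite divr_gt0// mulr_gt0.
have rss_gap : `|rss - D * sigma2| <= 2 * (n%:R * delta).
  have -> : rss - D * sigma2 = (rss - n%:R * form disturbance disturbance (n, w)) +
      n%:R * (form disturbance disturbance (n, w) - weighted_diag csigma (n, w)) + d%:R * sigma2.
    by rewrite mulrBr nwd /D; ring.
  apply: le_trans (ler_normD _ _) _; rewrite [X in _ + X]ger0_norm; last first.
    by rewrite mulr_ge0// sqr_ge0.
  have := ler_normD (rss - n%:R * form disturbance disturbance (n, w))
    (n%:R * (form disturbance disturbance (n, w) - weighted_diag csigma (n, w))).
  rewrite [X in _ <= _ + X]normrM (gtr0_norm nR).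
  have rss_le' : `|rss - n%:R * form disturbance disturbance (n, w)| <= n%:R * (C^-1 * Q).
    apply: le_trans rss_le _; rewrite le_eqVlt; apply/orP; left; apply/eqP; field.
    by rewrite !gt_eqF.
  have := ler_wpM2l (ltW nR) Bt; rewrite /gap -/Q mulrDr; lra.
have -> : D^-1 * rss - sigma2 = D^-1 * (rss - D * sigma2).
  by field; rewrite gt_eqF.
rewrite normrM gtr0_norm ?invr_gt0// ler_pdivrMl//.
apply: le_trans rss_gap _.
have -> : 2 * (n%:R * delta) = C1 * n%:R / 2 * e by rewrite /delta; field.
by rewrite ler_wpM2r// ltW.
Qed.

Lemma s2_limit e : 0 < e -> \forall t \near F,
  defined x z p t.1 (K t.1) t.2 /\ `|s2_plm y x z p t.1 (K t.1) t.2 - sigma2| <= e.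
Proof.
move=> e0.
have [C C0 hC] := gram_pos_def; have [C1 C10 hC1] := inprob_diag_lower.
pose delta := e * C1 / 4.
have delta0 : 0 < delta by rewrite divr_gt0// mulr_gt0.
have B0 : gap C t @[t --> F] --> 0.
  rewrite -[X in _ --> X]addr0; apply: cvgD.
    by rewrite -[X in _ --> X](@normr0 _ R); apply: cvg_norm; exact: disturbance_cvg.
  rewrite -[X in _ --> X](mulr0 C^-1); apply: cvgMl_tmp.
  have sq0 a : form (regressor a) disturbance t ^+ 2 @[t --> F] --> 0.
    have := cvg_comp _ _ (cross_cvg a) (@exprn_continuous R 2 0).
    by rewrite expr0n.
  have := @cvg_sum R _ F (inprob_filter P) 'I_d (index_enum _)
      (fun a t => form (regressor a) disturbance t ^+ 2) (fun=> 0) sq0.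
  by rewrite big1.
have hB : \forall t \near F, gap C t <= delta.
  have /cvgrPdist_le/(_ _ delta0) := B0; apply: (@filterS _ F) => t.
  by rewrite sub0r normrN; apply: le_trans; exact: ler_norm.
have hn (A : R) : \forall t \near F, A <= t.1%:R.
  by apply: (@inprob_near _ _ _ P (fun n => A <= n%:R)); exact: nbhs_infty_ger.
have hfull := inprob_full_rank.
near=> t.
have [MM tr] : Mmx z p t.1 (K t.1) t.2 = Mn t.1 t.2 /\
    \tr (Mn t.1 t.2) = t.1%:R - (K t.1)%:R by near: t.
have n1 : 1 <= t.1%:R :> R by near: t; exact: hn.
have n2 : 2 * d%:R / C1 <= t.1%:R by near: t; exact: hn.
have n3 : d%:R * sigma2 / delta <= t.1%:R by near: t; exact: hn.
have Mii i : C1 <= Mn t.1 t.2 i i by rewrite -MM; move: i; near: t.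
have Bt : gap C (t.1, t.2) <= delta by rewrite -surjective_pairing; near: t.
have hP u : C * t.1%:R * \sum_a u a ^+ 2 <=
    bil (gram (Mn t.1 t.2) (fun i : 'I_t.1 => xc x i t.2)) u u by move: u; near: t.
exact: (s2_error e0 C0 C10 MM tr n1 n2 n3 Mii Bt hP).
Unshelve. all: by end_near. Qed.

(** s^2 Gamma - sigma^2 W is
    (s^2 - sigma^2) (Gamma - W) + sigma^2 (Gamma - W) + (s^2 - sigma^2) W,
    where W = n^-1 * sum_i M_ii E[v_i v_i' | z_i] is bounded. *)
Lemma Sigma_HOM_limit e : 0 < e -> \forall t \near F, forall a b,
  `|s2_plm y x z p t.1 (K t.1) t.2 *
      (t.1%:R^-1 * gram (Mmx z p t.1 (K t.1) t.2) (fun i : 'I_t.1 => xc x i t.2) a b)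
    - sigma2 * weighted_diag (Vab a b) t| <= e.
Proof.
move=> e0; have k1 : 0 < 2 * (kappa + 1) by rewrite mulr_gt0// ltr_wpDl.
pose d1 := Num.min 1 (e / (2 * (kappa + 1))).
have d10 : 0 < d1 by rewrite lt_min ltr01 divr_gt0.
have hG : \forall t \near F, forall ab : 'I_d * 'I_d,
    `|form (regressor ab.1) (regressor ab.2) t - weighted_diag (Vab ab.1 ab.2) t| <= d1.
  apply: filter_forall => ab.
  have /cvgrPdist_le/(_ _ d10) := Gamma_cvg ab.1 ab.2.
  by apply: (@filterS _ F) => t; rewrite sub0r normrN.
have hn : \forall t \near F, (0 < t.1)%N.
  by apply: (@inprob_near _ _ _ P (fun n => (0 < n)%N)); exact: (nbhs_infty_gt 0).
have hfull := inprob_full_rank; have hs := s2_limit d10.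
near=> t => a b.
have [MM _] : Mmx z p t.1 (K t.1) t.2 = Mn t.1 t.2 /\
    \tr (Mn t.1 t.2) = t.1%:R - (K t.1)%:R by near: t.
have n0 : (0 < t.1)%N by near: t.
have Gt (ab : 'I_d * 'I_d) : `|form (regressor ab.1) (regressor ab.2) t -
    weighted_diag (Vab ab.1 ab.2) t| <= d1.
  by move: ab; near: t.
have [_ st] : defined x z p t.1 (K t.1) t.2 /\
  `|s2_plm y x z p t.1 (K t.1) t.2 - sigma2| <= d1 by near: t.
rewrite MM gram_form// [_^-1 * (_ * _)]mulrA mulVf ?mul1r ?pnatr_eq0 -?lt0n// -surjective_pairing.
have wd : `|weighted_diag (Vab a b) t| <= kappa by exact: wdiag_le (fun i s => bVz i s a b).
have := Gt (a, b) => /=; move: st wd.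
set s := s2_plm _ _ _ _ _ _ _; set f := form _ _ _; set W := weighted_diag _ _ => st wd fW.
have -> : s * f - sigma2 * W = (s - sigma2) * (f - W) + sigma2 * (f - W) + (s - sigma2) * W by ring.
have d1le : d1 <= 1 by rewrite ge_min lexx.
have d1e : d1 <= e / (2 * (kappa + 1)) by rewrite ge_min lexx orbT.
rewrite ler_pdivlMr// in d1e.
have m1 : `|(s - sigma2) * (f - W)| <= 1 * d1.
  by rewrite normrM ler_pM// (le_trans st).
have m2 : `|sigma2 * (f - W)| <= kappa * d1.
  by rewrite normrM ler_pM// ger0_norm// sqr_ge0.
have m3 : `|(s - sigma2) * W| <= d1 * kappa by rewrite normrM ler_pM.
have := ler_normD ((s - sigma2) * (f - W) + sigma2 * (f - W)) ((s - sigma2) * W).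
have := ler_normD ((s - sigma2) * (f - W)) (sigma2 * (f - W)).
have : 0 <= d1 by exact: ltW.
move: kappa_ge0; nra.
Unshelve. all: by end_near. Qed.
End Limits.
End PLM.

Theorem theorem2 (R : realType) (dO : measure_display)
    (Omega : measurableType dO) (P : probability Omega R) (d dz : nat)
    (y : nat -> {RV P >-> R}) (x : nat -> {RV P >-> d.-tuple R})
    (z : nat -> {RV P >-> dz.-tuple R})
    (beta0 : 'cV[R]_d) (g : {mfun (dz.-tuple R) >-> R})
    (h : dz.-tuple R -> 'cV[R]_d) (p : nat -> {mfun (dz.-tuple R) >-> R})
    (K : nat -> nat) (alpha_g alpha_h sigma_eps : R)
    (V : forall n, n.-tuple (dz.-tuple R) -> 'M[R]_d)
    (Sigma : nat -> Omega -> 'M[R]_d)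
    (hmodel : model y x z beta0 g h)
    (hPLM : assumption_PLM y x z beta0 g h p K alpha_g alpha_h)
    (hK : (fun n => (K n)%:R `^ (2 * (alpha_g + alpha_h)) / n%:R : R) @ \oo
            --> +oo)
    (hhom : forall i, is_cond_expectation P (xz x z i)
              (fun w => eps y x z beta0 g i w ^+ 2) (cst (sigma_eps ^+ 2)))
    (hV : \forall n \near \oo,
            is_cond_variance P (Z z n) (score y x z beta0 g h p n (K n)) (V n))
    (hSigma : forall n w, Sigma n w = n%:R^-1 *: V n (Z z n w)) :
  cvg_in_prob P (fun n => defined x z p n (K n))
    (fun n => s2_plm y x z p n (K n)) (sigma_eps ^+ 2) /\
  cvg_in_prob P (fun n => defined x z p n (K n))
    (fun n w => Sigma_HOM_plm y x z p n (K n) w - Sigma n w) 0.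
Proof.
have [c c0 [k0 [Vz hVz]]] := cond_cov hmodel hPLM.
have [k1 nreg] := reg_noise hmodel hPLM; have [k2 nerr] := err_noise hmodel hPLM hhom.
pose kappa := Num.max (Num.max k0 k1) (Num.max k2 (sigma_eps ^+ 2)).
have kk0 : k0 <= kappa by rewrite !le_max lexx.
have kk1 : k1 <= kappa by rewrite !le_max lexx orbT.
have kk2 : k2 <= kappa by rewrite !le_max lexx !orbT.
have kks : sigma_eps ^+ 2 <= kappa by rewrite !le_max lexx !orbT.
have nr a := noise_weaken kk1 (nreg a).
have ne := noise_weaken kk2 nerr.
have hVz1 i := let: And3 h1 _ _ := hVz i in h1.
have bVz i t a b : `|Vz i t a b| <= kappa.
  by have [_ hb _] := hVz i; exact: le_trans (hb t a b) kk0.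
have pVz i := let: And3 _ _ h3 := hVz i in h3.
have s2lim := s2_limit hmodel hPLM hhom hK nr ne c0 kks hVz1 bVz pVz.
have Slim := Sigma_HOM_limit hmodel hPLM hhom hK nr ne c0 kks hVz1 bVz pVz.
have mP n : mx_measurable (fun w => Mmx z p n (K n) w).
  apply: mx_measurable_annihilator => i j; under eq_fun do rewrite mxE.
  exact: measurableT_comp.
have mx n (i : 'I_n) : mx_measurable (fun w => xc x i w).
  move=> a b; rewrite ord1.
  by apply: (measurableT_comp (measurable_col_of_tuple a)).
have my n (i : 'I_n) : measurable_fun setT (fun w => y i w) by [].
have mD n : measurable (defined x z p n (K n)).
  rewrite -[X in measurable X]setTI.
  exact: (measurable_unitmx (mx_measurable_gram (mP n) (mx n))).
have ms n : measurable_fun setT (fun w => s2_plm y x z p n (K n) w).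
  exact: (measurable_s2 (K n) (mP n) (mx n) (my n)).
have score_var : \forall t \near inprob P, forall a b, V t.1 (Z z t.1 t.2) a b =
    sigma_eps ^+ 2 * \sum_i ann z p K t.1 t.2 i i * Vz i (z i t.2) a b.
  apply: (@inprob_ae _ _ _ P (fun n w => forall a b, V n (Z z n w) a b =
    sigma_eps ^+ 2 * \sum_i ann z p K n w i i * Vz i (z i w) a b)).
  have [hr _] := PLM_d hPLM.
  apply: filterS2 hV hr => n hVn rn.
  have MM : {ae P, forall w, Mmx z p n (K n) w = ann z p K n w}.
    by apply: filterS rn => w /gram_full_rank u; rewrite /ann /annihilator0 u.
  have sv := score_variance hmodel hPLM hhom nr hVz1 bVz MM hVn.
  suff : {ae P, forall w, forall ab : 'I_d * 'I_d, V n (Z z n w) ab.1 ab.2 =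
      sigma_eps ^+ 2 * \sum_i ann z p K n w i i * Vz i (z i w) ab.1 ab.2}.
    by apply: filterS => w hw a b; exact: (hw (a, b)).
  by apply: filter_forall => ab; exact: sv.
split; apply: cvg_in_prob_inprob => e e0.
- apply: nearW => n; apply: measurableI => //.
  rewrite -[X in measurable X]setTI
    (_ : [set w | _] = (fun w => `|s2_plm y x z p n (K n) w -
        sigma_eps ^+ 2| <= e) @^-1` [set true]).
    apply: measurable_fun_ler => //; apply: measurableT_comp => //.
    exact: measurable_funB.
  by apply/seteqP; split.
- exact: s2lim.
- apply: filterS hV => n [mu [_ hVn]]; apply: measurableI => //.
  under eq_set do rewrite subr0.
  apply: measurable_mx_norm_le; first exact: ltW.
  apply: mx_measurableB.
    apply: mx_measurableZ; first exact: ms.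
    by apply: mx_measurableZ => //; exact: mx_measurable_gram.
  move=> a b; under eq_fun do rewrite hSigma mxE.
  apply: measurable_funM => //; have [mZ _ mV _ _] := hVn a b.
  exact: (measurableT_comp mV mZ).
- have h1 := s2lim _ ltr01; have h2 := Slim _ e0.
  near=> t; split.
    have [] : defined x z p t.1 (K t.1) t.2 /\
      `|s2_plm y x z p t.1 (K t.1) t.2 - sigma_eps ^+ 2| <= 1 by near: t.
    by [].
  rewrite subr0; apply: mx_norm_le; first exact: ltW.
  move=> a b; rewrite mxE [X in _ + X]mxE hSigma !mxE.
  have -> : V t.1 (Z z t.1 t.2) a b =
      sigma_eps ^+ 2 * \sum_i ann z p K t.1 t.2 i i * Vz i (z i t.2) a b.
    by move: a b; near: t.
  rewrite [X in _ - X]mulrCA; move: a b; near: t; exact: h2.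
Unshelve. all: by end_near. Qed.
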